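(* Let $\gamma$ be a smooth simple closed curve in $\mathbb{R}^{2,1}$ with spacelike curvature vector which lies in a complete spacelike hypersurface of $\mathbb{R}^{2,1}$. If the torsion $\tau$ of $\gamma$ satisfies $\tau\ge 0$ everywhere (or $\tau\le 0$ everywhere), then $\tau\equiv 0$, and hence $\gamma$ lies in a plane.
   Context: $\mathbb{R}^{2,1}$ is $\mathbb{R}^3$ with coordinates $(x,y,t)$ and the Lorentzian metric $dx^2+dy^2-dt^2$; write $v\cdot w$ for the corresponding inner product and $|v|^2=v\cdot v$ (possibly negative). A tangent vector $v$ is spacelike if $|v|^2>0$, and a submanifold is spacelike if all its nonzero tangent vectors are spacelike. A spacelike hypersurface is complete if its induced Riemannian metric is complete. Curves are regular. The curvature vector of a spacelike curve parametrized by arc length $s$ is $\gamma''(s)$; having spacelike curvature vector means $|\gamma''(s)|^2>0$ for all $s$ (in particular it never vanishes), so the Frenet frame and torsion are well-defined. The cross product in $\mathbb{R}^{2,1}$ is obtained from the usual cross product of $\mathbb{R}^3$ by changing the sign of the $t$-component. The torsion is, up to an overall sign convention, $\tau=\dfrac{(\gamma'\times\gamma'')\cdot\gamma'''}{|\gamma'\times\gamma''|^2}$, with cross product, inner product and $|\cdot|^2$ taken in $\mathbb{R}^{2,1}$. *)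

(* Defs.v *)
From Stdlib Require Import Reals.
From Coquelicot Require Import Coquelicot.
Open Scope R_scope.

Notation R3 := (R * R * R)%type.

Definition px (p : R3) : R := fst (fst p).
Definition py (p : R3) : R := snd (fst p).
Definition pt (p : R3) : R := snd p.

Definition ldot (v w : R3) : R := px v * px w + py v * py w - pt v * pt w.
Definition lsq (v : R3) : R := ldot v v.

(* The Euclidean cross product with the sign of the t-component changed, so that
   ldot (lcross v w) z is the determinant of (v, w, z). *)
Definition lcross (v w : R3) : R3 :=
  (py v * pt w - pt v * py w,
   pt v * px w - px v * pt w,
   - (px v * py w - py v * px w)).

Definition spacelike (v : R3) : Prop := 0 < lsq v.

Definition vderive (c : R -> R3) (s : R) : R3 :=
  (Derive (fun u => px (c u)) s,
   Derive (fun u => py (c u)) s,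
   Derive (fun u => pt (c u)) s).

Definition smooth_curve_on (D : R -> Prop) (c : R -> R3) : Prop :=
  forall (n : nat) (s : R), D s ->
    ex_derive_n (fun u => px (c u)) n s /\
    ex_derive_n (fun u => py (c u)) n s /\
    ex_derive_n (fun u => pt (c u)) n s.

(* A smooth regular simple closed curve, as an L-periodic map on R. *)
Definition smooth_simple_closed_curve (L : R) (c : R -> R3) : Prop :=
  0 < L /\
  smooth_curve_on (fun _ => True) c /\
  (forall s, vderive c s <> zero) /\
  (forall s, c (s + L) = c s) /\
  (forall s s', 0 <= s < L -> 0 <= s' < L -> c s = c s' -> s = s').

(* The derivative with respect to arc length of a vector-valued function f
   along c. *)
Definition arc_derive (c f : R -> R3) (s : R) : R3 :=
  scal (/ sqrt (lsq (vderive c s))) (vderive f s).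

(* The second derivative of c with respect to arc length.  For c parametrized
   by arc length this is c''; the definition does not depend on the regular
   parametrization. *)
Definition curvature_vector (c : R -> R3) : R -> R3 :=
  arc_derive c (arc_derive c c).

(* This quotient is invariant under reparametrization, so that the derivatives
   may be taken in any regular parameter. *)
Definition torsion (c : R -> R3) (s : R) : R :=
  let c1 := vderive c in
  let c2 := vderive c1 in
  let c3 := vderive c2 in
  ldot (lcross (c1 s) (c2 s)) (c3 s) / lsq (lcross (c1 s) (c2 s)).

Definition smooth_map_on (U : R * R -> Prop) (phi : R * R -> R3) : Prop :=
  forall (n : nat) (u v : R), U (u, v) ->
    ex_diff_n (fun a b => px (phi (a, b))) n u v /\
    ex_diff_n (fun a b => py (phi (a, b))) n u v /\
    ex_diff_n (fun a b => pt (phi (a, b))) n u v.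

Definition immersion_on (U : R * R -> Prop) (phi : R * R -> R3) : Prop :=
  forall u v : R, U (u, v) -> forall a b : R,
    plus (scal a (vderive (fun z => phi (z, v)) u))
         (scal b (vderive (fun z => phi (u, z)) v)) = zero ->
    a = 0 /\ b = 0.

(* phi is a smooth immersion of U and a homeomorphism of U onto W, with
   inverse psi; continuity of phi on U follows from smoothness. *)
Definition local_parametrization (U : R * R -> Prop) (W : R3 -> Prop)
    (phi : R * R -> R3) (psi : R3 -> R * R) : Prop :=
  smooth_map_on U phi /\
  immersion_on U phi /\
  (forall w, U w -> W (phi w) /\ psi (phi w) = w) /\
  (forall q, W q -> U (psi q) /\ phi (psi q) = q) /\
  (forall q, W q -> filterlim psi (within W (locally q)) (locally (psi q))).

(* Smooth embedded two-dimensional submanifolds of R^3. *)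
Definition hypersurface (S : R3 -> Prop) : Prop :=
  forall p, S p ->
    exists (U : R * R -> Prop) (V : R3 -> Prop)
           (phi : R * R -> R3) (psi : R3 -> R * R),
      open U /\ open V /\ V p /\
      local_parametrization U (fun q => S q /\ V q) phi psi.

Definition tangent (S : R3 -> Prop) (p v : R3) : Prop :=
  exists (e : posreal) (c : R -> R3),
    smooth_curve_on (fun s => Rabs s < e) c /\
    (forall s, Rabs s < e -> S (c s)) /\
    c 0 = p /\ vderive c 0 = v.

Definition spacelike_submanifold (S : R3 -> Prop) : Prop :=
  forall p v, S p -> tangent S p v -> v <> zero -> spacelike v.

(* C^1 paths on [0,1] in S.  Only the restriction of c to [0,1] matters, since
   every C^1 map on [0,1] extends to a C^1 map on R.  The velocity may vanish,
   so piecewise C^1 paths are covered up to reparametrization, with the same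
   length. *)
Definition C1_path (S : R3 -> Prop) (p q : R3) (c : R -> R3) : Prop :=
  (forall s, ex_derive (fun u => px (c u)) s /\
             ex_derive (fun u => py (c u)) s /\
             ex_derive (fun u => pt (c u)) s) /\
  (forall s, continuous (vderive c) s) /\
  (forall s, 0 <= s <= 1 -> S (c s)) /\
  c 0 = p /\ c 1 = q.

Definition path_length (c : R -> R3) : R :=
  RInt (fun s => sqrt (lsq (vderive c s))) 0 1.

(* The distance of the induced metric: the infimum of the lengths of paths,
   equal to p_infty when p and q are not joined by any path in S. *)
Definition induced_dist (S : R3 -> Prop) (p q : R3) : Rbar :=
  Glb_Rbar (fun l => exists c, C1_path S p q c /\ l = path_length c).

Definition complete_submanifold (S : R3 -> Prop) : Prop :=
  forall x : nat -> R3,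
    (forall n, S (x n)) ->
    (forall eps : posreal, exists N : nat, forall m n : nat,
       (N <= m)%nat -> (N <= n)%nat ->
       Rbar_lt (induced_dist S (x m) (x n)) eps) ->
    exists p, S p /\
      forall eps : posreal, exists N : nat, forall n : nat,
        (N <= n)%nat -> Rbar_lt (induced_dist S (x n) p) eps.

Definition complete_spacelike_hypersurface (S : R3 -> Prop) : Prop :=
  hypersurface S /\ spacelike_submanifold S /\ complete_submanifold S.

Definition lies_in_plane (c : R -> R3) : Prop :=
  exists a b d h : R,
    (a, b, d) <> (0, 0, 0) /\
    forall s, a * px (c s) + b * py (c s) + d * pt (c s) = h.

(* Main.v *)
Require Import Defs.
From Stdlib Require Import Reals ZArith Lra Lia Psatz Classical ClassicalEpsilon.
From Coquelicot Require Import Coquelicot.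
Open Scope R_scope.

(** The proof compares the curve with its projection to the spatial plane.

    The projection is simple. Locally [S] is the graph of a function with gradient shorter than 1
    ([spacelike_hypersurface_graph]), so that the vertical projection of [S] does not decrease lengths.
    With completeness this allows one to lift every segment of the plane from a given point of [S]
    ([ray_lift_exists]). The endpoints of the lifts form the graph of a continuous function on the
    whole plane which lies in [S] ([entire_graph]). The curve is connected, so that it stays in that
    graph and is determined by its projection ([hypersurface_curve_projection_simple]).

    The projection is locally convex: the velocity and the curvature vector span a positive definite
    plane, which contains no vertical vector. A simple closed locally convex curve turns only once
    ([overturning_double_point]). If it turned more, the support function of the tangent lines,
    compared at angles which differ by a full turn, would have a zero. A zero is a line tangent to the
    curve at two points one turn apart, and without a double point every zero is crossed downward,
    which no periodic function allows.

    When the torsion has one sign, the osculating plane turns about the tangent line in one direction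
    only. As the projection turns once, the tangent directions at all points of the curve lie on one
    side of the osculating plane at any given point ([one_signed_torsion_planar]). The height of the
    curve over that plane is then a monotone periodic function, hence constant. So the curve is planar
    and its torsion vanishes. *)

(** * Induction on intervals and one-variable calculus *)

Lemma real_induction (P : R -> Prop) (a b : R) :
  P a ->
  (forall r, a < r <= b -> (forall r', a <= r' < r -> P r') -> P r) ->
  (forall r, a <= r < b -> (forall r', a <= r' <= r -> P r') ->
     exists d, 0 < d /\ forall r', r < r' < r + d -> r' <= b -> P r') ->
  forall r, a <= r <= b -> P r.
Proof.
  intros Pa Hlim Hright r Hr.
  set (E := fun x => a <= x <= b /\ forall y, a <= y <= x -> P y).
  destruct (completeness E) as [m [Hub Hlub]].
  { exists b. intros x [Hx _]. lra. }
  { exists a. split; [lra|]. intros y Hy. replace y with a by lra. exact Pa. }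
  assert (Ham : a <= m).
  { apply Hub. split; [lra|]. intros y Hy. replace y with a by lra. exact Pa. }
  assert (Hmb : m <= b) by (apply Hlub; intros x [Hx _]; lra).
  assert (Hbelow : forall y, a <= y < m -> P y).
  { intros y Hy. apply NNPP. intros Hn.
    assert (m <= y); [|lra].
    apply Hlub. intros x [Hx Hx']. apply Rnot_lt_le. intros Hlt.
    apply Hn, Hx'. lra. }
  assert (HPm : forall y, a <= y <= m -> P y).
  { intros y Hy. destruct (Req_dec y m) as [->|]; [|apply Hbelow; lra].
    destruct (Req_dec m a) as [->|]; [exact Pa|].
    apply Hlim; [lra|exact Hbelow]. }
  destruct (Rle_lt_dec b m) as [Hbm|Hmb']; [apply HPm; lra|].
  exfalso. destruct (Hright m) as [d [Hd Hd']]; [lra|exact HPm|].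
  set (e := Rmin (d / 2) (b - m)).
  assert (He : 0 < e <= b - m /\ e <= d / 2).
  { unfold e. unfold Rmin. destruct Rle_dec; lra. }
  assert (m + e <= m); [|lra].
  apply Hub. split; [lra|]. intros y Hy.
  destruct (Rle_lt_dec y m); [apply HPm; lra|apply Hd'; lra].
Qed.

(** The form used for closed and open conditions: truth of [P] propagates in both directions
    near each point, so that the set where it holds is closed and open in the interval. *)
Lemma interval_connected (P : R -> Prop) (a b : R) :
  P a ->
  (forall r, a <= r <= b -> exists d, 0 < d /\
     forall r1 r2, a <= r1 <= b -> a <= r2 <= b ->
       Rabs (r1 - r) < d -> Rabs (r2 - r) < d -> P r1 -> P r2) ->
  forall r, a <= r <= b -> P r.
Proof.
  intros Pa Hloc. apply real_induction; [exact Pa| |].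
  - intros r Hr Hb. destruct (Hloc r) as [d [Hd Hd']]; [lra|].
    assert (Hm : a <= Rmax a (r - d / 2) < r /\ r - d / 2 <= Rmax a (r - d / 2)).
    { unfold Rmax. destruct Rle_dec; lra. }
    apply (Hd' (Rmax a (r - d / 2)) r); [lra|lra| | |apply Hb; lra];
      apply Rabs_def1; lra.
  - intros r Hr Hb. destruct (Hloc r) as [d [Hd Hd']]; [lra|].
    exists d. split; [exact Hd|]. intros r' H1 H2.
    apply (Hd' r r'); [lra|lra| | |apply Hb; lra]; apply Rabs_def1; lra.
Qed.

Lemma continuity_pt_eps (f : R -> R) (x : R) :
  continuity_pt f x <->
  forall eps, 0 < eps -> exists d, 0 < d /\
    forall y, Rabs (y - x) < d -> Rabs (f y - f x) < eps.
Proof.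
  split.
  - intros H eps He. destruct (H eps He) as [d [Hd Hd']].
    exists d. split; [exact Hd|]. intros y Hy.
    destruct (Req_dec x y) as [->|Hn].
    + rewrite Rminus_diag, Rabs_R0. exact He.
    + apply Hd'. split; [split; [exact I|exact Hn]|exact Hy].
  - intros H eps He. destruct (H eps He) as [d [Hd Hd']].
    exists d. split; [exact Hd|]. intros y [_ Hy]. apply Hd', Hy.
Qed.

Lemma is_derive_continuity_pt (f : R -> R) (x l : R) :
  is_derive f x l -> continuity_pt f x.
Proof.
  intros H. apply continuity_pt_filterlim.
  apply (ex_derive_continuous f). exists l. exact H.
Qed.

Lemma is_derive_eps (f : R -> R) (x l : R) :
  is_derive f x l <->
  forall eps, 0 < eps -> exists d, 0 < d /\
    forall y, Rabs (y - x) < d -> Rabs (f y - f x - l * (y - x)) <= eps * Rabs (y - x).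
Proof.
  split.
  - intros H eps He. apply is_derive_Reals in H.
    destruct (H eps He) as [[d Hd] Hd']. simpl in Hd'. exists d.
    split; [exact Hd|]. intros y Hy.
    destruct (Req_dec y x) as [->|Hn].
    { rewrite !Rminus_diag, Rmult_0_r, Rminus_0_r, Rabs_R0. lra. }
    specialize (Hd' (y - x) ltac:(lra) Hy).
    replace (x + (y - x)) with y in Hd' by ring.
    replace (f y - f x - l * (y - x)) with (((f y - f x) / (y - x) - l) * (y - x))
      by (field; lra).
    rewrite Rabs_mult. apply Rmult_le_compat_r; [apply Rabs_pos|lra].
  - intros H. apply is_derive_Reals. intros eps He.
    destruct (H (eps / 2)) as [d [Hd Hd']]; [lra|].
    exists (mkposreal d Hd). intros h Hh Hhd. simpl in Hhd.
    specialize (Hd' (x + h)). replace (x + h - x) with h in Hd' by ring.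
    specialize (Hd' Hhd).
    replace ((f (x + h) - f x) / h - l) with ((f (x + h) - f x - l * h) / h) by (field; lra).
    unfold Rdiv. rewrite Rabs_mult, Rabs_inv.
    pose proof (Rabs_pos_lt h Hh) as Hp.
    apply Rle_lt_trans with (eps / 2); [|lra].
    apply Rmult_le_reg_r with (Rabs h); [exact Hp|].
    rewrite Rmult_assoc, Rinv_l by lra. lra.
Qed.

Lemma derive_pos_increasing (f f' : R -> R) (a b : R) :
  a < b ->
  (forall x, a <= x <= b -> is_derive f x (f' x)) ->
  (forall x, a < x < b -> 0 < f' x) -> f a < f b.
Proof.
  intros Hab Hd Hp.
  destruct (MVT_cor2 f f' a b Hab) as [c [Hc Hc']].
  { intros c Hc. apply is_derive_Reals, Hd, Hc. }
  specialize (Hp c Hc'). nra.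
Qed.

Lemma derive_nonneg_increasing (f f' : R -> R) (a b : R) :
  a <= b ->
  (forall x, a <= x <= b -> is_derive f x (f' x)) ->
  (forall x, a < x < b -> 0 <= f' x) -> f a <= f b.
Proof.
  intros Hab Hd Hp.
  destruct Hab as [Hab| ->]; [|lra].
  destruct (MVT_cor2 f f' a b Hab) as [c [Hc Hc']].
  { intros c Hc. apply is_derive_Reals, Hd, Hc. }
  specialize (Hp c Hc'). nra.
Qed.

Lemma derive_zero_constant (f : R -> R) :
  (forall x, is_derive f x 0) -> forall x y, f x = f y.
Proof.
  assert (H : forall f x y, (forall x, is_derive f x 0) -> x <= y -> f x <= f y).
  { intros g x y Hg Hxy. apply derive_nonneg_increasing with (fun _ => 0); auto; intros; lra. }
  intros Hf x y.
  assert (Hf' : forall x, is_derive (fun u => - f u) x 0).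
  { intros u. replace 0 with (- 0) by ring. apply (is_derive_opp f u 0), Hf. }
  destruct (Rle_dec x y).
  - pose proof (H f x y Hf r). pose proof (H _ x y Hf' r). simpl in *. lra.
  - pose proof (H f y x Hf ltac:(lra)). pose proof (H _ y x Hf' ltac:(lra)). simpl in *. lra.
Qed.

Lemma increasing_inverse (g : R -> R) :
  (forall x y, x < y -> g x < g y) ->
  (forall x, continuity_pt g x) ->
  (forall y, exists a b, g a <= y <= g b) ->
  exists h : R -> R, (forall y, g (h y) = y) /\ (forall x, h (g x) = x) /\
    (forall x y, x < y -> h x < h y) /\ (forall y, continuity_pt h y).
Proof.
  intros Hinc Hcont Hsurj.
  assert (Hex : forall y, exists x, g x = y).
  { intros y. destruct (Hsurj y) as [a [b Hy]].
    destruct (IVT_gen g a b y) as [x [_ Hx]]; [exact Hcont| |exists x; exact Hx].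
    rewrite Rmin_left, Rmax_right by lra. exact Hy. }
  set (h := fun y => proj1_sig (constructive_indefinite_description _ (Hex y))).
  assert (Hgh : forall y, g (h y) = y).
  { intros y. unfold h. destruct constructive_indefinite_description. assumption. }
  assert (Hrev : forall x y, g x < g y -> x < y).
  { intros x y H. apply Rnot_le_lt. intros [Hl| ->]; [|lra]. specialize (Hinc _ _ Hl). lra. }
  exists h. split; [exact Hgh|]. split; [|split].
  - intros x. destruct (Rtotal_order (h (g x)) x) as [H|[H|H]]; auto;
      apply Hinc in H; rewrite Hgh in H; lra.
  - intros x y H. apply Hrev. rewrite !Hgh. exact H.
  - intros y. apply continuity_pt_eps. intros eps He.
    pose proof (Hinc (h y - eps) (h y) ltac:(lra)).
    pose proof (Hinc (h y) (h y + eps) ltac:(lra)).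
    rewrite Hgh in *.
    exists (Rmin (y - g (h y - eps)) (g (h y + eps) - y)).
    split; [apply Rmin_pos; lra|]. intros z Hz. apply Rabs_def2 in Hz.
    pose proof (Rmin_l (y - g (h y - eps)) (g (h y + eps) - y)).
    pose proof (Rmin_r (y - g (h y - eps)) (g (h y + eps) - y)).
    assert (h z < h y + eps) by (apply Hrev; rewrite Hgh; lra).
    assert (h y - eps < h z) by (apply Hrev; rewrite Hgh; lra).
    apply Rabs_def1; lra.
Qed.

Lemma is_derive_inverse (g h : R -> R) (y l : R) :
  (forall z, g (h z) = z) -> continuity_pt h y ->
  is_derive g (h y) l -> 0 < l -> is_derive h y (/ l).
Proof.
  intros Hgh Hc Hd Hl. apply is_derive_eps. intros eps He.
  (* With j = h z - h y and k = z - y, the bound |k - l j| <= e |j| with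
     e <= l / 2 gives |j| <= 2 |k| / l, hence |j - k / l| <= 2 e |k| / l^2. *)
  set (e := Rmin (l / 2) (eps * l * l / 2)).
  assert (He' : 0 < e).
  { apply Rmin_pos; [lra|]. apply Rdiv_lt_0_compat; [|lra].
    repeat apply Rmult_lt_0_compat; lra. }
  assert (Hel : e <= l / 2) by apply Rmin_l.
  assert (Hee : e <= eps * l * l / 2) by apply Rmin_r.
  destruct (proj1 (is_derive_eps g (h y) l) Hd e He') as [d [Hdp Hd']].
  destruct (proj1 (continuity_pt_eps h y) Hc d Hdp) as [d2 [Hd2 Hd2']].
  exists d2. split; [exact Hd2|]. intros z Hz.
  specialize (Hd' (h z) (Hd2' z Hz)). rewrite !Hgh in Hd'.
  set (j := h z - h y) in *. set (k := z - y) in *.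
  assert (H1 : l * Rabs j <= Rabs k + e * Rabs j).
  { replace (l * Rabs j) with (Rabs (k - (k - l * j))).
    2:{ replace (k - (k - l * j)) with (l * j) by ring.
        rewrite Rabs_mult, (Rabs_pos_eq l) by lra. reflexivity. }
    eapply Rle_trans; [apply Rabs_triang|]. rewrite Rabs_Ropp. lra. }
  pose proof (Rabs_pos j). pose proof (Rabs_pos k).
  replace (j - / l * k) with (- (/ l * (k - l * j))) by (field; lra).
  rewrite Rabs_Ropp, Rabs_mult, (Rabs_pos_eq (/ l)) by (left; apply Rinv_0_lt_compat; lra).
  apply Rmult_le_reg_l with l; [lra|]. rewrite <- Rmult_assoc, Rinv_r, Rmult_1_l by lra.
  apply Rle_trans with (1 := Hd').
  assert (l * Rabs j <= 2 * Rabs k) by nra.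
  apply Rmult_le_reg_l with l; [lra|].
  apply Rle_trans with (e * (2 * Rabs k)); nra.
Qed.

(** * Locally convex closed plane curves turn once *)

Definition clamp (a b z : R) : R := Rmax a (Rmin b z).

Lemma clamp_continuous (a b z : R) : continuity_pt (clamp a b) z.
Proof.
  apply continuity_pt_eps. intros eps He. exists eps. split; [exact He|].
  intros y Hy. apply Rabs_def2 in Hy. apply Rabs_def1;
  unfold clamp, Rmax, Rmin; repeat destruct Rle_dec; lra.
Qed.

(** The curve [(X, Y)] is parametrized by the angle of its tangent, and [r] is its radius of
    curvature; [r > 0] says that it curves to the left throughout. *)
Definition angle_parametrized (X Y r : R -> R) : Prop :=
  forall a, is_derive X a (r a * cos a) /\ is_derive Y a (r a * sin a) /\ 0 < r a.

(** An arc which turns by [2 * PI] and starts horizontally rises along a branch on the right and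
    comes down along a branch on the left. If it ends at the initial height, to the right of its
    starting point, then the two branches have changed sides and by the intermediate value theorem
    they have met. *)
Lemma full_turn_crossing_horizontal (X Y r : R -> R) :
  angle_parametrized X Y r ->
  Y (2 * PI) = Y 0 -> X 0 <= X (2 * PI) ->
  exists a b, 0 <= a /\ a < b /\ b <= 2 * PI /\ X a = X b /\ Y a = Y b.
Proof.
  intros Hd HY HX. pose proof PI_RGT_0 as Hpi.
  destruct HX as [HX|HX].
  2:{ exists 0, (2 * PI). repeat split; try lra; auto. }
  assert (HYc : forall z, continuity_pt Y z).
  { intros z. apply is_derive_continuity_pt with (r z * sin z), Hd. }
  assert (HXc : forall z, continuity_pt X z).
  { intros z. apply is_derive_continuity_pt with (r z * cos z), Hd. }
  assert (Yup : forall u v, 0 <= u -> u < v -> v <= PI -> Y u < Y v).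
  { intros u v Hu Huv Hv.
    apply derive_pos_increasing with (fun z => r z * sin z); [lra| |].
    - intros z _. apply Hd.
    - intros z Hz. apply Rmult_lt_0_compat; [apply Hd|apply sin_gt_0; lra]. }
  assert (Ydown : forall u v, PI <= u -> u < v -> v <= 2 * PI -> Y v < Y u).
  { intros u v Hu Huv Hv.
    enough (- Y u < - Y v) by lra.
    apply (derive_pos_increasing (fun z => - Y z) (fun z => - (r z * sin z))); [lra| |].
    - intros z _. apply (is_derive_opp Y z). apply Hd.
    - intros z Hz. assert (sin z < 0) by (apply sin_lt_0; lra).
      destruct (Hd z) as [_ [_ Hr]]. nra. }
  assert (Xdown : forall u v, PI / 2 <= u -> u < v -> v <= 3 * (PI / 2) -> X v < X u).
  { intros u v Hu Huv Hv.
    enough (- X u < - X v) by lra.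
    apply (derive_pos_increasing (fun z => - X z) (fun z => - (r z * cos z))); [lra| |].
    - intros z _. apply (is_derive_opp X z). apply Hd.
    - intros z Hz. assert (cos z < 0) by (apply cos_lt_0; lra).
      destruct (Hd z) as [_ [_ Hr]]. nra. }
  (* The rising branch, continued to an increasing homeomorphism of the line. *)
  set (G := fun z => Y (clamp 0 PI z) + (z - clamp 0 PI z)).
  assert (Hcl : forall z, 0 <= z <= PI -> clamp 0 PI z = z).
  { intros z Hz. unfold clamp. rewrite Rmin_right, Rmax_right by lra. reflexivity. }
  assert (Hcl0 : forall z, z <= 0 -> clamp 0 PI z = 0).
  { intros z Hz. unfold clamp. rewrite Rmin_right, Rmax_left by lra. reflexivity. }
  assert (Hcl1 : forall z, PI <= z -> clamp 0 PI z = PI).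
  { intros z Hz. unfold clamp. rewrite Rmin_left, Rmax_right by lra. reflexivity. }
  destruct (increasing_inverse G) as [h [Hgh [Hhg [Hinc Hcont]]]].
  - intros x y Hxy. unfold G.
    destruct (Rle_dec x 0); destruct (Rle_dec y 0);
    destruct (Rle_dec PI x); destruct (Rle_dec PI y);
      repeat first [rewrite (Hcl0 x) by lra | rewrite (Hcl1 x) by lra | rewrite (Hcl x) by lra];
      repeat first [rewrite (Hcl0 y) by lra | rewrite (Hcl1 y) by lra | rewrite (Hcl y) by lra];
      try lra;
    (destruct (Req_dec x 0); destruct (Req_dec y PI); destruct (Req_dec x PI); destruct (Req_dec y 0); subst; try lra;
     try (pose proof (Yup 0 PI ltac:(lra) ltac:(lra) ltac:(lra)));
     try (pose proof (Yup x y ltac:(lra) ltac:(lra) ltac:(lra)));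
     try (pose proof (Yup 0 y ltac:(lra) ltac:(lra) ltac:(lra)));
     try (pose proof (Yup x PI ltac:(lra) ltac:(lra) ltac:(lra))); lra).
  - intros z. unfold G. apply continuity_pt_plus.
    + apply (continuity_pt_comp (clamp 0 PI) Y); [apply clamp_continuous|apply HYc].
    + apply continuity_pt_minus; [apply continuity_pt_id|apply clamp_continuous].
  - intros y. exists (Rmin 0 (y - Y 0)), (Rmax PI (y - Y PI + PI)). unfold G.
    pose proof (Rmin_l 0 (y - Y 0)). pose proof (Rmin_r 0 (y - Y 0)).
    pose proof (Rmax_l PI (y - Y PI + PI)). pose proof (Rmax_r PI (y - Y PI + PI)).
    rewrite Hcl0, Hcl1 by lra. lra.
  - assert (HG : forall z, 0 <= z <= PI -> G z = Y z).
    { intros z Hz. unfold G. rewrite Hcl by lra. ring. }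
    assert (HhPI : h (Y PI) = PI) by (rewrite <- (HG PI) by lra; apply Hhg).
    assert (Hh0 : h (Y 0) = 0) by (rewrite <- (HG 0) by lra; apply Hhg).
    set (D := fun z => X z - X (h (Y z))).
    assert (HDc : continuity D).
    { intros z. apply continuity_pt_minus; [apply HXc|].
      apply (continuity_pt_comp (fun z => h (Y z)) X); [|apply HXc].
      apply (continuity_pt_comp Y h); [apply HYc|apply Hcont]. }
    assert (Hrange : forall z, PI < z <= 2 * PI -> 0 <= h (Y z) < PI).
    { intros z Hz. pose proof (Ydown PI z ltac:(lra) ltac:(lra) ltac:(lra)) as H1.
      apply Hinc in H1. rewrite HhPI in H1. split; [|exact H1].
      destruct (Req_dec z (2 * PI)) as [->|]; [rewrite HY, Hh0; lra|].
      pose proof (Ydown z (2 * PI) ltac:(lra) ltac:(lra) ltac:(lra)) as H2.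
      rewrite HY in H2. apply Hinc in H2. rewrite Hh0 in H2. lra. }
    (* Just below the top the falling branch is on the left of the rising one. *)
    assert (Hstart : exists z, PI < z < 2 * PI /\ D z < 0).
    { assert (Hc : continuity_pt (fun z => h (Y z)) PI)
        by (apply (continuity_pt_comp Y h); [apply HYc|apply Hcont]).
      destruct (proj1 (continuity_pt_eps _ _) Hc (PI / 2)) as [d [Hdp Hd']]; [lra|].
      set (z := PI + Rmin (d / 2) (PI / 2)).
      assert (Hm : 0 < Rmin (d / 2) (PI / 2)) by (apply Rmin_pos; lra).
      pose proof (Rmin_l (d / 2) (PI / 2)). pose proof (Rmin_r (d / 2) (PI / 2)).
      exists z. assert (Hz : PI < z < 2 * PI) by (unfold z; lra). split; [exact Hz|].
      specialize (Hd' z). rewrite HhPI in Hd'.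
      assert (Hz' : Rabs (z - PI) < d) by (apply Rabs_def1; unfold z; lra).
      specialize (Hd' Hz'). apply Rabs_def2 in Hd'.
      specialize (Hrange z ltac:(lra)).
      pose proof (Xdown (h (Y z)) z ltac:(lra) ltac:(lra) ltac:(unfold z; lra)).
      unfold D. lra. }
    destruct Hstart as [z0 [Hz0 HD0]].
    destruct (IVT_cor D z0 (2 * PI) HDc) as [z [Hz HDz]]; [lra| |].
    { unfold D at 2. rewrite HY, Hh0. nra. }
    specialize (Hrange z ltac:(lra)).
    exists (h (Y z)), z. unfold D in HDz. repeat split; try lra.
    rewrite <- (HG (h (Y z))) by lra. apply Hgh.
Qed.

Lemma is_derive_shift (f : R -> R) (c x l : R) :
  is_derive f (c + x) l -> is_derive (fun u => f (c + u)) x l.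
Proof.
  intros H. apply is_derive_eps. intros eps He.
  destruct (proj1 (is_derive_eps _ _ _) H eps He) as [d [Hd Hd']].
  exists d. split; [exact Hd|]. intros y Hy.
  specialize (Hd' (c + y)). replace (c + y - (c + x)) with (y - x) in Hd' by ring.
  apply Hd', Hy.
Qed.

(** The previous lemma in a frame turned by [c]: the hypotheses say that the chord of the arc is a
    nonnegative multiple of the common direction of its end tangents. *)
Lemma full_turn_crossing (X Y r : R -> R) (c : R) :
  angle_parametrized X Y r ->
  (X (c + 2 * PI) - X c) * sin c - (Y (c + 2 * PI) - Y c) * cos c = 0 ->
  0 <= (X (c + 2 * PI) - X c) * cos c + (Y (c + 2 * PI) - Y c) * sin c ->
  exists a b, a < b /\ b <= a + 2 * PI /\ X a = X b /\ Y a = Y b.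
Proof.
  intros Hd HQ HM.
  assert (Hsc := sin2_cos2 c). unfold Rsqr in Hsc.
  destruct (full_turn_crossing_horizontal
    (fun a => cos c * X (c + a) + sin c * Y (c + a))
    (fun a => - sin c * X (c + a) + cos c * Y (c + a))
    (fun a => r (c + a))) as [a [b [Ha [Hab [Hb [E1 E2]]]]]].
  - intros a. destruct (Hd (c + a)) as [H1 [H2 H3]].
    apply is_derive_shift in H1. apply is_derive_shift in H2.
    split; [|split; [|exact H3]].
    + replace (r (c + a) * cos a)
        with (cos c * (r (c + a) * cos (c + a)) + sin c * (r (c + a) * sin (c + a))).
      2:{ replace (cos a) with (cos (c + a - c)) by (f_equal; ring).
          rewrite cos_minus. ring. }
      apply (is_derive_plus (fun a => cos c * X (c + a)) (fun a => sin c * Y (c + a)));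
        apply is_derive_scal; assumption.
    + replace (r (c + a) * sin a)
        with (- sin c * (r (c + a) * cos (c + a)) + cos c * (r (c + a) * sin (c + a))).
      2:{ replace (sin a) with (sin (c + a - c)) by (f_equal; ring).
          rewrite sin_minus. ring. }
      apply (is_derive_plus (fun a => - sin c * X (c + a)) (fun a => cos c * Y (c + a)));
        apply is_derive_scal; assumption.
  - rewrite Rplus_0_r. lra.
  - rewrite Rplus_0_r. lra.
  - exists (c + a), (c + b). repeat split; try lra.
    + replace (X (c + a)) with (cos c * (cos c * X (c + a) + sin c * Y (c + a))
        - sin c * (- sin c * X (c + a) + cos c * Y (c + a)));
      [|transitivity (X (c + a) * (sin c * sin c + cos c * cos c)); [ring|rewrite Hsc; ring]].
      rewrite E1, E2.
      transitivity (X (c + b) * (sin c * sin c + cos c * cos c)); [ring|rewrite Hsc; ring].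
    + replace (Y (c + a)) with (sin c * (cos c * X (c + a) + sin c * Y (c + a))
        + cos c * (- sin c * X (c + a) + cos c * Y (c + a)));
      [|transitivity (Y (c + a) * (sin c * sin c + cos c * cos c)); [ring|rewrite Hsc; ring]].
      rewrite E1, E2.
      transitivity (Y (c + b) * (sin c * sin c + cos c * cos c)); [ring|rewrite Hsc; ring].
Qed.

(** A function whose zeros are all crossed downward cannot return to zero, for it would do so
    from below. *)
Lemma negative_after_downward_zeros (Q Q' : R -> R) (a b : R) :
  (forall z, is_derive Q z (Q' z)) ->
  (forall z, Q z = 0 -> Q' z < 0) ->
  Q a <= 0 -> a < b -> Q b < 0.
Proof.
  intros Hd Hz Ha Hab.
  enough (H : forall z, a <= z <= b -> a < z -> Q z < 0) by (apply H; lra).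
  apply (real_induction (fun z => a < z -> Q z < 0)); [lra| |].
  - intros z Hz1 Hbefore _.
    apply Rnot_le_lt. intros Hpos.
    (* Q is negative to the left of z: it cannot be positive at z, and a zero would be crossed upward. *)
    assert (Hc := is_derive_continuity_pt _ _ _ (Hd z)).
    destruct Hpos as [Hpos|Hzero].
    + destruct (proj1 (continuity_pt_eps _ _) Hc (Q z) Hpos) as [d [Hdp Hd']].
      set (y := Rmax ((a + z) / 2) (z - d / 2)).
      assert (Hy : a < y < z /\ z - d / 2 <= y).
      { unfold y, Rmax. destruct Rle_dec; lra. }
      specialize (Hd' y ltac:(apply Rabs_def1; lra)).
      specialize (Hbefore y ltac:(lra) ltac:(lra)).
      apply Rabs_def2 in Hd'. lra.
    + pose proof (Hz z (eq_sym Hzero)) as Hneg.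
      destruct (proj1 (is_derive_eps _ _ _) (Hd z) (- Q' z / 2)) as [d [Hdp Hd']]; [lra|].
      set (y := Rmax ((a + z) / 2) (z - d / 2)).
      assert (Hy : a < y < z /\ z - d / 2 <= y).
      { unfold y, Rmax. destruct Rle_dec; lra. }
      specialize (Hd' y ltac:(apply Rabs_def1; lra)).
      specialize (Hbefore y ltac:(lra) ltac:(lra)).
      rewrite (Rabs_left (y - z)) in Hd' by lra.
      apply Rabs_le_between in Hd'. rewrite <- Hzero in Hd'. nra.
  - intros z Hz1 Hbefore.
    destruct (Rle_lt_or_eq_dec (Q z) 0) as [Hneg|Hzero].
    { destruct (Req_dec z a) as [->|]; [exact Ha|left; apply Hbefore; lra]. }
    + assert (Hc := is_derive_continuity_pt _ _ _ (Hd z)).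
      destruct (proj1 (continuity_pt_eps _ _) Hc (- Q z) ltac:(lra)) as [d [Hdp Hd']].
      exists d. split; [exact Hdp|]. intros y Hy _ _.
      specialize (Hd' y ltac:(apply Rabs_def1; lra)). apply Rabs_def2 in Hd'. lra.
    + pose proof (Hz z Hzero) as Hneg.
      destruct (proj1 (is_derive_eps _ _ _) (Hd z) (- Q' z / 2)) as [d [Hdp Hd']]; [lra|].
      exists d. split; [exact Hdp|]. intros y Hy _ _.
      specialize (Hd' y ltac:(apply Rabs_def1; lra)).
      rewrite (Rabs_right (y - z)) in Hd' by lra.
      apply Rabs_le_between in Hd'. nra.
Qed.

Lemma periodic_multiple {A : Type} (f : R -> A) (T : R) :
  (forall a, f (a + T) = f a) -> forall (k : Z) a, f (a + IZR k * T) = f a.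
Proof.
  intros Hper.
  assert (Hn : forall n a, f (a + INR n * T) = f a).
  { induction n as [|n IH]; intros u; [rewrite Rmult_0_l, Rplus_0_r; reflexivity|].
    rewrite S_INR. replace (u + (INR n + 1) * T) with (u + INR n * T + T) by ring.
    rewrite Hper. apply IH. }
  intros k u. destruct (Z.le_gt_cases 0 k) as [H|H].
  - rewrite <- (Z2Nat.id k H), <- INR_IZR_INZ. apply Hn.
  - rewrite <- (Hn (Z.to_nat (- k)) (u + IZR k * T)).
    rewrite INR_IZR_INZ, Z2Nat.id by lia. f_equal. rewrite opp_IZR. ring.
Qed.

Lemma period_reduction (T a : R) :
  0 < T -> exists k : Z, 0 <= a + IZR k * T < T.
Proof.
  intros HT. exists (- Int_part (a / T))%Z.
  assert (Hf := base_Int_part (a / T)). rewrite opp_IZR.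
  set (i := IZR (Int_part (a / T))) in *.
  assert (Ha : a = a / T * T) by (field; lra).
  set (q := a / T) in *. rewrite Ha. nra.
Qed.

Lemma periodic_attains_max (P : R -> R) (T : R) :
  0 < T -> continuity P -> (forall a, P (a + T) = P a) ->
  exists m, forall a, P a <= P m.
Proof.
  intros HT Hc Hper.
  destruct (continuity_ab_maj P 0 T) as [m [Hm _]]; [lra|intros; apply Hc|].
  exists m. intros a. destruct (period_reduction T a HT) as [k Hk].
  rewrite <- (periodic_multiple P T Hper k a). apply Hm. lra.
Qed.

(** Let [P a = X a * sin a - Y a * cos a], the support function of the tangent lines, and
    [Q a = P (a + 2 * PI) - P a]. A zero of [Q] is a line which is tangent at the parameters [a] and
    [a + 2 * PI], and there [Q'] is the signed length of the segment between the points of contact.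
    Without a double point this length is negative by [full_turn_crossing], so that [Q], once
    nonpositive, stays negative. But at a maximum [m] of [P] one has [Q m <= 0], while
    [Q (m - 2 * PI) >= 0], and by periodicity the latter holds also at [m - 2 * PI + T > m]. *)
Lemma overturning_double_point (X Y r : R -> R) (T : R) :
  angle_parametrized X Y r ->
  cos T = 1 -> sin T = 0 -> 2 * PI < T ->
  (forall a, X (a + T) = X a) -> (forall a, Y (a + T) = Y a) ->
  exists a b, a < b /\ b <= a + 2 * PI /\ X a = X b /\ Y a = Y b.
Proof.
  intros Hd HcT HsT HT HX HY. pose proof PI_RGT_0 as Hpi.
  apply NNPP. intros Hno.
  set (P := fun a => X a * sin a - Y a * cos a).
  assert (HPd : forall a, is_derive P a (X a * cos a + Y a * sin a)).
  { intros a. destruct (Hd a) as [H1 [H2 _]]. unfold P.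
    auto_derive; [split; [eexists; exact H1|split; [eexists; exact H2|exact I]]|].
    replace (Derive (fun x => X x) a) with (r a * cos a)
      by (symmetry; apply is_derive_unique, H1).
    replace (Derive (fun x => Y x) a) with (r a * sin a)
      by (symmetry; apply is_derive_unique, H2).
    ring. }
  destruct (periodic_attains_max P T) as [m Hm]; [lra| | |].
  { intros a. apply is_derive_continuity_pt with (1 := HPd a). }
  { intros a. unfold P. rewrite HX, HY, sin_plus, cos_plus, HcT, HsT. ring. }
  set (Q := fun a => P (a + 2 * PI) - P a).
  set (Q' := fun a => (X (a + 2 * PI) - X a) * cos a + (Y (a + 2 * PI) - Y a) * sin a).
  assert (HQ : forall a, is_derive Q a (Q' a)).
  { intros a. unfold Q, Q'.
    replace ((X (a + 2 * PI) - X a) * cos a + (Y (a + 2 * PI) - Y a) * sin a)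
      with ((X (a + 2 * PI) * cos (a + 2 * PI) + Y (a + 2 * PI) * sin (a + 2 * PI))
            - (X a * cos a + Y a * sin a)).
    2:{ replace (cos (a + 2 * PI)) with (cos a) by (rewrite <- (cos_period a 1); f_equal; simpl; ring).
        replace (sin (a + 2 * PI)) with (sin a) by (rewrite <- (sin_period a 1); f_equal; simpl; ring).
        ring. }
    apply (is_derive_minus (fun a => P (a + 2 * PI)) P); [|apply HPd].
    rewrite (Rplus_comm a (2 * PI)).
    apply is_derive_ext with (fun a => P (2 * PI + a)).
    { intros u. f_equal. ring. }
    apply is_derive_shift, HPd. }
  assert (HQz : forall a, Q a = 0 -> Q' a < 0).
  { intros a Ha. apply Rnot_le_lt. intros Hle. apply Hno.
    apply full_turn_crossing with (r := r) (c := a); [exact Hd| |exact Hle].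
    rewrite <- Ha. unfold Q, P.
    replace (cos (a + 2 * PI)) with (cos a) by (rewrite <- (cos_period a 1); f_equal; simpl; ring).
    replace (sin (a + 2 * PI)) with (sin a) by (rewrite <- (sin_period a 1); f_equal; simpl; ring).
    ring. }
  assert (Hlt : Q (m - 2 * PI + T) < 0).
  { apply negative_after_downward_zeros with Q' m; auto; [|lra].
    unfold Q. specialize (Hm (m + 2 * PI)). lra. }
  unfold Q in Hlt.
  replace (m - 2 * PI + T + 2 * PI) with (m + T) in Hlt by ring.
  assert (HPT : P (m + T) = P m).
  { unfold P. rewrite HX, HY, sin_plus, cos_plus, HcT, HsT. ring. }
  specialize (Hm (m - 2 * PI + T)). lra.
Qed.

(** * Osculating planes over a convex projection *)

Lemma derivative_periodic (f f' : R -> R) (L : R) :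
  (forall s, is_derive f s (f' s)) -> (forall s, f (s + L) = f s) ->
  forall s, f' (s + L) = f' s.
Proof.
  intros Hd Hper s.
  rewrite <- (is_derive_unique _ _ _ (Hd s)). symmetry. apply is_derive_unique.
  apply is_derive_ext with (fun u => f (L + u)).
  { intros u. rewrite Rplus_comm. apply Hper. }
  rewrite Rplus_comm. apply is_derive_shift, Hd.
Qed.

Section ConvexProjection.

Variables (x y x1 y1 x2 y2 : R -> R) (L : R).
Hypothesis dx : forall s, is_derive x s (x1 s).
Hypothesis dy : forall s, is_derive y s (y1 s).
Hypothesis dx1 : forall s, is_derive x1 s (x2 s).
Hypothesis dy1 : forall s, is_derive y1 s (y2 s).
Hypothesis cx2 : forall s, continuity_pt x2 s.
Hypothesis cy2 : forall s, continuity_pt y2 s.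
Hypothesis HL : 0 < L.
Hypothesis perx : forall s, x (s + L) = x s.
Hypothesis pery : forall s, y (s + L) = y s.
Hypothesis convex : forall s, 0 < x1 s * y2 s - y1 s * x2 s.

Let N s := x1 s * x1 s + y1 s * y1 s.
Let omega s := (x1 s * y2 s - y1 s * x2 s) / N s.
Let xi s := x1 s / sqrt (N s).
Let eta s := y1 s / sqrt (N s).
Let theta s := RInt omega 0 s.

Lemma speed_pos s : 0 < N s.
Proof.
  unfold N. pose proof (convex s).
  destruct (Req_dec (x1 s) 0); destruct (Req_dec (y1 s) 0); try nra.
Qed.

Lemma omega_pos s : 0 < omega s.
Proof. apply Rdiv_lt_0_compat; [apply convex|apply speed_pos]. Qed.

Lemma theta_derive s : is_derive theta s (omega s).
Proof.
  assert (Hc : forall z, continuous omega z).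
  { intros z. apply continuity_pt_filterlim.
    assert (C1 := is_derive_continuity_pt _ _ _ (dx1 z)).
    assert (C2 := is_derive_continuity_pt _ _ _ (dy1 z)).
    apply continuity_pt_div;
      [apply continuity_pt_minus|apply continuity_pt_plus|apply Rgt_not_eq, speed_pos];
      apply continuity_pt_mult; auto. }
  apply is_derive_RInt with 0; [|apply Hc].
  exists (mkposreal 1 Rlt_0_1). intros b _. apply (RInt_correct omega).
  apply (ex_RInt_continuous omega). intros z _. apply Hc.
Qed.

Lemma direction_derive s :
  is_derive xi s (- omega s * eta s) /\ is_derive eta s (omega s * xi s).
Proof.
  pose proof (speed_pos s) as HN. pose proof (sqrt_lt_R0 _ HN) as Hs.
  pose proof (sqrt_sqrt _ (Rlt_le _ _ HN)) as Hss.
  assert (E1 : Derive (fun z => x1 z) s = x2 s) by (apply is_derive_unique, dx1).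
  assert (E2 : Derive (fun z => y1 z) s = y2 s) by (apply is_derive_unique, dy1).
  assert (D1 : ex_derive (fun z => x1 z) s) by (eexists; apply dx1).
  assert (D2 : ex_derive (fun z => y1 z) s) by (eexists; apply dy1).
  unfold xi, eta, omega, N in *.
  split.
  all: auto_derive;
    [repeat split; auto; apply Rgt_not_eq; exact Hs|];
    rewrite E1, E2; set (q := sqrt _) in *;
    rewrite <- Hss; field_simplify_eq; [|lra];
    replace (q ^ 2) with (x1 s * x1 s + y1 s * y1 s) by (rewrite <- Hss; ring);
    ring.
Qed.

(** The unit tangent and the rotation by [theta] satisfy the same linear differential equation, so
    that one is a constant rotation of the other. *)
Lemma direction_angle s :
  xi s = xi 0 * cos (theta s) - eta 0 * sin (theta s) /\
  eta s = xi 0 * sin (theta s) + eta 0 * cos (theta s).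
Proof.
  assert (T0 : theta 0 = 0) by exact (RInt_point 0 omega).
  assert (HC : forall u, is_derive (fun z => xi z * cos (theta z) + eta z * sin (theta z)) u 0 /\
    is_derive (fun z => eta z * cos (theta z) - xi z * sin (theta z)) u 0).
  { intros u. destruct (direction_derive u) as [H1 H2]. pose proof (theta_derive u) as H3.
    assert (E1 : Derive (fun z => xi z) u = - omega u * eta u) by (apply is_derive_unique, H1).
    assert (E2 : Derive (fun z => eta z) u = omega u * xi u) by (apply is_derive_unique, H2).
    assert (E3 : Derive (fun z => theta z) u = omega u) by (apply is_derive_unique, H3).
    assert (D1 : ex_derive (fun z => xi z) u) by (eexists; apply H1).
    assert (D2 : ex_derive (fun z => eta z) u) by (eexists; apply H2).
    assert (D3 : ex_derive (fun z => theta z) u) by (eexists; apply H3).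
    split; (auto_derive; [repeat split; auto|rewrite E1, E2, E3; ring]). }
  pose proof (derive_zero_constant _ (fun u => proj1 (HC u)) s 0) as A.
  pose proof (derive_zero_constant _ (fun u => proj2 (HC u)) s 0) as B.
  simpl in A, B. rewrite T0, cos_0, sin_0 in A, B.
  assert (Hsc := sin2_cos2 (theta s)). unfold Rsqr in Hsc.
  replace (xi 0) with (xi s * cos (theta s) + eta s * sin (theta s)) by lra.
  replace (eta 0) with (eta s * cos (theta s) - xi s * sin (theta s)) by lra.
  split; [transitivity (xi s * (sin (theta s) * sin (theta s) + cos (theta s) * cos (theta s)))
         |transitivity (eta s * (sin (theta s) * sin (theta s) + cos (theta s) * cos (theta s)))];
    try (rewrite Hsc; ring); ring.
Qed.

Lemma direction_unit s : xi s * xi s + eta s * eta s = 1.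
Proof.
  pose proof (speed_pos s) as HN. pose proof (sqrt_lt_R0 _ HN) as Hs.
  pose proof (sqrt_sqrt _ (Rlt_le _ _ HN)) as Hss.
  unfold xi, eta. set (q := sqrt (N s)) in *.
  transitivity (N s / (q * q)); [unfold N; field; lra|rewrite Hss; field; lra].
Qed.

Lemma theta_increasing u v : u < v -> theta u < theta v.
Proof.
  intros H. apply derive_pos_increasing with omega; [exact H| |];
    intros; [apply theta_derive|apply omega_pos].
Qed.

Hypothesis simple : forall s s', s < s' < s + L -> ~ (x s = x s' /\ y s = y s').

(** If the turning were larger, then the curve as a function of [theta], rotated so that its initial
    direction is horizontal, would have a double point by [overturning_double_point]. *)
Lemma turning_at_most_full s : theta (s + L) <= theta s + 2 * PI.
Proof.
  assert (T0 : theta 0 = 0) by exact (RInt_point 0 omega).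
  pose proof (derivative_periodic x x1 L dx perx) as px1.
  pose proof (derivative_periodic y y1 L dy pery) as py1.
  pose proof (derivative_periodic x1 x2 L dx1 px1) as px2.
  pose proof (derivative_periodic y1 y2 L dy1 py1) as py2.
  set (T := theta L).
  assert (HT : forall u, theta (u + L) = theta u + T).
  { intros u.
    assert (H : forall z, is_derive (fun z => theta (L + z) - theta z) z 0).
    { intros z. replace 0 with (omega (L + z) - omega z).
      2:{ unfold omega, N. rewrite (Rplus_comm L), px1, py1, px2, py2. ring. }
      apply (is_derive_minus (fun z => theta (L + z)) theta); [|apply theta_derive].
      apply is_derive_shift, theta_derive. }
    pose proof (derive_zero_constant _ H u 0) as E. simpl in E.
    rewrite T0, Rplus_0_r in E. rewrite Rplus_comm. fold T in E. lra. }
  assert (HT0 : 0 < T) by (rewrite <- T0; apply theta_increasing; exact HL).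
  destruct (increasing_inverse theta) as [sigma [Hts [Hst [Hinc Hcont]]]].
  - exact theta_increasing.
  - intros z. apply is_derive_continuity_pt with (omega z), theta_derive.
  - intros v. destruct (period_reduction T v HT0) as [k Hk].
    assert (Hlin : forall j : Z, theta (IZR j * L) = IZR j * T).
    { intros j. pose proof (periodic_multiple (fun u => theta u - u * (T / L)) L) as H.
      simpl in H. specialize (H ltac:(intros a; rewrite HT; field; lra) j 0).
      rewrite T0, Rplus_0_l in H.
      replace (IZR j * L * (T / L)) with (IZR j * T) in H by (field; lra). lra. }
    exists (IZR (- k) * L), (IZR (1 - k) * L). rewrite !Hlin, minus_IZR, opp_IZR. lra.
  - assert (HsT : forall a, sigma (a + T) = sigma a + L).
    { intros a. rewrite <- (Hst (sigma a + L)), HT, Hts. reflexivity. }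
    rewrite HT. apply Rplus_le_compat_l, Rnot_lt_le. intros Hlt.
    destruct (direction_angle L) as [A1 A2]. fold T in A1, A2.
    assert (P1 : xi L = xi 0) by (unfold xi, N; rewrite <- (Rplus_0_l L), px1, py1; reflexivity).
    assert (P2 : eta L = eta 0) by (unfold eta, N; rewrite <- (Rplus_0_l L), px1, py1; reflexivity).
    rewrite P1 in A1. rewrite P2 in A2.
    pose proof (direction_unit 0) as U.
    assert (cT : cos T = 1).
    { assert (B1 : xi 0 * xi 0 = xi 0 * (xi 0 * cos T - eta 0 * sin T)) by (f_equal; exact A1).
      assert (B2 : eta 0 * eta 0 = eta 0 * (xi 0 * sin T + eta 0 * cos T)) by (f_equal; exact A2).
      replace (cos T) with (cos T * (xi 0 * xi 0 + eta 0 * eta 0)) by (rewrite U; ring).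
      lra. }
    assert (sT : sin T = 0).
    { assert (B1 : xi 0 * eta 0 = xi 0 * (xi 0 * sin T + eta 0 * cos T)) by (f_equal; exact A2).
      assert (B2 : eta 0 * xi 0 = eta 0 * (xi 0 * cos T - eta 0 * sin T)) by (f_equal; exact A1).
      replace (sin T) with (sin T * (xi 0 * xi 0 + eta 0 * eta 0)) by (rewrite U; ring).
      lra. }
    destruct (overturning_double_point
      (fun a => xi 0 * x (sigma a) + eta 0 * y (sigma a))
      (fun a => - eta 0 * x (sigma a) + xi 0 * y (sigma a))
      (fun a => sqrt (N (sigma a)) / omega (sigma a)) T) as [a [b [Hab [Hb [E1 E2]]]]]; auto.
    + intros a. set (z := sigma a).
      assert (Hd : is_derive sigma a (/ omega z)).
      { apply is_derive_inverse with theta; auto; [apply theta_derive|apply omega_pos]. }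
      assert (Dx : is_derive (fun a => x (sigma a)) a (/ omega z * x1 z))
        by (apply (is_derive_comp x sigma); [apply dx|exact Hd]).
      assert (Dy : is_derive (fun a => y (sigma a)) a (/ omega z * y1 z))
        by (apply (is_derive_comp y sigma); [apply dy|exact Hd]).
      destruct (direction_angle z) as [B1 B2].
      unfold z in B1, B2. rewrite Hts in B1, B2. fold z in B1, B2.
      pose proof (sqrt_lt_R0 _ (speed_pos z)) as Hs. pose proof (omega_pos z) as Ho.
      assert (X1 : x1 z = sqrt (N z) * xi z) by (unfold xi; field; lra).
      assert (Y1 : y1 z = sqrt (N z) * eta z) by (unfold eta; field; lra).
      split; [|split; [|apply Rdiv_lt_0_compat; assumption]].
      * replace (sqrt (N z) / omega z * cos a)
          with (xi 0 * (/ omega z * x1 z) + eta 0 * (/ omega z * y1 z)).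
        2:{ rewrite X1, Y1, B1, B2.
            transitivity (sqrt (N z) / omega z * cos a * (xi 0 * xi 0 + eta 0 * eta 0));
              [field; lra|rewrite U; ring]. }
        apply (is_derive_plus (fun a => xi 0 * x (sigma a)) (fun a => eta 0 * y (sigma a)));
          apply is_derive_scal; assumption.
      * replace (sqrt (N z) / omega z * sin a)
          with (- eta 0 * (/ omega z * x1 z) + xi 0 * (/ omega z * y1 z)).
        2:{ rewrite X1, Y1, B1, B2.
            transitivity (sqrt (N z) / omega z * sin a * (xi 0 * xi 0 + eta 0 * eta 0));
              [field; lra|rewrite U; ring]. }
        apply (is_derive_plus (fun a => - eta 0 * x (sigma a)) (fun a => xi 0 * y (sigma a)));
          apply is_derive_scal; assumption.
    + intros a. rewrite HsT, perx, pery. reflexivity.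
    + intros a. rewrite HsT, perx, pery. reflexivity.
    + apply (simple (sigma a) (sigma b)).
      * split; [apply Hinc, Hab|]. rewrite <- HsT. apply Hinc. lra.
      * assert (V : forall u v, u * (xi 0 * xi 0 + eta 0 * eta 0) = v * (xi 0 * xi 0 + eta 0 * eta 0) -> u = v).
        { intros u v. rewrite U. lra. }
        pose proof (f_equal (Rmult (xi 0)) E1). pose proof (f_equal (Rmult (eta 0)) E1).
        pose proof (f_equal (Rmult (xi 0)) E2). pose proof (f_equal (Rmult (eta 0)) E2).
        split; apply V; lra.
Qed.

(** The angle enters later arguments only through the sign of the cross product of two tangent
    directions. *)
Lemma tangent_angle :
  exists rho th : R -> R,
    (forall s, 0 < rho s) /\
    (forall s s', x1 s * y1 s' - y1 s * x1 s' = rho s * rho s' * sin (th s' - th s)) /\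
    (forall s s', s < s' -> th s < th s') /\
    (forall s, th (s + L) <= th s + 2 * PI).
Proof.
  exists (fun s => sqrt (N s)), theta.
  split; [|split; [|split]].
  - intros s. apply sqrt_lt_R0, speed_pos.
  - intros s s'.
    pose proof (sqrt_lt_R0 _ (speed_pos s)) as Hs.
    pose proof (sqrt_lt_R0 _ (speed_pos s')) as Hs'.
    replace (x1 s) with (sqrt (N s) * xi s) by (unfold xi; field; lra).
    replace (y1 s) with (sqrt (N s) * eta s) by (unfold eta; field; lra).
    replace (x1 s') with (sqrt (N s') * xi s') by (unfold xi; field; lra).
    replace (y1 s') with (sqrt (N s') * eta s') by (unfold eta; field; lra).
    destruct (direction_angle s) as [-> ->]. destruct (direction_angle s') as [-> ->].
    rewrite sin_minus.
    transitivity (sqrt (N s) * sqrt (N s') * (sin (theta s') * cos (theta s) - cos (theta s') * sin (theta s)) * (xi 0 * xi 0 + eta 0 * eta 0)); [ring|].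
    rewrite direction_unit. ring.
  - exact theta_increasing.
  - exact turning_at_most_full.
Qed.

End ConvexProjection.

(** Let [(a, b)] be the slopes of the osculating plane, given by [t1 = a * x1 + b * y1] and
    [t2 = a * x2 + b * y2]. Differentiating these equations gives [(a', b') = k * (- y1, x1)], where [k]
    is the determinant of the first three derivatives divided by a square. Hence the height of the
    tangent direction at [s1] over the osculating plane at [s], which is zero for [s = s1], has the
    derivative [- k * (x1 s * y1 s1 - y1 s * x1 s1)] in [s]. For [k >= 0] this height is nonnegative when
    [s1] comes within half a turn after [s] or within half a turn before [s]. As the curve turns only
    once, this covers all [s1]: the height of the curve over the osculating plane at [0] is
    nondecreasing, and being periodic it is constant. *)
Lemma one_signed_torsion_planar (x y t x1 y1 t1 x2 y2 t2 x3 y3 t3 : R -> R) (L : R) :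
  (forall s, is_derive x s (x1 s)) -> (forall s, is_derive y s (y1 s)) ->
  (forall s, is_derive t s (t1 s)) ->
  (forall s, is_derive x1 s (x2 s)) -> (forall s, is_derive y1 s (y2 s)) ->
  (forall s, is_derive t1 s (t2 s)) ->
  (forall s, is_derive x2 s (x3 s)) -> (forall s, is_derive y2 s (y3 s)) ->
  (forall s, is_derive t2 s (t3 s)) ->
  0 < L ->
  (forall s, x (s + L) = x s) -> (forall s, y (s + L) = y s) ->
  (forall s, t (s + L) = t s) ->
  (forall s s', s < s' < s + L -> ~ (x s = x s' /\ y s = y s')) ->
  (forall s, 0 < x1 s * y2 s - y1 s * x2 s) ->
  (forall s, 0 <= x1 s * (y2 s * t3 s - t2 s * y3 s) - y1 s * (x2 s * t3 s - t2 s * x3 s)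
                  + t1 s * (x2 s * y3 s - y2 s * x3 s)) ->
  exists a b h, forall s, t s = a * x s + b * y s + h.
Proof.
  intros dx dy dt dx1 dy1 dt1 dx2 dy2 dt2 HL perx pery pert simple convex Hdet.
  destruct (tangent_angle x y x1 y1 x2 y2 L) as [rho [th [Hrho [Hcross [Hinc Hturn]]]]]; auto.
  { intros s. apply is_derive_continuity_pt with (1 := dx2 s). }
  { intros s. apply is_derive_continuity_pt with (1 := dy2 s). }
  pose proof (derivative_periodic x x1 L dx perx) as px1.
  pose proof (derivative_periodic y y1 L dy pery) as py1.
  pose proof (derivative_periodic t t1 L dt pert) as pt1.
  pose proof (derivative_periodic x1 x2 L dx1 px1) as px2.
  pose proof (derivative_periodic y1 y2 L dy1 py1) as py2.
  pose proof (derivative_periodic t1 t2 L dt1 pt1) as pt2.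
  set (Delta := fun s => x1 s * y2 s - y1 s * x2 s).
  set (a := fun s => (t1 s * y2 s - y1 s * t2 s) / Delta s).
  set (b := fun s => (x1 s * t2 s - t1 s * x2 s) / Delta s).
  set (D := fun s => x1 s * (y2 s * t3 s - t2 s * y3 s) - y1 s * (x2 s * t3 s - t2 s * x3 s)
                  + t1 s * (x2 s * y3 s - y2 s * x3 s)).
  assert (slope_derive : forall s,
    is_derive a s (- (D s / (Delta s * Delta s)) * y1 s) /\
    is_derive b s (D s / (Delta s * Delta s) * x1 s)).
  { intros s. pose proof (convex s) as Hc.
    assert (E1 : Derive (fun z => x1 z) s = x2 s) by (apply is_derive_unique, dx1).
    assert (E2 : Derive (fun z => y1 z) s = y2 s) by (apply is_derive_unique, dy1).
    assert (E3 : Derive (fun z => t1 z) s = t2 s) by (apply is_derive_unique, dt1).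
    assert (E4 : Derive (fun z => x2 z) s = x3 s) by (apply is_derive_unique, dx2).
    assert (E5 : Derive (fun z => y2 z) s = y3 s) by (apply is_derive_unique, dy2).
    assert (E6 : Derive (fun z => t2 z) s = t3 s) by (apply is_derive_unique, dt2).
    assert (D1 : ex_derive (fun z => x1 z) s) by (eexists; apply dx1).
    assert (D2 : ex_derive (fun z => y1 z) s) by (eexists; apply dy1).
    assert (D3 : ex_derive (fun z => t1 z) s) by (eexists; apply dt1).
    assert (D4 : ex_derive (fun z => x2 z) s) by (eexists; apply dx2).
    assert (D5 : ex_derive (fun z => y2 z) s) by (eexists; apply dy2).
    assert (D6 : ex_derive (fun z => t2 z) s) by (eexists; apply dt2).
    unfold a, b, D, Delta.
    split; (auto_derive; [repeat split; auto; lra|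
      rewrite ?E1, ?E2, ?E3, ?E4, ?E5, ?E6; field; lra]). }
  (* The height of the tangent direction at s1 over the osculating plane at s0 *)
  assert (Hw : forall s0 s1, s0 <= s1 <= s0 + L -> 0 <= t1 s1 - a s0 * x1 s1 - b s0 * y1 s1).
  { intros s0 s1 Hs.
    set (w := fun s => t1 s1 - a s * x1 s1 - b s * y1 s1).
    set (w' := fun s => - (D s / (Delta s * Delta s)) * (x1 s * y1 s1 - y1 s * x1 s1)).
    assert (dw : forall s, is_derive w s (w' s)).
    { intros s. destruct (slope_derive s) as [H1 H2].
      assert (E1 : Derive (fun z => a z) s = _) by (apply is_derive_unique, H1).
      assert (E2 : Derive (fun z => b z) s = _) by (apply is_derive_unique, H2).
      assert (D1 : ex_derive (fun z => a z) s) by (eexists; apply H1).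
      assert (D2 : ex_derive (fun z => b z) s) by (eexists; apply H2).
      unfold w, w'. auto_derive; [repeat split; auto|]. rewrite E1, E2. ring. }
    assert (Hq : forall s, 0 <= D s / (Delta s * Delta s)).
    { intros s. pose proof (convex s) as Hc. fold (Delta s) in Hc.
      apply Rmult_le_pos; [apply Hdet|]. left. apply Rinv_0_lt_compat. nra. }
    assert (w1 : w s1 = 0).
    { pose proof (convex s1). unfold w, a, b, Delta. field. lra. }
    change (0 <= w s0). destruct (Rle_lt_dec (th s1 - th s0) PI) as [Hle|Hgt].
    - enough (- w s0 <= - w s1) by lra.
      apply (derive_nonneg_increasing (fun s => - w s) (fun s => - w' s)); [lra| |].
      + intros s _. apply (is_derive_opp w s), dw.
      + intros s Hs'. unfold w'. rewrite Hcross.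
        pose proof (Hinc s s1 ltac:(lra)). pose proof (Hinc s0 s ltac:(lra)).
        assert (0 <= sin (th s1 - th s)) by (apply sin_ge_0; lra).
        replace (- (- (D s / (Delta s * Delta s)) * (rho s * rho s1 * sin (th s1 - th s))))
          with (D s / (Delta s * Delta s) * (rho s * rho s1 * sin (th s1 - th s))) by ring.
        apply Rmult_le_pos; [apply Hq|]. apply Rmult_le_pos; [|assumption].
        left. apply Rmult_lt_0_compat; apply Hrho.
    - assert (Hp : w (s0 + L) = w s0).
      { unfold w, a, b, Delta. rewrite px1, py1, pt1, px2, py2, pt2. reflexivity. }
      rewrite <- Hp, <- w1.
      apply (derive_nonneg_increasing w w'); [lra| |].
      + intros s _. apply dw.
      + intros s Hs'. unfold w'.
        replace (x1 s * y1 s1 - y1 s * x1 s1) with (- (x1 s1 * y1 s - y1 s1 * x1 s)) by ring.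
        rewrite Hcross.
        pose proof (Hinc s1 s ltac:(lra)). pose proof (Hinc s (s0 + L) ltac:(lra)).
        pose proof (Hturn s0).
        assert (0 <= sin (th s - th s1)) by (apply sin_ge_0; lra).
        replace (- (D s / (Delta s * Delta s)) * - (rho s1 * rho s * sin (th s - th s1)))
          with (D s / (Delta s * Delta s) * (rho s1 * rho s * sin (th s - th s1))) by ring.
        apply Rmult_le_pos; [apply Hq|]. apply Rmult_le_pos; [|assumption].
        left. apply Rmult_lt_0_compat; apply Hrho. }
  set (g := fun s => t s - a 0 * x s - b 0 * y s).
  assert (dg : forall s, is_derive g s (t1 s - a 0 * x1 s - b 0 * y1 s)).
  { intros s. unfold g.
    apply (is_derive_minus (fun s => t s - a 0 * x s) (fun s => b 0 * y s));
      [apply (is_derive_minus t (fun s => a 0 * x s)); [apply dt|]|];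
      apply is_derive_scal; auto. }
  assert (gmono : forall u v, 0 <= u -> u <= v -> v <= L -> g u <= g v).
  { intros u v H1 H2 H3.
    apply (derive_nonneg_increasing g (fun s => t1 s - a 0 * x1 s - b 0 * y1 s)); [lra| |].
    - intros s _. apply dg.
    - intros s Hs. apply Hw. lra. }
  assert (gper : forall s, g (s + L) = g s).
  { intros s. unfold g. rewrite perx, pery, pert. reflexivity. }
  exists (a 0), (b 0), (g 0). intros s.
  enough (g s = g 0) by (unfold g in *; lra).
  destruct (period_reduction L s HL) as [k Hk].
  rewrite <- (periodic_multiple g L gper k s).
  pose proof (gmono 0 _ ltac:(lra) (proj1 Hk) ltac:(lra)).
  pose proof (gmono _ L (proj1 Hk) ltac:(lra) ltac:(lra)).
  pose proof (gper 0). rewrite Rplus_0_l in *. lra.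
Qed.

(** * Strict derivatives and lines in the plane *)

Definition in_box (d u0 v0 u v : R) : Prop := Rabs (u - u0) < d /\ Rabs (v - v0) < d.

(** Increments are compared between any two points near [(u0, v0)], as needed for inverting a map
    and for recovering a function which is C^1 from its behaviour at single points. *)
Definition strict_derivative (f : R -> R -> R) (u0 v0 fu fv : R) : Prop :=
  forall eps, 0 < eps -> exists d, 0 < d /\
    forall u v u' v', in_box d u0 v0 u v -> in_box d u0 v0 u' v' ->
      Rabs (f u v - f u' v' - (fu * (u - u') + fv * (v - v')))
        <= eps * (Rabs (u - u') + Rabs (v - v')).

Lemma mean_value_deviation (g : R -> R) (u u' l eps : R) :
  (forall z, Rmin u u' <= z <= Rmax u u' -> ex_derive g z /\ Rabs (Derive g z - l) <= eps) ->
  Rabs (g u - g u' - l * (u - u')) <= eps * Rabs (u - u').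
Proof.
  intros H.
  destruct (MVT_gen g u' u (Derive g)) as [c [Hc Hc']].
  - intros z Hz. apply Derive_correct, H. rewrite Rmin_comm, Rmax_comm. lra.
  - intros z Hz. apply continuity_pt_filterlim, (ex_derive_continuous g).
    apply H. rewrite Rmin_comm, Rmax_comm. lra.
  - rewrite Hc'. replace (Derive g c * (u - u') - l * (u - u'))
      with ((Derive g c - l) * (u - u')) by ring.
    rewrite Rabs_mult. apply Rmult_le_compat_r; [apply Rabs_pos|].
    apply H. rewrite Rmin_comm, Rmax_comm. lra.
Qed.

Lemma between_in_interval (d c u u' z : R) :
  Rabs (u - c) < d -> Rabs (u' - c) < d -> Rmin u u' <= z <= Rmax u u' -> Rabs (z - c) < d.
Proof.
  intros H1 H2 Hz. apply Rabs_def2 in H1. apply Rabs_def2 in H2.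
  apply Rabs_def1; revert Hz; unfold Rmin, Rmax; destruct Rle_dec; lra.
Qed.

Lemma open_box (U : R * R -> Prop) (u v : R) :
  open U -> U (u, v) ->
  exists d, 0 < d /\ forall u' v', in_box d u v u' v' -> U (u', v').
Proof.
  intros HU Huv. destruct (HU _ Huv) as [[d Hd] Hd'].
  exists d. split; [exact Hd|]. intros u' v' [H1 H2]. apply Hd'. split; assumption.
Qed.

Lemma continuously_differentiable_strict (U : R * R -> Prop) (f : R -> R -> R) (u0 v0 : R) :
  open U -> (forall u v, U (u, v) -> ex_diff_n f 1 u v) -> U (u0, v0) ->
  strict_derivative f u0 v0 (Derive (fun z => f z v0) u0) (Derive (fun z => f u0 z) v0).
Proof.
  intros HU Hf H0 eps He.
  destruct (open_box U u0 v0 HU H0) as [d0 [Hd0 Hbox]].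
  destruct (Hf u0 v0 H0) as [_ [_ [_ [[C1 _] [C2 _]]]]].
  destruct (C1 (mkposreal eps He)) as [[d1 Hd1] Hd1']. simpl in Hd1'.
  destruct (C2 (mkposreal eps He)) as [[d2 Hd2] Hd2']. simpl in Hd2'.
  set (d := Rmin d0 (Rmin d1 d2)).
  assert (Hd : 0 < d) by (repeat apply Rmin_pos; assumption).
  assert (L0 : d <= d0) by apply Rmin_l.
  assert (L1 : d <= d1) by (eapply Rle_trans; [apply Rmin_r|apply Rmin_l]).
  assert (L2 : d <= d2) by (eapply Rle_trans; [apply Rmin_r|apply Rmin_r]).
  exists d. split; [exact Hd|]. intros u v u' v' [Hu Hv] [Hu' Hv'].
  set (fu := Derive (fun z => f z v0) u0) in *. set (fv := Derive (fun z => f u0 z) v0) in *.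
  assert (A : Rabs (f u v - f u' v - fu * (u - u')) <= eps * Rabs (u - u')).
  { apply (mean_value_deviation (fun z => f z v)). intros z Hz.
    pose proof (between_in_interval _ _ _ _ _ Hu Hu' Hz) as Hz'.
    split.
    - destruct (Hf z v) as [_ [E _]]; [apply Hbox; split; lra|exact E].
    - left. apply Hd1'; simpl; lra. }
  assert (B : Rabs (f u' v - f u' v' - fv * (v - v')) <= eps * Rabs (v - v')).
  { apply (mean_value_deviation (fun z => f u' z)). intros z Hz.
    pose proof (between_in_interval _ _ _ _ _ Hv Hv' Hz) as Hz'.
    split.
    - destruct (Hf u' z) as [_ [_ [E _]]]; [apply Hbox; split; lra|exact E].
    - left. apply Hd2'; simpl; lra. }
  replace (f u v - f u' v' - (fu * (u - u') + fv * (v - v')))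
    with ((f u v - f u' v - fu * (u - u')) + (f u' v - f u' v' - fv * (v - v'))) by ring.
  eapply Rle_trans; [apply Rabs_triang|]. lra.
Qed.

Lemma strict_derivative_line (f : R -> R -> R) (u0 v0 a b s fu fv : R) :
  strict_derivative f (u0 + s * a) (v0 + s * b) fu fv ->
  is_derive (fun z => f (u0 + z * a) (v0 + z * b)) s (fu * a + fv * b).
Proof.
  intros Hf. apply is_derive_eps. intros eps He.
  set (k := Rabs a + Rabs b + 1).
  assert (Hk : 0 < k) by (unfold k; pose proof (Rabs_pos a); pose proof (Rabs_pos b); lra).
  destruct (Hf (eps / k)) as [d [Hd Hd']]; [apply Rdiv_lt_0_compat; lra|].
  exists (d / k). split; [apply Rdiv_lt_0_compat; lra|]. intros y Hy.
  assert (Hyd : Rabs (y - s) * k < d).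
  { apply Rmult_lt_compat_r with (r := k) in Hy; [|exact Hk].
    replace (d / k * k) with d in Hy by (field; lra). exact Hy. }
  pose proof (Rabs_pos (y - s)). pose proof (Rabs_pos a). pose proof (Rabs_pos b).
  specialize (Hd' (u0 + y * a) (v0 + y * b) (u0 + s * a) (v0 + s * b)).
  replace (u0 + y * a - (u0 + s * a)) with ((y - s) * a) in Hd' by ring.
  replace (v0 + y * b - (v0 + s * b)) with ((y - s) * b) in Hd' by ring.
  rewrite !Rabs_mult in Hd'.
  replace ((fu * a + fv * b) * (y - s)) with (fu * ((y - s) * a) + fv * ((y - s) * b)) by ring.
  eapply Rle_trans; [apply Hd'|].
  - split.
    + replace (u0 + y * a - (u0 + s * a)) with ((y - s) * a) by ring. rewrite Rabs_mult.
      unfold k in Hyd. nra.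
    + replace (v0 + y * b - (v0 + s * b)) with ((y - s) * b) by ring. rewrite Rabs_mult.
      unfold k in Hyd. nra.
  - split; rewrite Rminus_diag, Rabs_R0; exact Hd.
  - apply Rle_trans with (eps / k * (Rabs (y - s) * k)).
    + apply Rmult_le_compat_l; [left; apply Rdiv_lt_0_compat; lra|]. unfold k. nra.
    + right. field. lra.
Qed.

(** By the chain rule the derivative of the restriction is a linear combination of the restrictions
    of the two partial derivatives, to which the induction hypothesis applies. *)
Lemma smooth_along_line (U : R * R -> Prop) (u0 v0 a b : R) :
  open U -> forall n (f : R -> R -> R),
  (forall m u v, U (u, v) -> ex_diff_n f m u v) ->
  forall k s, (k <= n)%nat -> U (u0 + s * a, v0 + s * b) ->
  ex_derive_n (fun z => f (u0 + z * a) (v0 + z * b)) k s.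
Proof.
  intros HU.
  assert (Hloc : forall s, U (u0 + s * a, v0 + s * b) ->
    locally s (fun z => U (u0 + z * a, v0 + z * b))).
  { intros s Hs. destruct (open_box U _ _ HU Hs) as [d [Hd Hd']].
    set (k := Rabs a + Rabs b + 1).
    pose proof (Rabs_pos a) as Pa. pose proof (Rabs_pos b) as Pb.
    assert (Hk : 0 < k) by (unfold k; lra).
    assert (Hdk : 0 < d / k) by (apply Rdiv_lt_0_compat; lra).
    exists (mkposreal _ Hdk). intros z Hz. apply Hd'.
    change (Rabs (z - s) < d / k) in Hz.
    assert (Hyd : Rabs (z - s) * k < d).
    { apply Rmult_lt_compat_r with (r := k) in Hz; [|exact Hk].
      replace (d / k * k) with d in Hz by (field; lra). exact Hz. }
    pose proof (Rabs_pos (z - s)). unfold k in Hyd.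
    split.
    - replace (u0 + z * a - (u0 + s * a)) with ((z - s) * a) by ring. rewrite Rabs_mult. nra.
    - replace (v0 + z * b - (v0 + s * b)) with ((z - s) * b) by ring. rewrite Rabs_mult. nra. }
  induction n as [|n IH]; intros f Hf k s Hk Hs.
  { replace k with 0%nat by lia. exact I. }
  destruct k as [|k]; [exact I|].
  set (fu := fun u v => Derive (fun z => f z v) u).
  set (fv := fun u v => Derive (fun z => f u z) v).
  assert (Hfu : forall m u v, U (u, v) -> ex_diff_n fu m u v).
  { intros m u v Huv. destruct (Hf (S m) u v Huv) as [_ [_ [_ [H _]]]]. exact H. }
  assert (Hfv : forall m u v, U (u, v) -> ex_diff_n fv m u v).
  { intros m u v Huv. destruct (Hf (S m) u v Huv) as [_ [_ [_ [_ H]]]]. exact H. }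
  set (g := fun z => f (u0 + z * a) (v0 + z * b)).
  set (h := fun z => a * fu (u0 + z * a) (v0 + z * b) + b * fv (u0 + z * a) (v0 + z * b)).
  assert (Hd : forall z, U (u0 + z * a, v0 + z * b) -> is_derive g z (h z)).
  { intros z Hz. unfold h. rewrite (Rmult_comm a), (Rmult_comm b).
    apply strict_derivative_line, (continuously_differentiable_strict U); auto. }
  assert (Hh : ex_derive_n h k s).
  { apply ex_derive_n_plus.
    - generalize (Hloc s Hs). apply filter_imp. intros z Hz j Hj.
      apply ex_derive_n_scal_l. apply (IH fu); auto. lia.
    - generalize (Hloc s Hs). apply filter_imp. intros z Hz j Hj.
      apply ex_derive_n_scal_l. apply (IH fv); auto. lia. }
  destruct k as [|k].
  - exists (h s). apply Hd, Hs.
  - assert (Hh' : ex_derive_n (Derive g) (S k) s).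
    { apply ex_derive_n_ext_loc with h; [|exact Hh].
      generalize (Hloc s Hs). apply filter_imp. intros z Hz.
      symmetry. apply is_derive_unique, Hd, Hz. }
    simpl in Hh'. change (ex_derive (Derive_n g (S k)) s).
    apply ex_derive_ext with (2 := Hh'). intros z.
    change (Derive_n (Derive_n g 1) k z = Derive_n g (S k) z).
    rewrite Derive_n_comp. f_equal. lia.
Qed.

(** The map [z -> z + ((x, y) - G z)] contracts the box by a factor 1/2, and its fixed point solves
    [G z = (x, y)]. *)
Lemma near_identity_onto (G1 G2 : R -> R -> R) (u0 v0 e x y : R) :
  (forall u v u' v', in_box e u0 v0 u v -> in_box e u0 v0 u' v' ->
     Rabs (G1 u v - G1 u' v' - (u - u')) <= / 4 * (Rabs (u - u') + Rabs (v - v')) /\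
     Rabs (G2 u v - G2 u' v' - (v - v')) <= / 4 * (Rabs (u - u') + Rabs (v - v'))) ->
  Rabs (x - G1 u0 v0) < e / 8 -> Rabs (y - G2 u0 v0) < e / 8 ->
  exists u v, in_box e u0 v0 u v /\ G1 u v = x /\ G2 u v = y.
Proof.
  intros HG Hx Hy.
  set (step := fun z : R * R => (fst z + (x - G1 (fst z) (snd z)), snd z + (y - G2 (fst z) (snd z)))).
  set (zs := fun n => Nat.iter n step (u0, v0)).
  set (us := fun n => fst (zs n)). set (vs := fun n => snd (zs n)).
  assert (Su : forall n, us (S n) = us n + (x - G1 (us n) (vs n))) by reflexivity.
  assert (Sv : forall n, vs (S n) = vs n + (y - G2 (us n) (vs n))) by reflexivity.
  assert (He : 0 < e) by (pose proof (Rabs_pos (x - G1 u0 v0)); lra).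
  set (M := fun n => Rabs (us (S n) - us n) + Rabs (vs (S n) - vs n)).
  assert (Hpow : forall n, 0 < (/ 2) ^ n) by (intros; apply pow_lt; lra).
  assert (Hinv : forall n, Rabs (us n - u0) + Rabs (vs n - v0) <= e / 2 * (1 - (/ 2) ^ n) /\
    M n <= e / 4 * (/ 2) ^ n).
  { induction n as [|n [IH1 IH2]].
    - split.
      + change (us 0%nat) with u0. change (vs 0%nat) with v0.
        rewrite !Rminus_diag, !Rabs_R0. simpl. lra.
      + unfold M. rewrite Su, Sv. change (us 0%nat) with u0. change (vs 0%nat) with v0.
        replace (u0 + (x - G1 u0 v0) - u0) with (x - G1 u0 v0) by ring.
        replace (v0 + (y - G2 u0 v0) - v0) with (y - G2 u0 v0) by ring. simpl. lra.
    - assert (A1 : Rabs (us (S n) - u0) + Rabs (vs (S n) - v0) <= e / 2 * (1 - (/ 2) ^ S n)).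
      { replace (us (S n) - u0) with ((us (S n) - us n) + (us n - u0)) by ring.
        replace (vs (S n) - v0) with ((vs (S n) - vs n) + (vs n - v0)) by ring.
        pose proof (Rabs_triang (us (S n) - us n) (us n - u0)).
        pose proof (Rabs_triang (vs (S n) - vs n) (vs n - v0)).
        unfold M in IH2. simpl. lra. }
      split; [exact A1|].
      pose proof (Hpow n). pose proof (Hpow (S n)).
      pose proof (Rabs_pos (us n - u0)). pose proof (Rabs_pos (vs n - v0)).
      pose proof (Rabs_pos (us (S n) - u0)). pose proof (Rabs_pos (vs (S n) - v0)).
      destruct (HG (us n) (vs n) (us (S n)) (vs (S n))) as [B1 B2]; [split; nra|split; nra|].
      unfold M in *. rewrite (Su (S n)), (Sv (S n)).
      replace (us (S n) + (x - G1 (us (S n)) (vs (S n))) - us (S n))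
        with (G1 (us n) (vs n) - G1 (us (S n)) (vs (S n)) - (us n - us (S n))) by (rewrite (Su n); ring).
      replace (vs (S n) + (y - G2 (us (S n)) (vs (S n))) - vs (S n))
        with (G2 (us n) (vs n) - G2 (us (S n)) (vs (S n)) - (vs n - vs (S n))) by (rewrite (Sv n); ring).
      rewrite (Rabs_minus_sym (us n)) in B1, B2. rewrite (Rabs_minus_sym (vs n)) in B1, B2.
      simpl. lra. }
  assert (Hcauchy : forall n k, Rabs (us (n + k)%nat - us n) + Rabs (vs (n + k)%nat - vs n)
            <= e / 2 * ((/ 2) ^ n - (/ 2) ^ (n + k))).
  { intros n. induction k as [|k IH].
    - rewrite Nat.add_0_r, !Rminus_diag, Rabs_R0. lra.
    - rewrite Nat.add_succ_r. destruct (Hinv (n + k)%nat) as [_ HM]. unfold M in HM.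
      replace (us (S (n + k)) - us n) with ((us (S (n + k)) - us (n + k)%nat) + (us (n + k)%nat - us n)) by ring.
      replace (vs (S (n + k)) - vs n) with ((vs (S (n + k)) - vs (n + k)%nat) + (vs (n + k)%nat - vs n)) by ring.
      pose proof (Rabs_triang (us (S (n + k)) - us (n + k)%nat) (us (n + k)%nat - us n)).
      pose proof (Rabs_triang (vs (S (n + k)) - vs (n + k)%nat) (vs (n + k)%nat - vs n)).
      simpl. lra. }
  assert (Hlim : forall w : nat -> R, (forall n k, Rabs (w (n + k)%nat - w n) <= e * (/ 2) ^ n) ->
     exists l : R, is_lim_seq w l).
  { intros w Hw. apply ex_lim_seq_cauchy_corr. intros eps.
    destruct (pow_lt_1_zero (/ 2)) with (y := eps / (2 * e)) as [k Hk].
    { rewrite Rabs_pos_eq; lra. }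
    { apply Rdiv_lt_0_compat; [apply cond_pos|lra]. }
    specialize (Hk k (Nat.le_refl k)). rewrite Rabs_pos_eq in Hk by (left; apply Hpow).
    assert (Hk' : e * (/ 2) ^ k < eps / 2).
    { apply Rmult_lt_compat_l with (r := e) in Hk; [|exact He].
      replace (e * (eps / (2 * e))) with (eps / 2) in Hk by (field; lra). exact Hk. }
    exists k. intros n m Hn Hm.
    pose proof (Hw k (n - k)%nat) as A. pose proof (Hw k (m - k)%nat) as B.
    replace (k + (n - k))%nat with n in A by lia. replace (k + (m - k))%nat with m in B by lia.
    replace (w n - w m) with ((w n - w k) - (w m - w k)) by ring.
    eapply Rle_lt_trans; [apply Rabs_triang|]. rewrite Rabs_Ropp. lra. }
  destruct (Hlim us) as [u Hu].
  { intros n k. pose proof (Hcauchy n k). pose proof (Hpow n). pose proof (Hpow (n + k)%nat).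
    pose proof (Rabs_pos (vs (n + k)%nat - vs n)). nra. }
  destruct (Hlim vs) as [v Hv].
  { intros n k. pose proof (Hcauchy n k). pose proof (Hpow n). pose proof (Hpow (n + k)%nat).
    pose proof (Rabs_pos (us (n + k)%nat - us n)). nra. }
  assert (Hin : forall n, Rabs (us n - u0) <= e / 2 /\ Rabs (vs n - v0) <= e / 2).
  { intros n. destruct (Hinv n) as [H _]. pose proof (Hpow n).
    pose proof (Rabs_pos (us n - u0)). pose proof (Rabs_pos (vs n - v0)). split; nra. }
  assert (Hbox : in_box e u0 v0 u v).
  { assert (Hle : forall (w : nat -> R) (l c : R), (forall n, Rabs (w n - c) <= e / 2) -> is_lim_seq w l -> Rabs (l - c) < e).
    { intros w l c Hw Hwl. apply Rle_lt_trans with (e / 2); [|lra].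
      apply (is_lim_seq_le (fun n => Rabs (w n - c)) (fun _ => e / 2) (Rabs (l - c)) (e / 2));
        [exact Hw| |apply is_lim_seq_const].
      apply (is_lim_seq_abs (fun n => w n - c) (l - c)).
      apply (is_lim_seq_minus' w (fun _ => c)); [exact Hwl|apply is_lim_seq_const]. }
    split; [apply (Hle us)|apply (Hle vs)]; auto; intros n; apply Hin. }
  exists u, v. split; [exact Hbox|].
  (* |G z - w| <= |G z - G z_n - (z - z_n)| + |z - z_n| + |w - G z_n|, which tends to 0 *)
  assert (Hsmall : is_lim_seq (fun n => 2 * (Rabs (u - us n) + Rabs (v - vs n)) + e / 4 * (/ 2) ^ n) 0).
  { replace 0 with (2 * (Rabs (u - u) + Rabs (v - v)) + e / 4 * 0)
      by (rewrite !Rminus_diag, Rabs_R0; ring).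
    apply is_lim_seq_plus'.
    - apply (is_lim_seq_scal_l _ 2 (Rabs (u - u) + Rabs (v - v))).
      apply is_lim_seq_plus'; [apply (is_lim_seq_abs _ (u - u))|apply (is_lim_seq_abs _ (v - v))];
        apply is_lim_seq_minus'; auto using is_lim_seq_const.
    - apply (is_lim_seq_scal_l _ (e / 4) 0). apply is_lim_seq_geom. rewrite Rabs_pos_eq; lra. }
  assert (Hz : forall c, (forall n, Rabs c <= 2 * (Rabs (u - us n) + Rabs (v - vs n)) + e / 4 * (/ 2) ^ n) -> c = 0).
  { intros c Hc.
    assert (Rabs c <= 0).
    { apply (is_lim_seq_le (fun _ => Rabs c) _ (Rabs c) 0 Hc); [apply is_lim_seq_const|exact Hsmall]. }
    apply NNPP. intros Hn. apply Rabs_pos_lt in Hn. lra. }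
  split; apply Rminus_diag_uniq, Hz; intros n.
  - destruct (HG u v (us n) (vs n)) as [B _]; [exact Hbox|destruct (Hin n); split; lra|].
    destruct (Hinv n) as [_ HM]. unfold M in HM.
    replace (G1 u v - x) with ((G1 u v - G1 (us n) (vs n) - (u - us n)) + ((u - us n) - (us (S n) - us n)))
      by (rewrite (Su n); ring).
    eapply Rle_trans; [apply Rabs_triang|].
    pose proof (Rabs_triang (u - us n) (- (us (S n) - us n))) as T. rewrite Rabs_Ropp in T.
    unfold Rminus in *.
    pose proof (Rabs_pos (u + - us n)). pose proof (Rabs_pos (v + - vs n)).
    pose proof (Rabs_pos (vs (S n) + - vs n)). lra.
  - destruct (HG u v (us n) (vs n)) as [_ B]; [exact Hbox|destruct (Hin n); split; lra|].
    destruct (Hinv n) as [_ HM]. unfold M in HM.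
    replace (G2 u v - y) with ((G2 u v - G2 (us n) (vs n) - (v - vs n)) + ((v - vs n) - (vs (S n) - vs n)))
      by (rewrite (Sv n); ring).
    eapply Rle_trans; [apply Rabs_triang|].
    pose proof (Rabs_triang (v - vs n) (- (vs (S n) - vs n))) as T. rewrite Rabs_Ropp in T.
    unfold Rminus in *.
    pose proof (Rabs_pos (u + - us n)). pose proof (Rabs_pos (v + - vs n)).
    pose proof (Rabs_pos (us (S n) + - us n)). lra.
Qed.

(** * Spacelike hypersurfaces are local graphs *)

(** Composed with the inverse of its derivative at [(u0, v0)] the map is close to the identity in the
    sense of [near_identity_onto], where the Lipschitz bound for the inverse is read off directly. *)
Lemma strict_local_inverse (F1 F2 : R -> R -> R) (u0 v0 a b c d : R) :
  strict_derivative F1 u0 v0 a b -> strict_derivative F2 u0 v0 c d ->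
  a * d - b * c <> 0 ->
  (exists K r, 0 < K /\ 0 < r /\ forall u v u' v',
     in_box r u0 v0 u v -> in_box r u0 v0 u' v' ->
     Rabs (u - u') + Rabs (v - v')
       <= K * (Rabs (F1 u v - F1 u' v') + Rabs (F2 u v - F2 u' v'))) /\
  (forall eps, 0 < eps -> exists r, 0 < r /\ forall x y,
     in_box r (F1 u0 v0) (F2 u0 v0) x y ->
     exists u v, in_box eps u0 v0 u v /\ F1 u v = x /\ F2 u v = y).
Proof.
  intros HF1 HF2 Hdet. set (D := a * d - b * c) in *.
  set (m := Rabs a + Rabs b + Rabs c + Rabs d).
  pose proof (Rabs_pos a) as Pa. pose proof (Rabs_pos b) as Pb.
  pose proof (Rabs_pos c) as Pc. pose proof (Rabs_pos d) as Pd.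
  pose proof (Rabs_pos_lt D Hdet) as PD.
  assert (Hm : 0 < m).
  { apply Rnot_le_lt. intros Hm. apply Hdet. unfold D.
    assert (Rabs a = 0) by (unfold m in Hm; lra). assert (Rabs b = 0) by (unfold m in Hm; lra).
    assert (a = 0) by (apply NNPP; intros Hn; apply Rabs_pos_lt in Hn; lra).
    assert (b = 0) by (apply NNPP; intros Hn; apply Rabs_pos_lt in Hn; lra).
    subst. ring. }
  set (K := m / Rabs D).
  assert (HK : 0 < K) by (apply Rdiv_lt_0_compat; assumption).
  (* the rows of the inverse matrix have norm at most K *)
  assert (Hrow : forall p q x y, Rabs p + Rabs q <= m ->
            Rabs ((p * x + q * y) / D) <= K * Rmax (Rabs x) (Rabs y)).
  { intros p q x y Hpq. unfold Rdiv. rewrite Rabs_mult, Rabs_inv.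
    pose proof (Rmax_l (Rabs x) (Rabs y)). pose proof (Rmax_r (Rabs x) (Rabs y)).
    set (M := Rmax (Rabs x) (Rabs y)) in *.
    assert (Rabs (p * x + q * y) <= m * M).
    { eapply Rle_trans; [apply Rabs_triang|]. rewrite !Rabs_mult.
      pose proof (Rabs_pos p). pose proof (Rabs_pos q).
      pose proof (Rabs_pos x). pose proof (Rabs_pos y). nra. }
    unfold K, Rdiv. rewrite (Rmult_comm m), Rmult_assoc, (Rmult_comm (Rabs _)).
    apply Rmult_le_compat_l; [left; apply Rinv_0_lt_compat; exact PD|assumption]. }
  set (G1 := fun u v => (d * F1 u v + - b * F2 u v) / D).
  set (G2 := fun u v => (- c * F1 u v + a * F2 u v) / D).
  set (e := / (4 * K)).
  assert (He : 0 < e) by (apply Rinv_0_lt_compat; lra).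
  destruct (HF1 e He) as [d1 [Hd1 Hd1']]. destruct (HF2 e He) as [d2 [Hd2 Hd2']].
  set (r := Rmin d1 d2).
  assert (Hr : 0 < r) by (apply Rmin_pos; assumption).
  assert (L1 : r <= d1) by apply Rmin_l. assert (L2 : r <= d2) by apply Rmin_r.
  assert (HG : forall u v u' v', in_box r u0 v0 u v -> in_box r u0 v0 u' v' ->
     Rabs (G1 u v - G1 u' v' - (u - u')) <= / 4 * (Rabs (u - u') + Rabs (v - v')) /\
     Rabs (G2 u v - G2 u' v' - (v - v')) <= / 4 * (Rabs (u - u') + Rabs (v - v'))).
  { intros u v u' v' [H1 H2] [H1' H2'].
    assert (E1 := Hd1' u v u' v' ltac:(split; lra) ltac:(split; lra)).
    assert (E2 := Hd2' u v u' v' ltac:(split; lra) ltac:(split; lra)).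
    set (e1 := F1 u v - F1 u' v' - (a * (u - u') + b * (v - v'))) in *.
    set (e2 := F2 u v - F2 u' v' - (c * (u - u') + d * (v - v'))) in *.
    set (n := Rabs (u - u') + Rabs (v - v')) in *.
    assert (HM : K * Rmax (Rabs e1) (Rabs e2) <= / 4 * n).
    { replace (/ 4 * n) with (K * (e * n)) by (unfold e; field; lra).
      apply Rmult_le_compat_l; [lra|]. apply Rmax_lub; assumption. }
    split.
    - replace (G1 u v - G1 u' v' - (u - u')) with ((d * e1 + - b * e2) / D)
        by (unfold G1, e1, e2, D in *; field; exact Hdet).
      eapply Rle_trans; [apply Hrow; rewrite Rabs_Ropp; unfold m; lra|exact HM].
    - replace (G2 u v - G2 u' v' - (v - v')) with ((- c * e1 + a * e2) / D)
        by (unfold G2, e1, e2, D in *; field; exact Hdet).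
      eapply Rle_trans; [apply Hrow; rewrite Rabs_Ropp; unfold m; lra|exact HM]. }
  split.
  - exists (4 * K), r. split; [lra|]. split; [exact Hr|]. intros u v u' v' H H'.
    destruct (HG u v u' v' H H') as [A B].
    set (x := F1 u v - F1 u' v'). set (y := F2 u v - F2 u' v').
    assert (A' := Hrow d (- b) x y ltac:(rewrite Rabs_Ropp; unfold m; lra)).
    assert (B' := Hrow (- c) a x y ltac:(rewrite Rabs_Ropp; unfold m; lra)).
    replace (G1 u v - G1 u' v') with ((d * x + - b * y) / D) in A by (unfold G1, x, y; field; exact Hdet).
    replace (G2 u v - G2 u' v') with ((- c * x + a * y) / D) in B by (unfold G2, x, y; field; exact Hdet).
    assert (HM : Rmax (Rabs x) (Rabs y) <= Rabs x + Rabs y).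
    { pose proof (Rabs_pos x). pose proof (Rabs_pos y). apply Rmax_lub; lra. }
    apply Rmult_le_compat_l with (r := K) in HM; [|lra].
    pose proof (Rabs_triang ((d * x + - b * y) / D) (- ((d * x + - b * y) / D - (u - u')))) as T1.
    pose proof (Rabs_triang ((- c * x + a * y) / D) (- ((- c * x + a * y) / D - (v - v')))) as T2.
    rewrite Rabs_Ropp in T1, T2.
    replace ((d * x + - b * y) / D + - ((d * x + - b * y) / D - (u - u'))) with (u - u') in T1 by ring.
    replace ((- c * x + a * y) / D + - ((- c * x + a * y) / D - (v - v'))) with (v - v') in T2 by ring.
    lra.
  - intros eps Heps. set (s := Rmin eps r).
    assert (Hs : 0 < s) by (apply Rmin_pos; assumption).
    assert (Ls : s <= eps) by apply Rmin_l. assert (Lr : s <= r) by apply Rmin_r.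
    exists (s / (16 * K)). split; [apply Rdiv_lt_0_compat; lra|]. intros x y [Hx Hy].
    destruct (near_identity_onto G1 G2 u0 v0 s ((d * x + - b * y) / D) ((- c * x + a * y) / D))
      as [u [v [[Hu Hv] [E1 E2]]]].
    + intros u v u' v' [H1 H2] [H1' H2']. apply HG; split; lra.
    + replace ((d * x + - b * y) / D - G1 u0 v0)
        with ((d * (x - F1 u0 v0) + - b * (y - F2 u0 v0)) / D) by (unfold G1; field; exact Hdet).
      eapply Rle_lt_trans; [apply Hrow; rewrite Rabs_Ropp; unfold m; lra|].
      apply Rle_lt_trans with (K * (s / (16 * K))); [|replace (K * (s / (16 * K))) with (s / 16) by (field; lra); lra].
      apply Rmult_le_compat_l; [lra|]. apply Rmax_lub; lra.
    + replace ((- c * x + a * y) / D - G2 u0 v0)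
        with ((- c * (x - F1 u0 v0) + a * (y - F2 u0 v0)) / D) by (unfold G2; field; exact Hdet).
      eapply Rle_lt_trans; [apply Hrow; rewrite Rabs_Ropp; unfold m; lra|].
      apply Rle_lt_trans with (K * (s / (16 * K))); [|replace (K * (s / (16 * K))) with (s / 16) by (field; lra); lra].
      apply Rmult_le_compat_l; [lra|]. apply Rmax_lub; lra.
    + exists u, v. split; [split; lra|].
      assert (I1 : forall x y, a * ((d * x + - b * y) / D) + b * ((- c * x + a * y) / D) = x)
        by (intros; unfold D in *; field; exact Hdet).
      assert (I2 : forall x y, c * ((d * x + - b * y) / D) + d * ((- c * x + a * y) / D) = y)
        by (intros; unfold D in *; field; exact Hdet).
      unfold G1, G2 in E1, E2. split.
      * rewrite <- (I1 (F1 u v) (F2 u v)), <- (I1 x y), E1, E2. reflexivity.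
      * rewrite <- (I2 (F1 u v) (F2 u v)), <- (I2 x y), E1, E2. reflexivity.
Qed.

Definition near (d : R) (p q : R3) : Prop :=
  Rabs (px q - px p) < d /\ Rabs (py q - py p) < d /\ Rabs (pt q - pt p) < d.

(** Chords of [S] near [p] make a small angle with the plane of slopes [(l, m)]. *)
Definition tilt_bound (S : R3 -> Prop) (p : R3) (l m eps d : R) : Prop :=
  forall q q', S q -> S q' -> near d p q -> near d p q' ->
    Rabs (pt q - pt q' - (l * (px q - px q') + m * (py q - py q')))
      <= eps * (Rabs (px q - px q') + Rabs (py q - py q')).

(** At all points of [S] together, these conditions say that [S] is locally the graph, over the spatial
    plane, of a C^1 function whose gradient [(l, m)] is shorter than 1. No function is named: the second
    condition is its strict differentiability and the third one says that its domain is open. *)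
Definition spacelike_graph_at (S : R3 -> Prop) (p : R3) (l m : R) : Prop :=
  l * l + m * m < 1 /\
  (forall eps, 0 < eps -> exists d, 0 < d /\ tilt_bound S p l m eps d) /\
  (forall eps, 0 < eps -> exists d, 0 < d /\ forall x y,
     in_box d (px p) (py p) x y ->
     exists q, S q /\ near eps p q /\ px q = x /\ py q = y).

(** Every linear combination of the two partial derivatives of a parametrization is the velocity of
    the image of a line. *)
Lemma parametrization_tangent (S V : R3 -> Prop) (U : R * R -> Prop)
    (phi : R * R -> R3) (psi : R3 -> R * R) (u v a b : R) :
  open U -> local_parametrization U (fun q => S q /\ V q) phi psi -> U (u, v) ->
  tangent S (phi (u, v))
    (plus (scal a (vderive (fun z => phi (z, v)) u)) (scal b (vderive (fun z => phi (u, z)) v))).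
Proof.
  intros HU [Hsm [_ [Hpsi _]]] Huv.
  destruct (open_box U u v HU Huv) as [d [Hd Hd']].
  set (k := Rabs a + Rabs b + 1).
  pose proof (Rabs_pos a) as Pa. pose proof (Rabs_pos b) as Pb.
  assert (Hk : 0 < k) by (unfold k; lra).
  assert (Hdk : 0 < d / k) by (apply Rdiv_lt_0_compat; lra).
  assert (Hin : forall s, Rabs s < d / k -> U (u + s * a, v + s * b)).
  { intros s Hs. apply Hd'.
    assert (Hyd : Rabs s * k < d).
    { apply Rmult_lt_compat_r with (r := k) in Hs; [|exact Hk].
      replace (d / k * k) with d in Hs by (field; lra). exact Hs. }
    pose proof (Rabs_pos s). unfold k in Hyd.
    split.
    - replace (u + s * a - u) with (s * a) by ring. rewrite Rabs_mult. nra.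
    - replace (v + s * b - v) with (s * b) by ring. rewrite Rabs_mult. nra. }
  assert (E0 : (u + 0 * a, v + 0 * b) = (u, v)) by (f_equal; ring).
  exists (mkposreal _ Hdk), (fun s => phi (u + s * a, v + s * b)).
  split; [|split; [|split]].
  - intros n s Hs. simpl in Hs. specialize (Hin s Hs).
    split; [|split].
    + apply (smooth_along_line U u v a b HU n (fun x y => px (phi (x, y)))); auto.
      intros; apply Hsm; auto.
    + apply (smooth_along_line U u v a b HU n (fun x y => py (phi (x, y)))); auto.
      intros; apply Hsm; auto.
    + apply (smooth_along_line U u v a b HU n (fun x y => pt (phi (x, y)))); auto.
      intros; apply Hsm; auto.
  - intros s Hs. apply (Hpsi _ (Hin s Hs)).
  - rewrite E0. reflexivity.
  - assert (L : forall f : R -> R -> R, (forall u v, U (u, v) -> ex_diff_n f 1 u v) ->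
       Derive (fun s => f (u + s * a) (v + s * b)) 0
       = a * Derive (fun z => f z v) u + b * Derive (fun z => f u z) v).
    { intros f Hf. apply is_derive_unique.
      rewrite (Rmult_comm a), (Rmult_comm b). apply strict_derivative_line.
      rewrite !Rmult_0_l, !Rplus_0_r. apply (continuously_differentiable_strict U); auto. }
    unfold vderive.
    rewrite (L (fun x y => px (phi (x, y)))), (L (fun x y => py (phi (x, y)))),
      (L (fun x y => pt (phi (x, y)))); [reflexivity| | |]; intros; apply Hsm; auto.
Qed.

(** A vector in the kernel of the vertical projection is not spacelike, so that the projection of a
    parametrization has an invertible differential and [strict_local_inverse] applies. The slopes
    [(l, m)] of the tangent plane satisfy [l * l + m * m < 1] because the tangent vector over [(l, m)] is
    spacelike. *)
Lemma spacelike_hypersurface_graph (S : R3 -> Prop) (p : R3) :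
  hypersurface S -> spacelike_submanifold S -> S p ->
  exists l m, spacelike_graph_at S p l m.
Proof.
  intros HS Hsp Hp.
  destruct (HS p Hp) as [U [V [phi [psi [HU [HV [HVp Hloc]]]]]]].
  pose proof Hloc as Hloc'. destruct Hloc' as [Hsm [Himm [Hphi [Hpsi Hcont]]]].
  destruct (psi p) as [u v] eqn:Ez.
  destruct (Hpsi p (conj Hp HVp)) as [Huv Hpp]. rewrite Ez in Huv, Hpp.
  set (xf := fun a b => px (phi (a, b))). set (yf := fun a b => py (phi (a, b))).
  set (tf := fun a b => pt (phi (a, b))).
  assert (Sx := continuously_differentiable_strict U xf u v HU (fun a b H => proj1 (Hsm 1%nat a b H)) Huv).
  assert (Sy := continuously_differentiable_strict U yf u v HU (fun a b H => proj1 (proj2 (Hsm 1%nat a b H))) Huv).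
  assert (St := continuously_differentiable_strict U tf u v HU (fun a b H => proj2 (proj2 (Hsm 1%nat a b H))) Huv).
  set (xu := Derive (fun z => xf z v) u) in *. set (xv := Derive (fun z => xf u z) v) in *.
  set (yu := Derive (fun z => yf z v) u) in *. set (yv := Derive (fun z => yf u z) v) in *.
  set (tu := Derive (fun z => tf z v) u) in *. set (tv := Derive (fun z => tf u z) v) in *.
  (* The first fundamental form is positive definite. *)
  assert (Hpos : forall a b, (a <> 0 \/ b <> 0) ->
    (a * tu + b * tv) * (a * tu + b * tv)
    < (a * xu + b * xv) * (a * xu + b * xv) + (a * yu + b * yv) * (a * yu + b * yv)).
  { intros a b Hab.
    pose proof (parametrization_tangent S V U phi psi u v a b HU Hloc Huv) as Ht.
    rewrite Hpp in Ht. specialize (Hsp p _ Hp Ht).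
    assert (Hlt : 0 < (a * xu + b * xv) * (a * xu + b * xv) + (a * yu + b * yv) * (a * yu + b * yv)
        - (a * tu + b * tv) * (a * tu + b * tv)); [|lra].
    apply Hsp. intros H0. apply (Himm u v Huv) in H0. tauto. }
  set (D := xu * yv - xv * yu).
  assert (HD : D <> 0).
  { intros H0.
    assert (Hk : exists a b, (a <> 0 \/ b <> 0) /\ a * xu + b * xv = 0 /\ a * yu + b * yv = 0).
    { assert (Hnz : forall x y, ~ (x = 0 /\ y = 0) -> y <> 0 \/ - x <> 0).
      { intros x y Hn. destruct (Req_dec y 0); [right|left; assumption].
        intros Hx. apply Hn. split; lra. }
      destruct (classic (xu = 0 /\ xv = 0)) as [[Z1 Z2]|Hn].
      - destruct (classic (yu = 0 /\ yv = 0)) as [[Z3 Z4]|Hn'].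
        + exists 1, 0. rewrite Z1, Z2, Z3, Z4. split; [left; lra|lra].
        + exists yv, (- yu). rewrite Z1, Z2. split; [|split; ring].
          apply Hnz, Hn'.
      - exists xv, (- xu). split; [|split; [ring|unfold D in H0; lra]].
        apply Hnz, Hn. }
    destruct Hk as [a [b [Hab [E1 E2]]]]. specialize (Hpos a b Hab).
    rewrite E1, E2 in Hpos. pose proof (Rle_0_sqr (a * tu + b * tv)) as Hsq.
    unfold Rsqr in Hsq. lra. }
  set (l := (tu * yv - tv * yu) / D). set (m := (xu * tv - xv * tu) / D).
  assert (Etu : tu = l * xu + m * yu) by (unfold l, m, D in *; field; exact HD).
  assert (Etv : tv = l * xv + m * yv) by (unfold l, m, D in *; field; exact HD).
  destruct (strict_local_inverse xf yf u v xu xv yu yv Sx Sy HD) as [[K [r [HK [Hr Hlip]]]] Honto].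
  (* The topology of S is that of the parameter domain, by continuity of psi. *)
  assert (Hpar : forall e, 0 < e -> exists d, 0 < d /\ forall q, S q -> near d p q ->
     exists u' v', in_box e u v u' v' /\ phi (u', v') = q).
  { intros e He.
    destruct (HV p HVp) as [[dV HdV] HV'].
    specialize (Hcont p (conj Hp HVp)). rewrite Ez in Hcont.
    destruct (Hcont (fun w => ball (u, v) e w)) as [[d Hd] Hd'].
    { exists (mkposreal e He). intros w Hw. exact Hw. }
    exists (Rmin dV d). split; [apply Rmin_pos; assumption|].
    intros q Hq [N1 [N2 N3]].
    pose proof (Rmin_l dV d) as M1. pose proof (Rmin_r dV d) as M2.
    assert (HVq : V q).
    { apply HV'. split; [split|]; simpl.
      - apply Rlt_le_trans with (1 := N1); exact M1.
      - apply Rlt_le_trans with (1 := N2); exact M1.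
      - apply Rlt_le_trans with (1 := N3); exact M1. }
    assert (Hb : ball (u, v) e (psi q)).
    { apply Hd'; [|split; assumption]. split; [split|]; simpl.
      - apply Rlt_le_trans with (1 := N1); exact M2.
      - apply Rlt_le_trans with (1 := N2); exact M2.
      - apply Rlt_le_trans with (1 := N3); exact M2. }
    destruct (psi q) as [u' v'] eqn:Eq. exists u', v'. split.
    - exact Hb.
    - rewrite <- Eq. apply (Hpsi q (conj Hq HVq)). }
  exists l, m. split; [|split].
  - destruct (Req_dec (l * l + m * m) 0) as [E|E]; [lra|].
    (* apply Hpos to the parameter direction which projects onto (l, m) *)
    set (a := (yv * l - xv * m) / D). set (b := (xu * m - yu * l) / D).
    assert (Ex : a * xu + b * xv = l) by (unfold a, b, D in *; field; exact HD).
    assert (Ey : a * yu + b * yv = m) by (unfold a, b, D in *; field; exact HD).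
    assert (Hab : a <> 0 \/ b <> 0).
    { destruct (Req_dec a 0); [|left; assumption].
      destruct (Req_dec b 0); [|right; assumption].
      exfalso. apply E. rewrite <- Ex, <- Ey, H, H0. ring. }
    specialize (Hpos a b Hab). rewrite Ex, Ey in Hpos.
    replace (a * tu + b * tv) with (l * (a * xu + b * xv) + m * (a * yu + b * yv)) in Hpos
      by (rewrite Etu, Etv; ring).
    rewrite Ex, Ey in Hpos. nra.
  - intros eps He.
    set (k := 1 + Rabs l + Rabs m).
    pose proof (Rabs_pos l) as Pl. pose proof (Rabs_pos m) as Pm.
    assert (Hk : 0 < k) by (unfold k; lra).
    set (e := eps / (k * K)).
    assert (He' : 0 < e) by (apply Rdiv_lt_0_compat; [exact He|apply Rmult_lt_0_compat; assumption]).
    destruct (Sx e He') as [d1 [Hd1 E1]]. destruct (Sy e He') as [d2 [Hd2 E2]].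
    destruct (St e He') as [d3 [Hd3 E3]].
    set (dd := Rmin r (Rmin d1 (Rmin d2 d3))).
    assert (Hdd : 0 < dd) by (repeat apply Rmin_pos; assumption).
    assert (Ls : dd <= r /\ dd <= d1 /\ dd <= d2 /\ dd <= d3).
    { unfold dd, Rmin; repeat destruct Rle_dec; lra. }
    destruct (Hpar dd Hdd) as [d [Hd Hd']].
    exists d. split; [exact Hd|]. intros q q' Sq Sq' Nq Nq'.
    destruct (Hd' q Sq Nq) as [a [b [[Ha Hb] Eq]]].
    destruct (Hd' q' Sq' Nq') as [a' [b' [[Ha' Hb'] Eq']]].
    assert (B1 := E1 a b a' b' ltac:(split; lra) ltac:(split; lra)).
    assert (B2 := E2 a b a' b' ltac:(split; lra) ltac:(split; lra)).
    assert (B3 := E3 a b a' b' ltac:(split; lra) ltac:(split; lra)).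
    assert (B0 := Hlip a b a' b' ltac:(split; lra) ltac:(split; lra)).
    unfold xf, yf, tf in B0, B1, B2, B3. rewrite Eq, Eq' in B0, B1, B2, B3.
    set (dx := px q - px q') in *. set (dy := py q - py q') in *. set (dt := pt q - pt q') in *.
    set (n := Rabs (a - a') + Rabs (b - b')) in *.
    replace (dt - (l * dx + m * dy))
      with ((dt - (tu * (a - a') + tv * (b - b')))
            - l * (dx - (xu * (a - a') + xv * (b - b')))
            - m * (dy - (yu * (a - a') + yv * (b - b')))) by (rewrite Etu, Etv; ring).
    set (e1 := dx - _) in *. set (e2 := dy - _) in *. set (e3 := dt - _) in *.
    apply Rle_trans with (k * (e * n)).
    + unfold Rminus. eapply Rle_trans; [apply Rabs_triang|]. rewrite Rabs_Ropp, Rabs_mult.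
      pose proof (Rabs_triang e3 (- (l * e1))) as T. rewrite Rabs_Ropp, Rabs_mult in T.
      unfold k. nra.
    + apply Rle_trans with (k * (e * (K * (Rabs dx + Rabs dy)))).
      * apply Rmult_le_compat_l; [lra|]. apply Rmult_le_compat_l; lra.
      * right. unfold e. field. lra.
  - intros eps He.
    set (k := 1 + Rabs tu + Rabs tv + Rabs xu + Rabs xv + Rabs yu + Rabs yv).
    assert (Hk : 1 <= k).
    { unfold k. pose proof (Rabs_pos tu). pose proof (Rabs_pos tv). pose proof (Rabs_pos xu).
      pose proof (Rabs_pos xv). pose proof (Rabs_pos yu). pose proof (Rabs_pos yv). lra. }
    destruct (Sx 1 Rlt_0_1) as [d1 [Hd1 E1]]. destruct (Sy 1 Rlt_0_1) as [d2 [Hd2 E2]].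
    destruct (St 1 Rlt_0_1) as [d3 [Hd3 E3]].
    destruct (open_box U u v HU Huv) as [d4 [Hd4 Hbox]].
    set (dd := Rmin (eps / (4 * k)) (Rmin (Rmin d1 d4) (Rmin d2 d3))).
    assert (Hek : 0 < eps / (4 * k)) by (apply Rdiv_lt_0_compat; lra).
    assert (Hdd : 0 < dd) by (repeat apply Rmin_pos; assumption).
    assert (Ls : dd <= eps / (4 * k) /\ dd <= d1 /\ dd <= d2 /\ dd <= d3 /\ dd <= d4).
    { unfold dd. clearbody k. unfold Rmin; repeat destruct Rle_dec; lra. }
    destruct (Honto dd Hdd) as [d [Hd Hd']].
    exists d. split; [exact Hd|]. intros x y Hxy.
    unfold xf at 1, yf at 1 in Hd'. rewrite Hpp in Hd'.
    destruct (Hd' x y Hxy) as [a [b [[Ha Hb] [Ex Ey]]]].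
    exists (phi (a, b)).
    assert (Hab : U (a, b)) by (apply Hbox; split; lra).
    destruct (Hphi _ Hab) as [[HSq _] _].
    split; [exact HSq|]. split; [|split; [exact Ex|exact Ey]].
    assert (Hsmall : forall f fa fb, Rabs fa + Rabs fb + 1 <= k ->
       Rabs (f a b - f u v - (fa * (a - u) + fb * (b - v))) <= 1 * (Rabs (a - u) + Rabs (b - v)) ->
       Rabs (f a b - f u v) < eps).
    { intros f fa fb Hf Hfe.
      assert (Hk' : k * dd <= eps / 4).
      { apply Rle_trans with (k * (eps / (4 * k))); [apply Rmult_le_compat_l; lra|right; field; lra]. }
      replace (f a b - f u v) with
        ((f a b - f u v - (fa * (a - u) + fb * (b - v))) + (fa * (a - u) + fb * (b - v))) by ring.
      eapply Rle_lt_trans; [apply Rabs_triang|].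
      pose proof (Rabs_triang (fa * (a - u)) (fb * (b - v))) as T. rewrite !Rabs_mult in T.
      pose proof (Rabs_pos fa). pose proof (Rabs_pos fb).
      pose proof (Rabs_pos (a - u)). pose proof (Rabs_pos (b - v)). nra. }
    assert (Hu0 : in_box dd u v u v) by (split; rewrite Rminus_diag, Rabs_R0; exact Hdd).
    assert (P6 := Rabs_pos tu). assert (P1 := Rabs_pos tv). assert (P2 := Rabs_pos xu).
    assert (P3 := Rabs_pos xv). assert (P4 := Rabs_pos yu). assert (P5 := Rabs_pos yv).
    destruct Hu0 as [H1 H2].
    rewrite <- Hpp. split; [|split].
    + apply (Hsmall xf xu xv); [unfold k; lra|]. apply E1; split; lra.
    + apply (Hsmall yf yu yv); [unfold k; lra|]. apply E2; split; lra.
    + apply (Hsmall tf tu tv); [unfold k; lra|]. apply E3; split; lra.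
Qed.

(** * Curves in a spacelike graph and the induced distance *)

Definition everywhere_spacelike_graph (S : R3 -> Prop) : Prop :=
  forall p, S p -> exists l m, spacelike_graph_at S p l m.

Lemma square_le_abs (x y : R) : x * x <= y * y -> 0 <= y -> Rabs x <= y.
Proof. intros H Hy. apply Rabs_le_between. split; nra. Qed.

(** In particular a point of [S] near [p] is determined by its vertical projection. *)
Lemma graph_locally_lipschitz (S : R3 -> Prop) (p : R3) (l m : R) :
  spacelike_graph_at S p l m ->
  exists d, 0 < d /\ forall q q', S q -> S q' -> near d p q -> near d p q' ->
    Rabs (pt q - pt q') <= Rabs (px q - px q') + Rabs (py q - py q').
Proof.
  intros [Hlm [Htilt _]].
  assert (Hl : Rabs l < 1) by (apply Rabs_def1; nra).
  assert (Hm : Rabs m < 1) by (apply Rabs_def1; nra).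
  set (e := 1 - Rmax (Rabs l) (Rabs m)).
  assert (He : 0 < e) by (unfold e, Rmax; destruct Rle_dec; lra).
  assert (El : Rabs l <= 1 - e) by (unfold e; pose proof (Rmax_l (Rabs l) (Rabs m)); lra).
  assert (Em : Rabs m <= 1 - e) by (unfold e; pose proof (Rmax_r (Rabs l) (Rabs m)); lra).
  destruct (Htilt e He) as [d [Hd Hd']]. exists d. split; [exact Hd|].
  intros q q' Sq Sq' Nq Nq'. specialize (Hd' q q' Sq Sq' Nq Nq').
  set (dx := px q - px q') in *. set (dy := py q - py q') in *. set (dt := pt q - pt q') in *.
  replace dt with ((dt - (l * dx + m * dy)) + (l * dx + m * dy)) by ring.
  eapply Rle_trans; [apply Rabs_triang|].
  pose proof (Rabs_triang (l * dx) (m * dy)) as T. rewrite !Rabs_mult in T.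
  pose proof (Rabs_pos dx). pose proof (Rabs_pos dy). nra.
Qed.

Lemma derivative_of_tilt (x y t : R -> R) (s x' y' t' l m eps : R) :
  is_derive x s x' -> is_derive y s y' -> is_derive t s t' ->
  (exists d, 0 < d /\ forall u, Rabs (u - s) < d ->
     Rabs (t u - t s - (l * (x u - x s) + m * (y u - y s)))
       <= eps * (Rabs (x u - x s) + Rabs (y u - y s))) ->
  0 <= eps -> Rabs (t' - (l * x' + m * y')) <= eps * (Rabs x' + Rabs y').
Proof.
  intros Hx Hy Ht [d0 [Hd0 H]] Heps.
  set (k := 1 + Rabs l + Rabs m + 2 * eps).
  assert (Hk : 0 < k) by (unfold k; pose proof (Rabs_pos l); pose proof (Rabs_pos m); lra).
  apply le_epsilon. intros e He.
  assert (Hek : 0 < e / k) by (apply Rdiv_lt_0_compat; lra).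
  destruct (proj1 (is_derive_eps _ _ _) Hx _ Hek) as [d1 [Hd1 H1]].
  destruct (proj1 (is_derive_eps _ _ _) Hy _ Hek) as [d2 [Hd2 H2]].
  destruct (proj1 (is_derive_eps _ _ _) Ht _ Hek) as [d3 [Hd3 H3]].
  set (d := Rmin (Rmin d0 d1) (Rmin d2 d3)).
  assert (Hd : 0 < d) by (repeat apply Rmin_pos; assumption).
  assert (Ls : d <= d0 /\ d <= d1 /\ d <= d2 /\ d <= d3).
  { unfold d, Rmin; repeat destruct Rle_dec; lra. }
  set (h := d / 2).
  assert (E : s + h - s = h) by ring.
  assert (Hh : Rabs h = h) by (apply Rabs_pos_eq; unfold h; lra).
  specialize (H (s + h)). specialize (H1 (s + h)). specialize (H2 (s + h)). specialize (H3 (s + h)).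
  rewrite E, Hh in H, H1, H2, H3.
  assert (Hhd : 0 < h < d) by (unfold h; lra).
  specialize (H ltac:(lra)). specialize (H1 ltac:(lra)). specialize (H2 ltac:(lra)). specialize (H3 ltac:(lra)).
  set (dx := x (s + h) - x s) in *. set (dy := y (s + h) - y s) in *. set (dt := t (s + h) - t s) in *.
  assert (Hkk : e / k * k = e) by (field; lra).
  set (q := e / k) in *. clearbody q h dx dy dt.
  apply Rmult_le_reg_r with h; [lra|].
  rewrite <- Hh at 1. rewrite <- Rabs_mult.
  replace ((t' - (l * x' + m * y')) * h)
    with ((dt - (l * dx + m * dy)) + (- (dt - t' * h) + (l * (dx - x' * h) + m * (dy - y' * h)))) by ring.
  eapply Rle_trans; [apply Rabs_triang|].
  assert (A1 : Rabs (- (dt - t' * h) + (l * (dx - x' * h) + m * (dy - y' * h)))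
     <= q * h + (Rabs l * (q * h) + Rabs m * (q * h))).
  { eapply Rle_trans; [apply Rabs_triang|]. rewrite Rabs_Ropp.
    apply Rplus_le_compat; [exact H3|].
    eapply Rle_trans; [apply Rabs_triang|]. rewrite !Rabs_mult.
    apply Rplus_le_compat; apply Rmult_le_compat_l; auto using Rabs_pos. }
  assert (A2 : Rabs dx <= Rabs x' * h + q * h).
  { replace dx with (x' * h + (dx - x' * h)) by ring.
    eapply Rle_trans; [apply Rabs_triang|]. rewrite Rabs_mult, Hh. lra. }
  assert (A3 : Rabs dy <= Rabs y' * h + q * h).
  { replace dy with (y' * h + (dy - y' * h)) by ring.
    eapply Rle_trans; [apply Rabs_triang|]. rewrite Rabs_mult, Hh. lra. }
  apply Rle_trans with (eps * ((Rabs x' * h + q * h) + (Rabs y' * h + q * h))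
     + (q * h + (Rabs l * (q * h) + Rabs m * (q * h)))).
  - apply Rplus_le_compat; [|exact A1]. apply Rle_trans with (1 := H).
    apply Rmult_le_compat_l; lra.
  - rewrite <- Hkk. unfold k. right. ring.
Qed.

(** A lift of a C^1 plane curve to [S] which is only assumed continuous is C^1, because [S] is
    locally the graph of a C^1 function, and it is not steeper than the light cone. *)
Lemma lift_differentiable (S : R3 -> Prop) (a b t a' b' : R -> R) :
  everywhere_spacelike_graph S ->
  (forall s, is_derive a s (a' s)) -> (forall s, is_derive b s (b' s)) ->
  (forall s, continuity_pt a' s) -> (forall s, continuity_pt b' s) ->
  (forall s, continuity_pt t s) ->
  (forall s, S (a s, b s, t s)) ->
  exists t' : R -> R, (forall s, is_derive t s (t' s)) /\
    (forall s, continuity_pt t' s) /\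
    (forall s, t' s * t' s <= a' s * a' s + b' s * b' s).
Proof.
  intros Hg Ha Hb Ha' Hb' Ht HS.
  assert (Hchoice : forall s, exists lm : R * R,
     spacelike_graph_at S (a s, b s, t s) (fst lm) (snd lm)).
  { intros s. destruct (Hg _ (HS s)) as [l [m H]]. exists (l, m). exact H. }
  set (lm := fun s => proj1_sig (constructive_indefinite_description _ (Hchoice s))).
  assert (Hlm : forall s, spacelike_graph_at S (a s, b s, t s) (fst (lm s)) (snd (lm s))).
  { intros s. unfold lm. destruct constructive_indefinite_description. assumption. }
  clearbody lm.
  assert (Hnear : forall s d, 0 < d -> exists r, 0 < r /\
     forall u, Rabs (u - s) < r -> near d (a s, b s, t s) (a u, b u, t u)).
  { intros s d Hd.
    destruct (proj1 (continuity_pt_eps _ _) (is_derive_continuity_pt _ _ _ (Ha s)) d Hd) as [r1 [R1 H1]].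
    destruct (proj1 (continuity_pt_eps _ _) (is_derive_continuity_pt _ _ _ (Hb s)) d Hd) as [r2 [R2 H2]].
    destruct (proj1 (continuity_pt_eps _ _) (Ht s) d Hd) as [r3 [R3' H3]].
    set (r := Rmin r1 (Rmin r2 r3)).
    assert (Ls : r <= r1 /\ r <= r2 /\ r <= r3) by (unfold r, Rmin; repeat destruct Rle_dec; lra).
    exists r. split; [unfold r; repeat apply Rmin_pos; assumption|].
    intros u Hu. repeat split; [apply H1|apply H2|apply H3]; lra. }
  assert (Hd : forall s, is_derive t s (fst (lm s) * a' s + snd (lm s) * b' s)).
  { intros s. destruct (Hlm s) as [_ [Htilt _]]. set (l := fst (lm s)) in *. set (m := snd (lm s)) in *.
    apply is_derive_eps. intros e He.
    set (k := Rabs (a' s) + Rabs (b' s) + 2 + Rabs l + Rabs m).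
    pose proof (Rabs_pos (a' s)) as P1. pose proof (Rabs_pos (b' s)) as P2.
    pose proof (Rabs_pos l) as P3. pose proof (Rabs_pos m) as P4.
    assert (Hk : 0 < k) by (unfold k; lra).
    assert (Hek : 0 < e / k) by (apply Rdiv_lt_0_compat; lra).
    set (q := Rmin 1 (e / k)).
    assert (Hq : 0 < q) by (apply Rmin_pos; lra).
    assert (Hq1 : q <= 1) by apply Rmin_l.
    assert (Hqk : q * k <= e).
    { apply Rle_trans with (e / k * k); [apply Rmult_le_compat_r; [lra|apply Rmin_r]|right; field; lra]. }
    destruct (Htilt q Hq) as [d [Hdp Hd']].
    destruct (Hnear s d Hdp) as [r [Hr Hr']].
    destruct (proj1 (is_derive_eps _ _ _) (Ha s) q Hq) as [d1 [Hd1 H1]].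
    destruct (proj1 (is_derive_eps _ _ _) (Hb s) q Hq) as [d2 [Hd2 H2]].
    set (dd := Rmin r (Rmin d1 d2)).
    assert (Ls : dd <= r /\ dd <= d1 /\ dd <= d2) by (unfold dd, Rmin; repeat destruct Rle_dec; lra).
    exists dd. split; [unfold dd; repeat apply Rmin_pos; assumption|].
    intros y Hy. specialize (H1 y ltac:(lra)). specialize (H2 y ltac:(lra)).
    assert (Hn0 : near d (a s, b s, t s) (a s, b s, t s)).
    { repeat split; rewrite Rminus_diag, Rabs_R0; exact Hdp. }
    specialize (Hd' _ _ (HS y) (HS s) (Hr' y ltac:(lra)) Hn0).
    unfold px, py, pt in Hd'. simpl in Hd'.
    set (da := a y - a s) in *. set (db := b y - b s) in *. set (dt := t y - t s) in *.
    set (h := y - s) in *. pose proof (Rabs_pos h).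
    replace (dt - (l * a' s + m * b' s) * h)
      with ((dt - (l * da + m * db)) + (l * (da - a' s * h) + m * (db - b' s * h))) by ring.
    eapply Rle_trans; [apply Rabs_triang|].
    pose proof (Rabs_triang (l * (da - a' s * h)) (m * (db - b' s * h))) as T.
    rewrite !Rabs_mult in T.
    assert (A2 : Rabs da <= (Rabs (a' s) + q) * Rabs h).
    { replace da with (a' s * h + (da - a' s * h)) by ring.
      eapply Rle_trans; [apply Rabs_triang|]. rewrite Rabs_mult. lra. }
    assert (A3 : Rabs db <= (Rabs (b' s) + q) * Rabs h).
    { replace db with (b' s * h + (db - b' s * h)) by ring.
      eapply Rle_trans; [apply Rabs_triang|]. rewrite Rabs_mult. lra. }
    assert (B1 : Rabs l * Rabs (da - a' s * h) <= Rabs l * (q * Rabs h)) by (apply Rmult_le_compat_l; assumption).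
    assert (B2 : Rabs m * Rabs (db - b' s * h) <= Rabs m * (q * Rabs h)) by (apply Rmult_le_compat_l; assumption).
    assert (B3 : q * (Rabs da + Rabs db) <= q * ((Rabs (a' s) + 1 + Rabs (b' s) + 1) * Rabs h)).
    { apply Rmult_le_compat_l; [lra|]. nra. }
    apply Rle_trans with (q * k * Rabs h); [unfold k; lra|].
    apply Rmult_le_compat_r; assumption. }
  exists (fun s => fst (lm s) * a' s + snd (lm s) * b' s).
  split; [exact Hd|]. split.
  - intros s. apply continuity_pt_eps. intros e He.
    destruct (Hlm s) as [_ [Htilt _]]. set (l := fst (lm s)) in *. set (m := snd (lm s)) in *.
    set (k := Rabs (a' s) + Rabs (b' s) + 2 + Rabs l + Rabs m).
    pose proof (Rabs_pos (a' s)) as P1. pose proof (Rabs_pos (b' s)) as P2.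
    pose proof (Rabs_pos l) as P3. pose proof (Rabs_pos m) as P4.
    assert (Hk : 0 < k) by (unfold k; lra).
    assert (Hek : 0 < e / (2 * k)) by (apply Rdiv_lt_0_compat; lra).
    set (q := Rmin 1 (e / (2 * k))).
    assert (Hq : 0 < q) by (apply Rmin_pos; lra).
    assert (Hq1 : q <= 1) by apply Rmin_l.
    assert (Hqk : q * k <= e / 2).
    { apply Rle_trans with (e / (2 * k) * k); [apply Rmult_le_compat_r; [lra|apply Rmin_r]|right; field; lra]. }
    destruct (Htilt q Hq) as [d [Hdp Hd']].
    destruct (Hnear s d Hdp) as [r [Hr Hr']].
    destruct (proj1 (continuity_pt_eps _ _) (Ha' s) q Hq) as [d1 [Hd1 H1]].
    destruct (proj1 (continuity_pt_eps _ _) (Hb' s) q Hq) as [d2 [Hd2 H2]].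
    set (dd := Rmin r (Rmin d1 d2)).
    assert (Hdd : 0 < dd) by (unfold dd; repeat apply Rmin_pos; assumption).
    assert (Ls : dd <= r /\ dd <= d1 /\ dd <= d2) by (unfold dd, Rmin; repeat destruct Rle_dec; lra).
    exists dd. split; [exact Hdd|].
    intros y Hy. specialize (H1 y ltac:(lra)). specialize (H2 y ltac:(lra)).
    assert (A : Rabs (fst (lm y) * a' y + snd (lm y) * b' y - (l * a' y + m * b' y))
        <= q * (Rabs (a' y) + Rabs (b' y))).
    { apply derivative_of_tilt with (x := a) (y := b) (t := t) (s := y); auto; [|lra].
      exists (dd - Rabs (y - s)). split; [lra|]. intros u Hu.
      specialize (Hd' _ _ (HS u) (HS y)). unfold px, py, pt in Hd'. simpl in Hd'.
      apply Hd'; [|apply Hr'; lra]. apply Hr'.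
      replace (u - s) with ((u - y) + (y - s)) by ring.
      eapply Rle_lt_trans; [apply Rabs_triang|]. lra. }
    replace (fst (lm y) * a' y + snd (lm y) * b' y - (l * a' s + m * b' s))
      with ((fst (lm y) * a' y + snd (lm y) * b' y - (l * a' y + m * b' y))
        + (l * (a' y - a' s) + m * (b' y - b' s))) by ring.
    eapply Rle_lt_trans; [apply Rabs_triang|].
    pose proof (Rabs_triang (l * (a' y - a' s)) (m * (b' y - b' s))) as T.
    rewrite !Rabs_mult in T.
    assert (A2 : Rabs (a' y) <= Rabs (a' s) + 1).
    { replace (a' y) with (a' s + (a' y - a' s)) by ring.
      eapply Rle_trans; [apply Rabs_triang|]. lra. }
    assert (A3 : Rabs (b' y) <= Rabs (b' s) + 1).
    { replace (b' y) with (b' s + (b' y - b' s)) by ring.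
      eapply Rle_trans; [apply Rabs_triang|]. lra. }
    assert (B1 : Rabs l * Rabs (a' y - a' s) <= Rabs l * q) by (apply Rmult_le_compat_l; lra).
    assert (B2 : Rabs m * Rabs (b' y - b' s) <= Rabs m * q) by (apply Rmult_le_compat_l; lra).
    assert (B3 : q * (Rabs (a' y) + Rabs (b' y)) <= q * (Rabs (a' s) + 1 + Rabs (b' s) + 1)).
    { apply Rmult_le_compat_l; lra. }
    apply Rle_lt_trans with (q * k); [unfold k; lra|lra].
  - intros s. destruct (Hlm s) as [Hn _].
    set (l := fst (lm s)) in *. set (m := snd (lm s)) in *.
    set (A := a' s). set (B := b' s).
    pose proof (Rle_0_sqr (l * B - m * A)) as H0. unfold Rsqr in H0.
    pose proof (Rle_0_sqr A) as HA. pose proof (Rle_0_sqr B) as HB. unfold Rsqr in HA, HB. nra.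
Qed.

Lemma induced_dist_path (S : R3 -> Prop) (p q : R3) (e : R) :
  Rbar_lt (induced_dist S p q) e -> exists c, C1_path S p q c /\ path_length c < e.
Proof.
  intros H. apply NNPP. intros Hn.
  apply (Rbar_lt_not_le _ _ H).
  apply (Glb_Rbar_correct (fun l => exists c, C1_path S p q c /\ l = path_length c)).
  intros l [c [Hc Hl]]. simpl. apply Rnot_lt_le. intros Hlt. apply Hn.
  exists c. rewrite <- Hl. auto.
Qed.

Lemma path_induced_dist (S : R3 -> Prop) (p q : R3) (c : R -> R3) (e : R) :
  C1_path S p q c -> path_length c < e -> Rbar_lt (induced_dist S p q) e.
Proof.
  intros Hc Hl.
  apply Rbar_le_lt_trans with (Finite (path_length c)); [|exact Hl].
  apply (Glb_Rbar_correct (fun l => exists c, C1_path S p q c /\ l = path_length c)).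
  exists c. auto.
Qed.

(** Near a spacelike plane the Euclidean length of a vector is controlled by its Lorentzian
    length. *)
Lemma spacelike_speed_bound (l m : R) :
  l * l + m * m < 1 ->
  exists C eps, 0 < C /\ 0 < eps /\ forall x y t,
    Rabs (t - (l * x + m * y)) <= eps * (Rabs x + Rabs y) ->
    Rabs x <= C * sqrt (x * x + y * y - t * t) /\
    Rabs y <= C * sqrt (x * x + y * y - t * t) /\
    Rabs t <= C * sqrt (x * x + y * y - t * t).
Proof.
  intros Hlm. set (k := sqrt (l * l + m * m)).
  assert (H0 : 0 <= l * l + m * m) by nra.
  assert (Hk0 : 0 <= k) by apply sqrt_pos.
  assert (Hkk : k * k = l * l + m * m) by (apply sqrt_sqrt; exact H0).
  assert (Hk1 : k < 1) by nra.
  set (k' := (1 + k) / 2).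
  assert (Hk' : 0 < 1 - k' * k') by (unfold k'; nra).
  set (w := sqrt (1 - k' * k')).
  assert (Hw : 0 < w) by (apply sqrt_lt_R0; exact Hk').
  assert (Hww : w * w = 1 - k' * k') by (apply sqrt_sqrt; lra).
  exists (/ w), ((1 - k) / 4). split; [apply Rinv_0_lt_compat; exact Hw|]. split; [lra|].
  intros x y t Ht.
  set (n := sqrt (x * x + y * y)).
  assert (Hn2 : 0 <= x * x + y * y) by nra.
  assert (Hn0 : 0 <= n) by apply sqrt_pos.
  assert (Hnn : n * n = x * x + y * y) by (apply sqrt_sqrt; exact Hn2).
  assert (Hx : Rabs x <= n) by (apply square_le_abs; nra).
  assert (Hy : Rabs y <= n) by (apply square_le_abs; nra).
  assert (Hlin : Rabs (l * x + m * y) <= k * n).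
  { apply square_le_abs; [|apply Rmult_le_pos; assumption].
    replace (k * n * (k * n)) with ((k * k) * (n * n)) by ring. rewrite Hkk, Hnn.
    pose proof (Rle_0_sqr (l * y - m * x)) as Hs. unfold Rsqr in Hs. lra. }
  assert (Ht' : Rabs t <= k' * n).
  { replace t with ((t - (l * x + m * y)) + (l * x + m * y)) by ring.
    eapply Rle_trans; [apply Rabs_triang|]. unfold k'. nra. }
  assert (Htt : t * t <= k' * k' * (n * n)).
  { pose proof (Rabs_pos t). replace (t * t) with (Rabs t * Rabs t).
    - replace (k' * k' * (n * n)) with ((k' * n) * (k' * n)) by ring.
      apply Rmult_le_compat; assumption.
    - rewrite <- Rabs_mult. apply Rabs_pos_eq. nra. }
  assert (Hb : n <= / w * sqrt (x * x + y * y - t * t)).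
  { apply Rmult_le_reg_l with w; [exact Hw|].
    rewrite <- Rmult_assoc, Rinv_r, Rmult_1_l by lra.
    apply Rsqr_incr_0; [|apply Rmult_le_pos; lra|apply sqrt_pos].
    unfold Rsqr. rewrite sqrt_sqrt by (rewrite <- Hnn; nra).
    replace (w * n * (w * n)) with ((w * w) * (n * n)) by ring. rewrite Hww, <- Hnn. nra. }
  assert (Ht1 : Rabs t <= n) by (unfold k' in Ht'; nra).
  repeat split; lra.
Qed.

(** While a path is in a box around [p] where the tangent planes are uniformly spacelike, its
    Euclidean speed is at most a constant times its Lorentzian speed. A path to [p] which is too short
    to come from the boundary of the box therefore stays inside. *)
Lemma short_path_near (S : R3 -> Prop) (p : R3) (l m : R) :
  spacelike_graph_at S p l m -> forall eps, 0 < eps ->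
  exists e, 0 < e /\ forall q, Rbar_lt (induced_dist S q p) e -> near eps p q.
Proof.
  intros [Hlm [Htilt _]] eps Heps.
  destruct (spacelike_speed_bound l m Hlm) as [C [e0 [HC [He0 Hspeed]]]].
  destruct (Htilt e0 He0) as [d [Hd Hbox]].
  set (dd := Rmin d eps).
  assert (Hdd : 0 < dd) by (apply Rmin_pos; assumption).
  assert (L1 : dd <= d) by apply Rmin_l. assert (L2 : dd <= eps) by apply Rmin_r.
  exists (dd / C). split; [apply Rdiv_lt_0_compat; assumption|].
  intros q Hq. destruct (induced_dist_path S q p _ Hq) as [c [[Hder [Hcont [HSc [Hc0 Hc1]]]] Hlen]].
  set (x := fun u => px (c u)). set (y := fun u => py (c u)). set (t := fun u => pt (c u)).
  assert (dx : forall s, is_derive x s (Derive x s)) by (intros s; apply Derive_correct, Hder).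
  assert (dy : forall s, is_derive y s (Derive y s)) by (intros s; apply Derive_correct, Hder).
  assert (dt : forall s, is_derive t s (Derive t s)) by (intros s; apply Derive_correct, Hder).
  set (sigma := fun s => sqrt (lsq (vderive c s))).
  assert (Hsigma : forall s, continuous sigma s).
  { intros s.
    assert (Cx : continuous (Derive x) s).
    { apply (continuous_comp (vderive c) px); [apply Hcont|].
      apply (continuous_comp (fst : R3 -> R * R) fst); apply continuous_fst. }
    assert (Cy : continuous (Derive y) s).
    { apply (continuous_comp (vderive c) py); [apply Hcont|].
      apply (continuous_comp (fst : R3 -> R * R) snd); [apply continuous_fst|apply continuous_snd]. }
    assert (Ct : continuous (Derive t) s).
    { apply (continuous_comp (vderive c) pt); [apply Hcont|]. apply continuous_snd. }
    apply (continuous_comp (fun s => lsq (vderive c s)) sqrt); [|apply continuous_sqrt].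
    apply (continuous_minus (fun s => Derive x s * Derive x s + Derive y s * Derive y s)
             (fun s => Derive t s * Derive t s)).
    - apply (continuous_plus (fun s => Derive x s * Derive x s) (fun s => Derive y s * Derive y s)).
      + apply (continuous_mult (Derive x) (Derive x)); assumption.
      + apply (continuous_mult (Derive y) (Derive y)); assumption.
    - apply (continuous_mult (Derive t) (Derive t)); assumption. }
  set (G := fun s => RInt sigma 0 s).
  assert (dG : forall s, is_derive G s (sigma s)).
  { intros s. apply is_derive_RInt with 0; [|apply Hsigma].
    exists (mkposreal 1 Rlt_0_1). intros b _. apply (RInt_correct sigma).
    apply (ex_RInt_continuous sigma). intros z _. apply Hsigma. }
  assert (HG0 : G 0 = 0) by exact (RInt_point 0 sigma).
  assert (HG1 : C * G 1 < dd).
  { change (G 1 < dd / C) in Hlen.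
    apply Rmult_lt_compat_l with (r := C) in Hlen; [|exact HC].
    replace (C * (dd / C)) with dd in Hlen by (field; lra). exact Hlen. }
  assert (Gmono : forall u v, u <= v -> G u <= G v).
  { intros u v Huv. apply (derive_nonneg_increasing G sigma u v Huv); intros; [apply dG|apply sqrt_pos]. }
  set (P := fun s => Rabs (x s - px p) <= C * (G 1 - G s) /\
     Rabs (y s - py p) <= C * (G 1 - G s) /\ Rabs (t s - pt p) <= C * (G 1 - G s)).
  assert (Hstep : forall s, 0 <= s <= 1 -> (forall u, s < u < 1 -> near d p (c u)) -> P s).
  { intros s Hs Hnear.
    assert (Hsp : forall u, s < u < 1 -> Rabs (Derive x u) <= C * sigma u /\
       Rabs (Derive y u) <= C * sigma u /\ Rabs (Derive t u) <= C * sigma u).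
    { intros u Hu. apply Hspeed.
      apply derivative_of_tilt with (x := x) (y := y) (t := t) (s := u); auto; [|lra].
      exists (Rmin (u - s) (1 - u)). split; [apply Rmin_pos; lra|]. intros v Hv.
      pose proof (Rmin_l (u - s) (1 - u)). pose proof (Rmin_r (u - s) (1 - u)).
      apply Rabs_def2 in Hv.
      apply Hbox; [apply HSc; lra|apply HSc; lra|apply Hnear; lra|apply Hnear; lra]. }
    assert (Hone : forall f f' : R -> R, (forall u, is_derive f u (f' u)) ->
       (forall u, s < u < 1 -> Rabs (f' u) <= C * sigma u) -> Rabs (f s - f 1) <= C * (G 1 - G s)).
    { intros f f' Hf Hf'.
      assert (A : C * G s + f s <= C * G 1 + f 1).
      { apply (derive_nonneg_increasing (fun u => C * G u + f u) (fun u => C * sigma u + f' u)); [lra| |].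
        - intros u _. apply (is_derive_plus (fun u => C * G u) f); [apply is_derive_scal, dG|apply Hf].
        - intros u Hu. specialize (Hf' u Hu). apply Rabs_le_between in Hf'. lra. }
      assert (B : C * G s - f s <= C * G 1 - f 1).
      { apply (derive_nonneg_increasing (fun u => C * G u - f u) (fun u => C * sigma u - f' u)); [lra| |].
        - intros u _. apply (is_derive_minus (fun u => C * G u) f); [apply is_derive_scal, dG|apply Hf].
        - intros u Hu. specialize (Hf' u Hu). apply Rabs_le_between in Hf'. lra. }
      apply Rabs_le_between. lra. }
    unfold P. rewrite <- Hc1.
    split; [|split].
    - apply (Hone x (Derive x) dx). intros u Hu. apply (Hsp u Hu).
    - apply (Hone y (Derive y) dy). intros u Hu. apply (Hsp u Hu).
    - apply (Hone t (Derive t) dt). intros u Hu. apply (Hsp u Hu). }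
  assert (Hin : forall s, 0 <= s -> P s -> near dd p (c s)).
  { intros s Hs [P1 [P2 P3]]. pose proof (Gmono 0 s Hs) as Hm. rewrite HG0 in Hm.
    assert (C * (G 1 - G s) <= C * G 1) by (apply Rmult_le_compat_l; lra).
    unfold x, y, t in P1, P2, P3. repeat split; lra. }
  assert (Hweak : forall q, near dd p q -> near d p q) by (intros r [N1 [N2 N3]]; repeat split; lra).
  (* induction along the path, backwards from its endpoint p *)
  assert (HP : forall u, 0 <= u <= 1 -> P (1 - u)).
  { apply (real_induction (fun u => P (1 - u))).
    - apply Hstep; [lra|]. intros u Hu. lra.
    - intros u Hu Hbefore. apply Hstep; [lra|]. intros v Hv. apply Hweak, Hin; [lra|].
      replace v with (1 - (1 - v)) by ring. apply Hbefore. lra.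
    - intros u Hu Hbefore.
      assert (N : near dd p (c (1 - u))) by (apply Hin; [lra|]; apply Hbefore; lra).
      destruct N as [N1 [N2 N3]].
      destruct (proj1 (continuity_pt_eps _ _) (is_derive_continuity_pt _ _ _ (dx (1 - u)))
        (dd - Rabs (x (1 - u) - px p))) as [r1 [R1 H1]]; [unfold x; lra|].
      destruct (proj1 (continuity_pt_eps _ _) (is_derive_continuity_pt _ _ _ (dy (1 - u)))
        (dd - Rabs (y (1 - u) - py p))) as [r2 [R2 H2]]; [unfold y; lra|].
      destruct (proj1 (continuity_pt_eps _ _) (is_derive_continuity_pt _ _ _ (dt (1 - u)))
        (dd - Rabs (t (1 - u) - pt p))) as [r3 [R3' H3]]; [unfold t; lra|].
      set (r := Rmin r1 (Rmin r2 r3)).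
      assert (Ls : r <= r1 /\ r <= r2 /\ r <= r3) by (unfold r, Rmin; repeat destruct Rle_dec; lra).
      exists r. split; [unfold r; repeat apply Rmin_pos; assumption|].
      intros u' Hu' Hu1. apply Hstep; [lra|]. intros v Hv. apply Hweak.
      destruct (Rle_dec (1 - u) v) as [Hge|Hlt].
      + apply Hin; [lra|]. replace v with (1 - (1 - v)) by ring. apply Hbefore. lra.
      + assert (Hv' : Rabs (v - (1 - u)) < r) by (apply Rabs_def1; lra).
        specialize (H1 v ltac:(lra)). specialize (H2 v ltac:(lra)). specialize (H3 v ltac:(lra)).
        assert (Tri : forall a b c, Rabs (a - c) <= Rabs (a - b) + Rabs (b - c)).
        { intros a0 b0 c0. replace (a0 - c0) with ((a0 - b0) + (b0 - c0)) by ring. apply Rabs_triang. }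
        pose proof (Tri (x v) (x (1 - u)) (px p)).
        pose proof (Tri (y v) (y (1 - u)) (py p)).
        pose proof (Tri (t v) (t (1 - u)) (pt p)).
        unfold x, y, t in *. repeat split; lra. }
  specialize (HP 1 ltac:(lra)). rewrite Rminus_diag in HP.
  destruct (Hin 0 (Rle_refl 0) HP) as [N1 [N2 N3]]. rewrite Hc0 in N1, N2, N3.
  repeat split; lra.
Qed.

(** * Lifting segments of the spatial plane *)

(** The Lipschitz bound, which holds for every continuous lift to a spacelike hypersurface, is part
    of the definition: it replaces compactness arguments for families of lifts. *)
Definition ray_lift (S : R3 -> Prop) (p : R3) (a b h : R) (tau : R -> R) : Prop :=
  tau 0 = pt p /\
  (forall r, 0 <= r <= h -> S (px p + r * a, py p + r * b, tau r)) /\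
  (forall r r', 0 <= r <= h -> 0 <= r' <= h ->
     Rabs (tau r - tau r') <= (Rabs a + Rabs b) * Rabs (r - r')).

(** The estimate propagates along the segment: near each of its points both lifts lie in a box where
    [graph_locally_lipschitz] compares them, and by the Lipschitz bounds neither can leave the box in a
    short time. *)
Lemma ray_lift_stable (S : R3 -> Prop) (p : R3) (a b h : R) (tau : R -> R) :
  everywhere_spacelike_graph S -> h <= 1 -> ray_lift S p a b h tau ->
  forall r, 0 <= r <= h -> exists d, 0 < d /\ forall a' b' tau',
    Rabs (a' - a) + Rabs (b' - b) < d -> ray_lift S p a' b' h tau' ->
    Rabs (tau' r - tau r) <= Rabs (a' - a) + Rabs (b' - b).
Proof.
  intros Hg HR [H0 [HS Hlip]].
  apply (interval_connected (fun r => exists d, 0 < d /\ forall a' b' tau',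
    Rabs (a' - a) + Rabs (b' - b) < d -> ray_lift S p a' b' h tau' ->
    Rabs (tau' r - tau r) <= Rabs (a' - a) + Rabs (b' - b))).
  { exists 1. split; [lra|]. intros a' b' tau' _ [H0' _].
    rewrite H0, H0', Rminus_diag, Rabs_R0.
    pose proof (Rabs_pos (a' - a)). pose proof (Rabs_pos (b' - b)). lra. }
  intros r Hr.
  destruct (Hg _ (HS r Hr)) as [l [m Hgr]].
  destruct (graph_locally_lipschitz _ _ _ _ Hgr) as [e [He Hbox]].
  set (K := Rabs a + Rabs b) in *.
  pose proof (Rabs_pos a) as Pa. pose proof (Rabs_pos b) as Pb.
  set (d := e / (8 * (K + 1))).
  assert (Hd : 0 < d) by (apply Rdiv_lt_0_compat; unfold K; lra).
  assert (Hde : (K + 1) * d = e / 8) by (unfold d; field; unfold K; lra).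
  exists d. split; [exact Hd|]. intros r1 r2 Hr1 Hr2 N1 N2 [d1 [Hd1 HP]].
  exists (Rmin d1 (Rmin 1 (e / 8))). split; [repeat apply Rmin_pos; lra|].
  intros a' b' tau' Hab Hl'.
  assert (Ls : Rmin d1 (Rmin 1 (e / 8)) <= d1 /\ Rmin d1 (Rmin 1 (e / 8)) <= 1
               /\ Rmin d1 (Rmin 1 (e / 8)) <= e / 8) by (unfold Rmin; repeat destruct Rle_dec; lra).
  specialize (HP a' b' tau' ltac:(lra) Hl'). destruct Hl' as [_ [HS' Hlip']].
  set (n := Rabs (a' - a) + Rabs (b' - b)) in *.
  assert (Tri : forall x y z, Rabs (x - z) <= Rabs (x - y) + Rabs (y - z)).
  { intros x y z. replace (x - z) with ((x - y) + (y - z)) by ring. apply Rabs_triang. }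
  assert (Hn : Rabs (a' - a) <= n /\ Rabs (b' - b) <= n).
  { unfold n. pose proof (Rabs_pos (a' - a)). pose proof (Rabs_pos (b' - b)). lra. }
  assert (HKr : K * Rabs (r2 - r) <= e / 8).
  { rewrite <- Hde. apply Rmult_le_compat; try lra; [unfold K; lra|apply Rabs_pos]. }
  assert (HKr1 : K * Rabs (r1 - r) <= e / 8).
  { rewrite <- Hde. apply Rmult_le_compat; try lra; [unfold K; lra|apply Rabs_pos]. }
  assert (Hc : forall c c', Rabs c <= K -> Rabs (c' - c) <= n ->
            Rabs (r2 * c - r * c) < e /\ Rabs (r2 * c' - r * c) < e /\ Rabs (r2 * c' - r2 * c) <= Rabs (c' - c)).
  { intros c c' Hc Hc'.
    assert (A1 : Rabs (r2 * c - r * c) <= e / 8).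
    { replace (r2 * c - r * c) with (c * (r2 - r)) by ring. rewrite Rabs_mult.
      apply Rle_trans with (2 := HKr). apply Rmult_le_compat_r; [apply Rabs_pos|exact Hc]. }
    assert (A2 : Rabs (r2 * c' - r2 * c) <= Rabs (c' - c)).
    { replace (r2 * c' - r2 * c) with (r2 * (c' - c)) by ring. rewrite Rabs_mult, (Rabs_pos_eq r2) by lra.
      pose proof (Rabs_pos (c' - c)). nra. }
    pose proof (Tri (r2 * c') (r2 * c) (r * c)). repeat split; lra. }
  destruct (Hc a a') as [A1 [A2 A3]]; [unfold K; lra|apply Hn|].
  destruct (Hc b b') as [B1 [B2 B3]]; [unfold K; lra|apply Hn|].
  assert (HK' : Rabs a' + Rabs b' <= K + 1).
  { pose proof (Tri a' a 0). pose proof (Tri b' b 0). rewrite !Rminus_0_r in *. unfold K, n in *. lra. }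
  assert (T1 : Rabs (tau r2 - tau r) < e) by (pose proof (Hlip r2 r Hr2 Hr); lra).
  assert (T2 : Rabs (tau' r2 - tau r) < e).
  { pose proof (Tri (tau' r2) (tau' r1) (tau r)). pose proof (Tri (tau' r1) (tau r1) (tau r)).
    pose proof (Hlip r1 r Hr1 Hr).
    pose proof (Hlip' r2 r1 Hr2 Hr1).
    pose proof (Tri r2 r r1) as Trr. rewrite (Rabs_minus_sym r r1) in Trr.
    assert ((Rabs a' + Rabs b') * Rabs (r2 - r1) <= (K + 1) * (d + d)).
    { apply Rmult_le_compat; try lra; [|apply Rabs_pos].
      pose proof (Rabs_pos a'). pose proof (Rabs_pos b'). lra. }
    lra. }
  specialize (Hbox _ _ (HS' r2 Hr2) (HS r2 Hr2)).
  unfold near, px, py, pt in Hbox. simpl in Hbox.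
  fold (px p) (py p) in Hbox.
  assert (E : forall x y z : R, x + y - (x + z) = y - z) by (intros; ring).
  rewrite !E in Hbox. specialize (Hbox (conj A2 (conj B2 T2)) (conj A1 (conj B1 T1))).
  unfold n. lra.
Qed.

Lemma ray_lift_unique (S : R3 -> Prop) (p : R3) (a b h : R) (tau tau' : R -> R) :
  everywhere_spacelike_graph S -> h <= 1 -> ray_lift S p a b h tau -> ray_lift S p a b h tau' ->
  forall r, 0 <= r <= h -> tau r = tau' r.
Proof.
  intros Hg HR Hl Hl' r Hr.
  destruct (ray_lift_stable S p a b h tau Hg HR Hl r Hr) as [d [Hd H]].
  specialize (H a b tau'). rewrite !Rminus_diag, Rabs_R0, Rplus_0_r in H. specialize (H Hd Hl').
  pose proof (Rabs_pos (tau' r - tau r)). symmetry. apply Rminus_diag_uniq, NNPP.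
  intros Hn. apply Rabs_pos_lt in Hn. lra.
Qed.

Lemma ray_lift_restrict (S : R3 -> Prop) (p : R3) (a b h h' : R) (tau : R -> R) :
  h' <= h -> ray_lift S p a b h tau -> ray_lift S p a b h' tau.
Proof.
  intros HR [H0 [HS Hlip]]. split; [exact H0|]. split.
  - intros r Hr. apply HS. lra.
  - intros r r' Hr Hr'. apply Hlip; lra.
Qed.

Lemma continuous_pair {U V W : UniformSpace} (f : U -> V) (g : U -> W) (x : U) :
  continuous f x -> continuous g x -> continuous (fun u => (f u, g u)) x.
Proof.
  intros Hf Hg. apply (continuous_comp_2 f g (fun a b => (a, b)) x Hf Hg).
  apply continuous_ext with (fun z => z); [intros [u v]; reflexivity|apply continuous_id].
Qed.

(** The vertical projection of a spacelike hypersurface does not decrease lengths, so that the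
    induced distance along a lift is bounded by the distance in the plane. *)
Lemma segment_path (S : R3 -> Prop) (p : R3) (a b h : R) (T : R -> R) :
  everywhere_spacelike_graph S ->
  (forall r, 0 <= r < h -> S (px p + r * a, py p + r * b, T r)) ->
  (forall r r', 0 <= r < h -> 0 <= r' < h ->
     Rabs (T r - T r') <= (Rabs a + Rabs b) * Rabs (r - r')) ->
  forall r r', 0 <= r < h -> 0 <= r' < h ->
  exists c, C1_path S (px p + r * a, py p + r * b, T r) (px p + r' * a, py p + r' * b, T r') c /\
    path_length c <= 2 * (Rabs a + Rabs b) * Rabs (r' - r).
Proof.
  intros Hg HS Hlip r r' Hr Hr'.
  set (K := Rabs a + Rabs b) in *.
  pose proof (Rabs_pos a) as Pa. pose proof (Rabs_pos b) as Pb.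
  (* Reparametrized by a cosine, the segment gives a C^1 path on the whole line which stays over it. *)
  set (rho := fun s => r + (r' - r) * ((1 - cos (PI * s)) / 2)).
  set (rho' := fun s => (r' - r) * (PI / 2 * sin (PI * s))).
  assert (drho : forall s, is_derive rho s (rho' s)).
  { intros s. unfold rho, rho'. auto_derive; [exact I|field]. }
  assert (Hrho : forall s, 0 <= rho s < h).
  { intros s. unfold rho. pose proof (COS_bound (PI * s)).
    set (w := (1 - cos (PI * s)) / 2). assert (0 <= w <= 1) by (unfold w; lra).
    replace (r + (r' - r) * w) with (r * (1 - w) + r' * w) by ring. split; [nra|].
    destruct (Req_dec w 0) as [-> | Hw]; [lra|].
    apply Rlt_le_trans with (r * (1 - w) + h * w); [|nra].
    apply Rplus_lt_compat_l, Rmult_lt_compat_r; lra. }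
  assert (Crho : forall s, continuity_pt rho s).
  { intros s. apply is_derive_continuity_pt with (1 := drho s). }
  assert (Crho' : forall s, continuity_pt rho' s).
  { intros s. apply (is_derive_continuity_pt rho' s ((r' - r) * (PI / 2 * (PI * cos (PI * s))))).
    unfold rho'. auto_derive; [exact I|ring]. }
  assert (Hlin : forall x c s, is_derive (fun s => x + rho s * c) s (rho' s * c)).
  { intros x c s. replace (rho' s * c) with (0 + rho' s * c) by ring.
    apply (is_derive_plus (fun _ => x) (fun s => rho s * c)); [exact (is_derive_const (V := R_NormedModule) x s)|].
    rewrite (Rmult_comm (rho' s)). apply is_derive_ext with (fun s => c * rho s); [intros; apply Rmult_comm|].
    apply is_derive_scal, drho. }
  destruct (lift_differentiable S (fun s => px p + rho s * a) (fun s => py p + rho s * b)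
    (fun s => T (rho s)) (fun s => rho' s * a) (fun s => rho' s * b))
    as [t' [Dt [Ct Bt]]]; auto.
  { intros s. apply continuity_pt_mult; [apply Crho'|apply continuity_pt_const; intros u v; reflexivity]. }
  { intros s. apply continuity_pt_mult; [apply Crho'|apply continuity_pt_const; intros u v; reflexivity]. }
  { intros s. apply continuity_pt_eps. intros e He.
    assert (HeK : 0 < e / (K + 1)) by (apply Rdiv_lt_0_compat; unfold K; lra).
    destruct (proj1 (continuity_pt_eps _ _) (Crho s) _ HeK) as [d [Hd Hd']].
    exists d. split; [exact Hd|]. intros y Hy. specialize (Hd' y Hy).
    eapply Rle_lt_trans; [apply Hlip; apply Hrho|]. fold K.
    assert (E : (K + 1) * (e / (K + 1)) = e) by (field; unfold K; lra).
    pose proof (Rabs_pos (rho y - rho s)). set (q := e / (K + 1)) in *.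
    assert (0 <= K) by (unfold K; lra). nra. }
  set (c := fun s => (px p + rho s * a, py p + rho s * b, T (rho s)) : R3).
  assert (Hv : forall s, vderive c s = (rho' s * a, rho' s * b, t' s)).
  { intros s. unfold vderive. f_equal; [f_equal|]; apply is_derive_unique.
    - apply Hlin.
    - apply Hlin.
    - apply Dt. }
  assert (rho0 : rho 0 = r) by (unfold rho; rewrite Rmult_0_r, cos_0; field).
  assert (rho1 : rho 1 = r') by (unfold rho; rewrite Rmult_1_r, cos_PI; field).
  assert (Ca : forall x s, continuous (fun s => rho' s * x) s).
  { intros x s. apply continuity_pt_filterlim, continuity_pt_mult;
      [apply Crho'|apply continuity_pt_const; intros u v; reflexivity]. }
  assert (Ct' : forall s, continuous t' s) by (intros s; apply continuity_pt_filterlim, Ct).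
  exists c. split.
  - split; [|split; [|split; [|split]]].
    + intros s. split; [|split].
      * exists (rho' s * a). apply Hlin.
      * exists (rho' s * b). apply Hlin.
      * exists (t' s). apply Dt.
    + intros s. apply continuous_ext with (fun s => (rho' s * a, rho' s * b, t' s) : R3).
      { intros u. symmetry. apply Hv. }
      apply continuous_pair; [|apply Ct'].
      apply continuous_pair; apply Ca.
    + intros s _. apply HS, Hrho.
    + unfold c. rewrite rho0. reflexivity.
    + unfold c. rewrite rho1. reflexivity.
  - unfold path_length.
    replace (2 * K * Rabs (r' - r)) with (RInt (fun _ => 2 * K * Rabs (r' - r)) 0 1).
    2:{ rewrite RInt_const. unfold scal; simpl; unfold mult; simpl. ring. }
    assert (Hext : forall s, sqrt (lsq (vderive c s))
       = sqrt (rho' s * a * (rho' s * a) + rho' s * b * (rho' s * b) - t' s * t' s)).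
    { intros s. rewrite Hv. reflexivity. }
    apply RInt_le; [lra| |apply ex_RInt_const|].
    + apply (ex_RInt_continuous (fun s => sqrt (lsq (vderive c s)))). intros s _.
      apply continuous_ext with (fun s => sqrt (rho' s * a * (rho' s * a) + rho' s * b * (rho' s * b) - t' s * t' s)).
      { intros u. symmetry. apply Hext. }
      apply (continuous_comp (fun s => rho' s * a * (rho' s * a) + rho' s * b * (rho' s * b) - t' s * t' s) sqrt);
        [|apply continuous_sqrt].
      apply (continuous_minus (fun s => rho' s * a * (rho' s * a) + rho' s * b * (rho' s * b)) (fun s => t' s * t' s)).
      * apply (continuous_plus (fun s => rho' s * a * (rho' s * a)) (fun s => rho' s * b * (rho' s * b))).
        -- apply (continuous_mult (fun s => rho' s * a) (fun s => rho' s * a)); apply Ca.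
        -- apply (continuous_mult (fun s => rho' s * b) (fun s => rho' s * b)); apply Ca.
      * apply (continuous_mult t' t'); apply Ct'.
    + intros s _. rewrite Hext.
      set (w := Rabs (r' - r)). pose proof (Rabs_pos (r' - r)) as Hw. fold w in Hw.
      assert (Hrw : Rabs (rho' s) <= 2 * w).
      { unfold rho'. rewrite Rabs_mult. fold w. rewrite (Rmult_comm 2).
        apply Rmult_le_compat_l; [exact Hw|]. pose proof (SIN_bound (PI * s)).
        pose proof PI_4. pose proof PI_RGT_0. apply Rabs_le_between. nra. }
      set (q := rho' s) in *. clearbody q w.
      rewrite <- (sqrt_square (2 * K * w)) by (unfold K; nra).
      apply sqrt_le_1_alt.
      apply Rle_trans with (q * q * (K * K)).
      * assert (Haa : a * a = Rabs a * Rabs a) by (rewrite <- Rabs_mult; symmetry; apply Rabs_pos_eq; nra).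
        assert (Hbb : b * b = Rabs b * Rabs b) by (rewrite <- Rabs_mult; symmetry; apply Rabs_pos_eq; nra).
        pose proof (Rle_0_sqr (t' s)) as Ht2. unfold Rsqr in Ht2.
        pose proof (Rle_0_sqr q) as Hq2. unfold Rsqr in Hq2.
        apply Rle_trans with (q * q * (a * a + b * b)); [lra|].
        apply Rmult_le_compat_l; [exact Hq2|]. rewrite Haa, Hbb. unfold K. nra.
      * replace (2 * K * w * (2 * K * w)) with ((2 * w) * (2 * w) * (K * K)) by ring.
        apply Rmult_le_compat_r; [unfold K; nra|].
        replace (q * q) with (Rabs q * Rabs q) by (rewrite <- Rabs_mult; apply Rabs_pos_eq; nra).
        pose proof (Rabs_pos q). apply Rmult_le_compat; lra.
Qed.

(** * A complete spacelike hypersurface contains an entire graph *)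

(** At the end of a lift the hypersurface is a graph over a disc, along which the lift goes on. *)
Lemma ray_lift_extend (S : R3 -> Prop) (p : R3) (a b h : R) (tau : R -> R) :
  everywhere_spacelike_graph S -> 0 <= h -> ray_lift S p a b h tau ->
  exists d, 0 < d /\ forall h', h < h' < h + d -> exists tau', ray_lift S p a b h' tau'.
Proof.
  intros Hg Hh [H0 [HS Hlip]].
  set (q := (px p + h * a, py p + h * b, tau h) : R3).
  assert (Sq : S q) by (apply HS; lra).
  destruct (Hg q Sq) as [l [m Hq]].
  destruct (graph_locally_lipschitz _ _ _ _ Hq) as [e [He Hbox]].
  destruct Hq as [_ [_ Honto]]. destruct (Honto e He) as [r0 [Hr0 Hr0']].
  set (K := Rabs a + Rabs b) in *.
  pose proof (Rabs_pos a) as Pa. pose proof (Rabs_pos b) as Pb.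
  set (d := r0 / (K + 1)).
  assert (Hd : 0 < d) by (apply Rdiv_lt_0_compat; unfold K; lra).
  assert (Hdr : d * (K + 1) = r0) by (unfold d; field; unfold K; lra).
  exists d. split; [exact Hd|]. intros h' Hh'.
  set (good := fun r z => S (px p + r * a, py p + r * b, z) /\ near e q (px p + r * a, py p + r * b, z)).
  assert (Hex : forall r, h <= r <= h' -> exists z, good r z).
  { intros r Hr.
    assert (Hc : forall x c, Rabs c <= K -> Rabs (x + r * c - (x + h * c)) < r0).
    { intros x c Hc. replace (x + r * c - (x + h * c)) with ((r - h) * c) by ring.
      rewrite Rabs_mult, (Rabs_pos_eq (r - h)) by lra. pose proof (Rabs_pos c). nra. }
    destruct (Hr0' (px p + r * a) (py p + r * b)) as [s [Ss [Ns [Ex Ey]]]].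
    { split; apply Hc; unfold K; lra. }
    exists (pt s). unfold good. rewrite <- Ex, <- Ey.
    destruct s as [[s1 s2] s3]. split; assumption. }
  set (tau' := fun r => if Rle_dec r h then tau r else epsilon (inhabits 0) (good r)).
  assert (Hle : forall r, r <= h -> tau' r = tau r).
  { intros r Hr. unfold tau'. destruct Rle_dec; [reflexivity|lra]. }
  assert (Hgood : forall r, h <= r <= h' -> good r (tau' r)).
  { intros r Hr. destruct (Req_dec r h) as [->|Hn].
    - rewrite Hle by lra. split; [exact Sq|]. 
      change (near e q q). repeat split; rewrite Rminus_diag, Rabs_R0; exact He.
    - unfold tau'. destruct Rle_dec; [lra|]. apply epsilon_spec, Hex. exact Hr. }
  exists tau'. split; [rewrite Hle by lra; exact H0|].
  assert (HS' : forall r, 0 <= r <= h' -> S (px p + r * a, py p + r * b, tau' r)).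
  { intros r Hr. destruct (Rle_dec r h) as [Hrh|Hrh]; [rewrite Hle by lra; apply HS; lra|].
    apply Hgood. lra. }
  split; [exact HS'|].
  assert (Hlow : forall r r', 0 <= r <= h -> 0 <= r' <= h -> Rabs (tau' r - tau' r') <= K * Rabs (r - r')).
  { intros r r' Hr Hr'. rewrite !Hle by lra. apply Hlip; lra. }
  assert (Hhigh : forall r r', h <= r <= h' -> h <= r' <= h' -> Rabs (tau' r - tau' r') <= K * Rabs (r - r')).
  { intros r r' Hr Hr'. destruct (Hgood r Hr) as [S1 N1]. destruct (Hgood r' Hr') as [S2 N2].
    specialize (Hbox _ _ S1 S2 N1 N2). unfold px, py, pt in Hbox. simpl in Hbox.
    fold (px p) (py p) in Hbox.
    replace (px p + r * a - (px p + r' * a)) with ((r - r') * a) in Hbox by ring.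
    replace (py p + r * b - (py p + r' * b)) with ((r - r') * b) in Hbox by ring.
    rewrite !Rabs_mult in Hbox. unfold K. lra. }
  assert (Hmix : forall r r', 0 <= r <= h -> h <= r' <= h' -> Rabs (tau' r - tau' r') <= K * Rabs (r - r')).
  { intros r r' Hr Hr'.
    replace (tau' r - tau' r') with ((tau' r - tau' h) + (tau' h - tau' r')) by ring.
    eapply Rle_trans; [apply Rabs_triang|].
    pose proof (Hlow r h Hr ltac:(lra)) as A. pose proof (Hhigh h r' ltac:(lra) Hr') as B.
    rewrite (Rabs_left1 (r - h)) in A by lra. rewrite (Rabs_left1 (h - r')) in B by lra.
    rewrite (Rabs_left1 (r - r')) by lra. lra. }
  intros r r' Hr Hr'.
  destruct (Rle_dec r h); destruct (Rle_dec r' h).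
  - apply Hlow; lra.
  - apply Hmix; lra.
  - rewrite (Rabs_minus_sym (tau' r)), (Rabs_minus_sym r). apply Hmix; lra.
  - apply Hhigh; lra.
Qed.

(** By [segment_path] the points of the lift form a Cauchy sequence for the induced distance as the
    parameter tends to [h]. Completeness yields a limit in [S], and [short_path_near] shows that it is
    a limit in the ambient space, hence the missing endpoint. *)
Lemma ray_lift_limit (S : R3 -> Prop) (p : R3) (a b h : R) :
  everywhere_spacelike_graph S -> complete_submanifold S -> 0 < h <= 1 ->
  (forall r, 0 <= r < h -> exists tau, ray_lift S p a b r tau) ->
  exists tau, ray_lift S p a b h tau.
Proof.
  intros Hg Hcomp Hh Hex.
  set (K := Rabs a + Rabs b) in *.
  pose proof (Rabs_pos a) as Pa. pose proof (Rabs_pos b) as Pb.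
  set (L := fun r => epsilon (inhabits (fun _ : R => 0)) (ray_lift S p a b r)).
  assert (HL : forall r, 0 <= r < h -> ray_lift S p a b r (L r)).
  { intros r Hr. apply epsilon_spec, Hex, Hr. }
  set (T := fun r => L r r).
  assert (HTL : forall r r', 0 <= r <= r' -> r' < h -> T r = L r' r).
  { intros r r' Hr Hr'. change (L r r = L r' r). apply (ray_lift_unique S p a b r); auto; try lra; [apply HL; lra|].
    apply ray_lift_restrict with r'; [lra|apply HL; lra]. }
  assert (HT0 : T 0 = pt p) by (apply (HL 0); lra).
  assert (HTS : forall r, 0 <= r < h -> S (px p + r * a, py p + r * b, T r)).
  { intros r Hr. destruct (HL r Hr) as [_ [H _]]. apply H. lra. }
  assert (HTlip : forall r r', 0 <= r < h -> 0 <= r' < h -> Rabs (T r - T r') <= K * Rabs (r - r')).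
  { assert (H : forall r r', 0 <= r <= r' -> r' < h -> Rabs (T r - T r') <= K * Rabs (r - r')).
    { intros r r' Hr Hr'. rewrite (HTL r r' Hr Hr'). apply (HL r'); lra. }
    intros r r' Hr Hr'. destruct (Rle_dec r r'); [apply H; lra|].
    rewrite (Rabs_minus_sym (T r)), (Rabs_minus_sym r). apply H; lra. }
  set (rs := fun n => h - h / (INR n + 2)).
  assert (Hinv : forall n, 0 < h / (INR n + 2) <= h / 2).
  { intros n. pose proof (pos_INR n). split; [apply Rdiv_lt_0_compat; lra|].
    apply Rmult_le_compat_l; [lra|]. apply Rinv_le_contravar; lra. }
  assert (Hrs : forall n, 0 <= rs n < h) by (intros n; unfold rs; specialize (Hinv n); lra).
  assert (Hconv : forall e, 0 < e -> exists N, forall n, (N <= n)%nat -> h - rs n < e).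
  { intros e He. destruct (INR_archimed e h He) as [N HN]. exists N. intros n Hn.
    unfold rs. apply le_INR in Hn. pose proof (pos_INR n). pose proof (pos_INR N).
    replace (h - (h - h / (INR n + 2))) with (h / (INR n + 2)) by ring.
    apply Rmult_lt_reg_r with (INR n + 2); [lra|].
    unfold Rdiv. rewrite Rmult_assoc, Rinv_l by lra. nra. }
  set (x := fun n => (px p + rs n * a, py p + rs n * b, T (rs n)) : R3).
  destruct (Hcomp x) as [p' [Sp' Hp']].
  { intros n. apply HTS, Hrs. }
  { intros [e He]. simpl.
    destruct (Hconv (e / (4 * (K + 1)))) as [N HN]; [apply Rdiv_lt_0_compat; unfold K; lra|].
    exists N. intros n k Hn Hk.
    destruct (segment_path S p a b h T Hg HTS HTlip (rs n) (rs k) (Hrs n) (Hrs k)) as [c [Hc Hlen]].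
    apply path_induced_dist with c; [exact Hc|].
    eapply Rle_lt_trans; [exact Hlen|]. fold K.
    specialize (HN n Hn) as A. specialize (HN k Hk) as B.
    pose proof (Hrs n). pose proof (Hrs k).
    assert (E : 4 * (K + 1) * (e / (4 * (K + 1))) = e) by (field; unfold K; lra).
    set (q := e / (4 * (K + 1))) in *.
    assert (Rabs (rs k - rs n) <= q) by (apply Rabs_le_between; lra).
    assert (0 <= K) by (unfold K; lra). pose proof (Rabs_pos (rs k - rs n)). nra. }
  destruct (Hg p' Sp') as [l [m Hgr]].
  assert (Hnear : forall e, 0 < e -> exists N, forall n, (N <= n)%nat -> near e p' (x n)).
  { intros e He. destruct (short_path_near S p' l m Hgr e He) as [e' [He' H]].
    destruct (Hp' (mkposreal e' He')) as [N HN]. exists N. intros n Hn. apply H, HN, Hn. }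
  assert (Hclose : forall c, (forall e, 0 < e -> Rabs c <= e) -> c = 0).
  { intros c Hc. apply NNPP. intros Hn. apply Rabs_pos_lt in Hn.
    specialize (Hc (Rabs c / 2)). lra. }
  assert (Hboth : forall e, 0 < e -> exists n, near e p' (x n) /\ h - rs n < e).
  { intros e He. destruct (Hnear e He) as [N HN]. destruct (Hconv e He) as [N' HN'].
    exists (max N N'). split; [apply HN|apply HN']; lia. }
  assert (Hlin : forall u v c, (forall e, 0 < e -> exists n, Rabs (v + rs n * c - u) < e /\ h - rs n < e) ->
            u = v + h * c).
  { intros u v c H. apply Rminus_diag_uniq, Hclose. intros e He.
    pose proof (Rabs_pos c) as Pc.
    destruct (H (e / (1 + Rabs c))) as [n [A B]]; [apply Rdiv_lt_0_compat; lra|].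
    assert (E : (1 + Rabs c) * (e / (1 + Rabs c)) = e) by (field; lra).
    set (q := e / (1 + Rabs c)) in *.
    replace (u - (v + h * c)) with (- (v + rs n * c - u) + (rs n - h) * c) by ring.
    eapply Rle_trans; [apply Rabs_triang|]. rewrite Rabs_Ropp, Rabs_mult.
    pose proof (Hrs n). rewrite (Rabs_left1 (rs n - h)) by lra. nra. }
  assert (Ex : px p' = px p + h * a).
  { apply Hlin. intros e He. destruct (Hboth e He) as [n [[N1 _] N4]]. exists n. split; assumption. }
  assert (Ey : py p' = py p + h * b).
  { apply Hlin. intros e He. destruct (Hboth e He) as [n [[_ [N1 _]] N4]]. exists n. split; assumption. }
  assert (HTlim : forall r, 0 <= r < h -> Rabs (T r - pt p') <= K * (h - r)).
  { intros r Hr. apply le_epsilon. intros e He.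
    destruct (Hboth (Rmin e (h - r))) as [n [[_ [_ N3]] N4]]; [apply Rmin_pos; lra|].
    pose proof (Rmin_l e (h - r)). pose proof (Rmin_r e (h - r)).
    change (Rabs (T (rs n) - pt p') < Rmin e (h - r)) in N3.
    replace (T r - pt p') with ((T r - T (rs n)) + (T (rs n) - pt p')) by ring.
    eapply Rle_trans; [apply Rabs_triang|].
    pose proof (HTlip r (rs n) Hr (Hrs n)) as A.
    rewrite (Rabs_left1 (r - rs n)) in A by lra. pose proof (Hrs n).
    assert (0 <= K) by (unfold K; lra). nra. }
  exists (fun r => if Rlt_dec r h then T r else pt p').
  split; [|split].
  - destruct Rlt_dec; [exact HT0|lra].
  - intros r Hr. destruct Rlt_dec; [apply HTS; lra|].
    replace r with h by lra. rewrite <- Ex, <- Ey. destruct p' as [[u v] w]. exact Sp'.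
  - intros r r' Hr Hr'. fold K. destruct (Rlt_dec r h); destruct (Rlt_dec r' h).
    + apply HTlip; lra.
    + replace r' with h by lra. rewrite (Rabs_left1 (r - h)) by lra.
      replace (- (r - h)) with (h - r) by ring. apply HTlim; lra.
    + replace r with h by lra. rewrite (Rabs_minus_sym (pt p')), (Rabs_right (h - r')) by lra.
      apply HTlim; lra.
    + replace r with h by lra. replace r' with h by lra.
      rewrite !Rminus_diag, Rabs_R0. lra.
Qed.

Lemma ray_lift_exists (S : R3 -> Prop) (p : R3) (a b : R) :
  everywhere_spacelike_graph S -> complete_submanifold S -> S p ->
  exists tau, ray_lift S p a b 1 tau.
Proof.
  intros Hg Hcomp Sp.
  apply (real_induction (fun h => exists tau, ray_lift S p a b h tau) 0 1); [| | |lra].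
  - exists (fun _ => pt p). split; [reflexivity|]. split.
    + intros r Hr. replace r with 0 by lra. rewrite !Rmult_0_l, !Rplus_0_r.
      destruct p as [[u v] w]. exact Sp.
    + intros r r' _ _. rewrite Rminus_diag, Rabs_R0.
      pose proof (Rabs_pos a). pose proof (Rabs_pos b). pose proof (Rabs_pos (r - r')). nra.
  - intros h Hh Hex. apply ray_lift_limit; auto.
  - intros h Hh Hex. destruct (Hex h) as [tau Htau]; [lra|].
    destruct (ray_lift_extend S p a b h tau Hg) as [d [Hd Hd']]; [lra|exact Htau|].
    exists d. split; [exact Hd|]. intros h' H1 _. apply Hd', H1.
Qed.

(** The value at [(x, y)] is the endpoint of the lift, starting at [p], of the segment from the
    projection of [p] to [(x, y)]. *)
Lemma entire_graph (S : R3 -> Prop) (p : R3) :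
  everywhere_spacelike_graph S -> complete_submanifold S -> S p ->
  exists f : R -> R -> R,
    (forall x y, S (x, y, f x y)) /\ f (px p) (py p) = pt p /\
    (forall x y e, 0 < e -> exists d, 0 < d /\ forall x' y', in_box d x y x' y' ->
       Rabs (f x' y' - f x y) < e).
Proof.
  intros Hg Hcomp Sp.
  set (L := fun x y => epsilon (inhabits (fun _ : R => 0)) (ray_lift S p (x - px p) (y - py p) 1)).
  assert (HL : forall x y, ray_lift S p (x - px p) (y - py p) 1 (L x y)).
  { intros x y. apply epsilon_spec, ray_lift_exists; assumption. }
  exists (fun x y => L x y 1). split; [|split].
  - intros x y. destruct (HL x y) as [_ [H _]]. specialize (H 1 ltac:(lra)).
    replace (px p + 1 * (x - px p)) with x in H by ring.
    replace (py p + 1 * (y - py p)) with y in H by ring. exact H.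
  - destruct (HL (px p) (py p)) as [H0 [_ H]]. specialize (H 1 0 ltac:(lra) ltac:(lra)).
    rewrite !Rminus_diag, Rabs_R0, Rplus_0_l, Rmult_0_l in H.
    rewrite <- H0. apply Rminus_diag_uniq, NNPP. intros Hn. apply Rabs_pos_lt in Hn. lra.
  - intros x y e He.
    destruct (ray_lift_stable S p _ _ 1 _ Hg (Rle_refl 1) (HL x y) 1) as [d [Hd H]]; [lra|].
    exists (Rmin d e / 2).
    assert (Hm : 0 < Rmin d e) by (apply Rmin_pos; assumption).
    pose proof (Rmin_l d e). pose proof (Rmin_r d e).
    split; [lra|]. intros x' y' [Hx Hy].
    specialize (H (x' - px p) (y' - py p) (L x' y')).
    replace (x' - px p - (x - px p)) with (x' - x) in H by ring.
    replace (y' - py p - (y - py p)) with (y' - y) in H by ring.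
    specialize (H ltac:(lra) (HL x' y')). lra.
Qed.

(** The parameters at which the curve meets the graph form a closed set by continuity and an open
    set by local uniqueness. *)
Lemma connected_in_entire_graph (S : R3 -> Prop) (x y t : R -> R) :
  everywhere_spacelike_graph S -> complete_submanifold S ->
  (forall s, continuity_pt x s) -> (forall s, continuity_pt y s) -> (forall s, continuity_pt t s) ->
  (forall s, S (x s, y s, t s)) ->
  exists f : R -> R -> R, forall s, 0 <= s -> t s = f (x s) (y s).
Proof.
  intros Hg Hcomp Cx Cy Ct HS.
  destruct (entire_graph S _ Hg Hcomp (HS 0)) as [f [Hf [Hf0 Cf]]].
  exists f. intros s Hs.
  apply (interval_connected (fun s => t s = f (x s) (y s)) 0 s); [symmetry; exact Hf0| |lra].
  intros r Hr.
  assert (Hloc : forall e, 0 < e -> exists d, 0 < d /\ forall u, Rabs (u - r) < d ->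
    Rabs (x u - x r) < e /\ Rabs (y u - y r) < e /\ Rabs (t u - t r) < e /\
    Rabs (f (x u) (y u) - f (x r) (y r)) < e).
  { intros e He. destruct (Cf (x r) (y r) e He) as [d0 [Hd0 H0]].
    set (e' := Rmin e d0). assert (He' : 0 < e') by (apply Rmin_pos; assumption).
    assert (M1 : e' <= e) by apply Rmin_l. assert (M2 : e' <= d0) by apply Rmin_r.
    destruct (proj1 (continuity_pt_eps _ _) (Cx r) e' He') as [d1 [Hd1 H1]].
    destruct (proj1 (continuity_pt_eps _ _) (Cy r) e' He') as [d2 [Hd2 H2]].
    destruct (proj1 (continuity_pt_eps _ _) (Ct r) e' He') as [d3 [Hd3 H3]].
    set (d := Rmin d1 (Rmin d2 d3)).
    assert (Ls : d <= d1 /\ d <= d2 /\ d <= d3) by (unfold d, Rmin; repeat destruct Rle_dec; lra).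
    exists d. split; [unfold d; repeat apply Rmin_pos; assumption|]. intros u Hu.
    specialize (H1 u ltac:(lra)). specialize (H2 u ltac:(lra)). specialize (H3 u ltac:(lra)).
    repeat split; try lra. apply H0. split; lra. }
  destruct (Req_dec (t r) (f (x r) (y r))) as [E|E].
  - destruct (Hg _ (HS r)) as [l [m Hgr]].
    destruct (graph_locally_lipschitz _ _ _ _ Hgr) as [e [He Hbox]].
    destruct (Hloc e He) as [d [Hd H]]. exists d. split; [exact Hd|].
    intros w u _ _ _ Hu _. destruct (H u Hu) as [H1 [H2 [H3 H4]]].
    specialize (Hbox (x u, y u, t u) (x u, y u, f (x u) (y u)) (HS u) (Hf _ _)).
    unfold near, px, py, pt in Hbox. simpl in Hbox.
    rewrite <- E in H4. specialize (Hbox ltac:(auto) ltac:(auto)).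
    rewrite !Rminus_diag, Rabs_R0, Rplus_0_l in Hbox.
    apply Rminus_diag_uniq, NNPP. intros Hn. apply Rabs_pos_lt in Hn. lra.
  - set (e := Rabs (t r - f (x r) (y r)) / 2).
    assert (He : 0 < e) by (assert (Hn : t r - f (x r) (y r) <> 0) by lra; apply Rabs_pos_lt in Hn; unfold e; lra).
    destruct (Hloc e He) as [d [Hd H]]. exists d. split; [exact Hd|].
    intros u w _ _ Hu _ Eu. exfalso. destruct (H u Hu) as [_ [_ [H3 H4]]].
    rewrite Eu in H3.
    assert (Rabs (t r - f (x r) (y r)) < 2 * e); [|unfold e in *; lra].
    replace (t r - f (x r) (y r)) with (- (f (x u) (y u) - t r) + (f (x u) (y u) - f (x r) (y r))) by ring.
    eapply Rle_lt_trans; [apply Rabs_triang|]. rewrite Rabs_Ropp. lra.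
Qed.

(** * Closed curves with torsion of one sign *)

(** The reflections of [y] and of [t] change the signs of the planar curvature and of the
    determinant of the derivatives, which reduces the four cases to one. *)
Lemma one_signed_torsion_planar_up_to_symmetry
    (x y t x1 y1 t1 x2 y2 t2 x3 y3 t3 : R -> R) (L : R) :
  (forall s, is_derive x s (x1 s)) -> (forall s, is_derive y s (y1 s)) ->
  (forall s, is_derive t s (t1 s)) ->
  (forall s, is_derive x1 s (x2 s)) -> (forall s, is_derive y1 s (y2 s)) ->
  (forall s, is_derive t1 s (t2 s)) ->
  (forall s, is_derive x2 s (x3 s)) -> (forall s, is_derive y2 s (y3 s)) ->
  (forall s, is_derive t2 s (t3 s)) ->
  0 < L ->
  (forall s, x (s + L) = x s) -> (forall s, y (s + L) = y s) ->
  (forall s, t (s + L) = t s) ->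
  (forall s s', s < s' < s + L -> ~ (x s = x s' /\ y s = y s')) ->
  (forall s, x1 s * y2 s - y1 s * x2 s <> 0) ->
  let D := fun s => x1 s * (y2 s * t3 s - t2 s * y3 s) - y1 s * (x2 s * t3 s - t2 s * x3 s)
                  + t1 s * (x2 s * y3 s - y2 s * x3 s) in
  (forall s, 0 <= D s) \/ (forall s, D s <= 0) ->
  exists a b h, forall s, t s = a * x s + b * y s + h.
Proof.
  intros dx dy dt dx1 dy1 dt1 dx2 dy2 dt2 HL perx pery pert simple Hne D HD.
  set (Delta := fun s => x1 s * y2 s - y1 s * x2 s).
  assert (HDelta : exists i, i * i = 1 /\ forall s, 0 < i * Delta s).
  { assert (Hc : continuity Delta).
    { intros s. apply continuity_pt_minus; apply continuity_pt_mult;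
        eapply is_derive_continuity_pt; auto. }
    exists (if Rlt_dec 0 (Delta 0) then 1 else -1). split; [destruct Rlt_dec; ring|].
    assert (Hsame : forall s, 0 < Delta 0 * Delta s).
    { intros s. apply Rnot_le_lt. intros Hle.
      destruct (Rle_dec 0 s) as [H|H].
      - destruct (IVT_cor Delta 0 s Hc H Hle) as [z [_ Hz]]. exact (Hne z Hz).
      - destruct (IVT_cor Delta s 0 Hc) as [z [_ Hz]]; [lra|lra|]. exact (Hne z Hz). }
    intros s. specialize (Hsame s). destruct Rlt_dec; nra. }
  destruct HDelta as [i [Hi HDelta]].
  assert (HDs : exists j, j * j = 1 /\ forall s, 0 <= j * D s).
  { destruct HD as [HD|HD]; [exists 1|exists (-1)]; split; try ring; intros s; specialize (HD s); lra. }
  destruct HDs as [j [Hj HDs]].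
  assert (sc : forall k (f f' : R -> R), (forall s, is_derive f s (f' s)) ->
     forall s, is_derive (fun s => k * f s) s (k * f' s)).
  { intros k f f' Hf s. apply is_derive_scal, Hf. }
  assert (Hi0 : i <> 0) by (intros H; rewrite H in Hi; lra).
  assert (Hj0 : j <> 0) by (intros H; rewrite H in Hj; lra).
  destruct (one_signed_torsion_planar x (fun s => i * y s) (fun s => (i * j) * t s)
    x1 (fun s => i * y1 s) (fun s => (i * j) * t1 s) x2 (fun s => i * y2 s) (fun s => (i * j) * t2 s)
    x3 (fun s => i * y3 s) (fun s => (i * j) * t3 s) L) as [a [b [h H]]]; auto.
  - intros s. rewrite pery. reflexivity.
  - intros s. rewrite pert. reflexivity.
  - intros s s' Hs [E1 E2]. apply (simple s s' Hs). split; [exact E1|].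
    apply Rmult_eq_reg_l with i; assumption.
  - intros s. specialize (HDelta s). unfold Delta in HDelta. lra.
  - intros s. specialize (HDs s).
    replace (_ + _) with (i * i * (j * D s)) by (unfold D; ring). rewrite Hi, Rmult_1_l. exact HDs.
  - exists (i * j * a), (j * b), (i * j * h). intros s. specialize (H s).
    replace (t s) with (i * j * (i * j * t s))
      by (transitivity (i * i * (j * j) * t s); [ring|rewrite Hi, Hj; ring]).
    rewrite H.
    transitivity (i * j * a * x s + i * i * j * b * y s + i * j * h); [ring|rewrite Hi; ring].
Qed.

Lemma smooth_derivatives (f : R -> R) :
  (forall n s, ex_derive_n f n s) ->
  (forall s, is_derive f s (Derive f s)) /\
  (forall s, is_derive (Derive f) s (Derive (Derive f) s)) /\
  (forall s, is_derive (Derive (Derive f)) s (Derive (Derive (Derive f)) s)).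
Proof.
  intros H. split; [|split]; intros s; apply Derive_correct.
  - exact (H 1%nat s).
  - exact (H 2%nat s).
  - exact (H 3%nat s).
Qed.

Lemma velocity_tangent (S : R3 -> Prop) (gamma : R -> R3) (s : R) :
  smooth_curve_on (fun _ => True) gamma -> (forall u, S (gamma u)) ->
  tangent S (gamma s) (vderive gamma s).
Proof.
  intros Hsm HS. exists (mkposreal 1 Rlt_0_1), (fun u => gamma (u + s)).
  split; [|split; [|split]].
  - intros n u _. destruct (Hsm n (u + s) I) as [H1 [H2 H3]].
    split; [|split].
    + apply (ex_derive_n_comp_trans (fun v => px (gamma v))), H1.
    + apply (ex_derive_n_comp_trans (fun v => py (gamma v))), H2.
    + apply (ex_derive_n_comp_trans (fun v => pt (gamma v))), H3.
  - intros u _. apply HS.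
  - rewrite Rplus_0_l. reflexivity.
  - assert (E : forall f : R -> R, ex_derive f s -> Derive (fun u => f (u + s)) 0 = Derive f s).
    { intros f Hf. apply is_derive_unique.
      apply is_derive_ext with (fun u => f (s + u)); [intros u; f_equal; ring|].
      apply is_derive_shift. rewrite Rplus_0_r. apply Derive_correct, Hf. }
    destruct (Hsm 1%nat s I) as [H1 [H2 H3]].
    unfold vderive. f_equal; [f_equal|].
    + apply (E (fun v => px (gamma v))), H1.
    + apply (E (fun v => py (gamma v))), H2.
    + apply (E (fun v => pt (gamma v))), H3.
Qed.

(** The Gram determinant in the numerator is also, up to its sign, the square of the cross product
    of the first two derivatives, so that a spacelike curvature vector makes the latter timelike. *)
Lemma lsq_curvature_vector (gamma : R -> R3) (s : R) :
  smooth_curve_on (fun _ => True) gamma ->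
  (forall u, spacelike (vderive gamma u)) ->
  let g1 := vderive gamma s in let g2 := vderive (vderive gamma) s in
  lsq (curvature_vector gamma s) = (lsq g1 * lsq g2 - ldot g1 g2 * ldot g1 g2) / lsq g1 ^ 3.
Proof.
  intros Hsm Hsp.
  destruct (smooth_derivatives (fun u => px (gamma u)) (fun n u => proj1 (Hsm n u I))) as [_ [dx1 _]].
  destruct (smooth_derivatives (fun u => py (gamma u)) (fun n u => proj1 (proj2 (Hsm n u I)))) as [_ [dy1 _]].
  destruct (smooth_derivatives (fun u => pt (gamma u)) (fun n u => proj2 (proj2 (Hsm n u I)))) as [_ [dt1 _]].
  set (x1 := Derive (fun u => px (gamma u))) in *. set (y1 := Derive (fun u => py (gamma u))) in *.
  set (t1 := Derive (fun u => pt (gamma u))) in *.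
  set (x2 := Derive x1) in *. set (y2 := Derive y1) in *. set (t2 := Derive t1) in *.
  set (q := fun u => x1 u * x1 u + y1 u * y1 u - t1 u * t1 u).
  assert (Hq : forall u, 0 < q u) by exact Hsp.
  set (p := x1 s * x2 s + y1 s * y2 s - t1 s * t2 s).
  assert (dq : is_derive q s (2 * p)).
  { unfold q, p.
    assert (E1 : Derive (fun z => x1 z) s = x2 s) by reflexivity.
    assert (E2 : Derive (fun z => y1 z) s = y2 s) by reflexivity.
    assert (E3 : Derive (fun z => t1 z) s = t2 s) by reflexivity.
    assert (D1 : ex_derive (fun z => x1 z) s) by (eexists; apply dx1).
    assert (D2 : ex_derive (fun z => y1 z) s) by (eexists; apply dy1).
    assert (D3 : ex_derive (fun z => t1 z) s) by (eexists; apply dt1).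
    auto_derive; [repeat split; auto|]. rewrite E1, E2, E3. ring. }
  set (v := sqrt (q s)).
  assert (Hv : 0 < v) by (apply sqrt_lt_R0, Hq).
  assert (Hvv : v * v = q s) by (apply sqrt_sqrt, Rlt_le, Hq).
  assert (Hunit : forall f f2, is_derive f s f2 ->
     Derive (fun u => / sqrt (q u) * f u) s = / v * f2 - p / (q s * v) * f s).
  { intros f f2 Hf. apply is_derive_unique.
    assert (Ef : Derive (fun z => f z) s = f2) by (apply is_derive_unique, Hf).
    assert (Eq : Derive (fun z => q z) s = 2 * p) by (apply is_derive_unique, dq).
    assert (Df : ex_derive (fun z => f z) s) by (eexists; apply Hf).
    assert (Dq : ex_derive (fun z => q z) s) by (eexists; apply dq).
    auto_derive; [repeat split; auto; apply Rgt_not_eq; exact Hv|].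
    rewrite Ef, Eq. fold v. rewrite <- Hvv. field. lra. }
  assert (Hk : curvature_vector gamma s =
    (/ v * (/ v * x2 s - p / (q s * v) * x1 s),
     / v * (/ v * y2 s - p / (q s * v) * y1 s),
     / v * (/ v * t2 s - p / (q s * v) * t1 s))).
  { rewrite <- (Hunit x1 (x2 s)), <- (Hunit y1 (y2 s)), <- (Hunit t1 (t2 s)); [reflexivity|auto..]. }
  simpl. rewrite Hk.
  change (lsq (vderive gamma s)) with (q s).
  change (lsq (vderive (vderive gamma) s)) with (x2 s * x2 s + y2 s * y2 s - t2 s * t2 s).
  change (ldot (vderive gamma s) (vderive (vderive gamma) s)) with p.
  unfold lsq, ldot, px, py, pt. simpl.
  assert (HQ : x1 s * x1 s + y1 s * y1 s - t1 s * t1 s = v * v) by (symmetry; exact Hvv).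
  assert (HP : x1 s * x2 s + y1 s * y2 s - t1 s * t2 s = p) by reflexivity.
  rewrite <- Hvv. clearbody v p. clear dq Hunit Hk.
  transitivity (((v * v) ^ 2 * (x2 s * x2 s + y2 s * y2 s - t2 s * t2 s)
     - 2 * (v * v) * p * (x1 s * x2 s + y1 s * y2 s - t1 s * t2 s)
     + p ^ 2 * (x1 s * x1 s + y1 s * y1 s - t1 s * t1 s)) / v ^ 8); [field; lra|].
  rewrite HQ, HP. field. lra.
Qed.

Lemma hypersurface_curve_projection_simple (L : R) (gamma : R -> R3) (S : R3 -> Prop) :
  smooth_simple_closed_curve L gamma -> complete_spacelike_hypersurface S ->
  (forall s, S (gamma s)) ->
  forall s s', s < s' < s + L ->
    ~ (px (gamma s) = px (gamma s') /\ py (gamma s) = py (gamma s')).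
Proof.
  intros [HL [Hsm [_ [Hper Hinj]]]] [Hhyp [Hsp Hcomp]] Hin s s' Hs [Ex Ey].
  assert (Hg : everywhere_spacelike_graph S).
  { intros p Sp. apply spacelike_hypersurface_graph; assumption. }
  destruct (smooth_derivatives (fun u => px (gamma u)) (fun n u => proj1 (Hsm n u I))) as [dx _].
  destruct (smooth_derivatives (fun u => py (gamma u)) (fun n u => proj1 (proj2 (Hsm n u I)))) as [dy _].
  destruct (smooth_derivatives (fun u => pt (gamma u)) (fun n u => proj2 (proj2 (Hsm n u I)))) as [dt _].
  destruct (connected_in_entire_graph S (fun u => px (gamma u)) (fun u => py (gamma u))
    (fun u => pt (gamma u)) Hg Hcomp) as [f Hf].
  - intros u. eapply is_derive_continuity_pt, dx.
  - intros u. eapply is_derive_continuity_pt, dy.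
  - intros u. eapply is_derive_continuity_pt, dt.
  - intros u. specialize (Hin u). destruct (gamma u) as [[a b] c]. exact Hin.
  - destruct (period_reduction L s HL) as [k Hk].
    assert (Hmul : forall u, gamma (u + IZR k * L) = gamma u) by (apply periodic_multiple; exact Hper).
    assert (E : gamma (s + IZR k * L) = gamma (s' + IZR k * L)).
    { pose proof (Hf (s + IZR k * L) ltac:(lra)) as E1.
      pose proof (Hf (s' + IZR k * L) ltac:(lra)) as E2.
      simpl in E1, E2. rewrite !Hmul in *. rewrite Ex, Ey, <- E2 in E1.
      destruct (gamma s) as [[a b] c]. destruct (gamma s') as [[a' b'] c'].
      unfold px, py, pt in *. simpl in *. congruence. }
    destruct (Rlt_dec (s' + IZR k * L) L) as [Hlt|Hge].
    + apply Hinj in E; lra.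
    + rewrite <- (Rplus_0_r (s' + IZR k * L)), <- (Rplus_opp_l L), <- Rplus_assoc, Hper in E.
      apply Hinj in E; lra.
Qed.

Theorem theorem2 (L : R) (gamma : R -> R3) (S : R3 -> Prop)
    (hgamma : smooth_simple_closed_curve L gamma)
    (hS : complete_spacelike_hypersurface S)
    (hin : forall s, S (gamma s))
    (hcurv : forall s, spacelike (curvature_vector gamma s))
    (htau : (forall s, 0 <= torsion gamma s) \/ (forall s, torsion gamma s <= 0)) :
  (forall s, torsion gamma s = 0) /\ lies_in_plane gamma.
Proof.
  pose proof (hypersurface_curve_projection_simple L gamma S hgamma hS hin) as Hsimple.
  destruct hgamma as [HL [Hsm [Hreg [Hper _]]]]. destruct hS as [_ [Hsp _]].
  assert (Hvel : forall s, spacelike (vderive gamma s)).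
  { intros s. apply (Hsp (gamma s)); [apply hin|apply velocity_tangent; assumption|apply Hreg]. }
  destruct (smooth_derivatives (fun u => px (gamma u)) (fun n u => proj1 (Hsm n u I))) as [dx [dx1 dx2]].
  destruct (smooth_derivatives (fun u => py (gamma u)) (fun n u => proj1 (proj2 (Hsm n u I)))) as [dy [dy1 dy2]].
  destruct (smooth_derivatives (fun u => pt (gamma u)) (fun n u => proj2 (proj2 (Hsm n u I)))) as [dt [dt1 dt2]].
  set (x := fun u => px (gamma u)) in *. set (y := fun u => py (gamma u)) in *.
  set (t := fun u => pt (gamma u)) in *.
  set (x1 := Derive x) in *. set (y1 := Derive y) in *. set (t1 := Derive t) in *.
  set (x2 := Derive x1) in *. set (y2 := Derive y1) in *. set (t2 := Derive t1) in *.
  set (x3 := Derive x2) in *. set (y3 := Derive y2) in *. set (t3 := Derive t2) in *.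
  set (D := fun s => x1 s * (y2 s * t3 s - t2 s * y3 s) - y1 s * (x2 s * t3 s - t2 s * x3 s)
                  + t1 s * (x2 s * y3 s - y2 s * x3 s)).
  set (W := fun s => lsq (lcross (vderive gamma s) (vderive (vderive gamma) s))).
  assert (Htors : forall s, torsion gamma s = D s / W s).
  { intros s. transitivity (ldot (lcross (vderive gamma s) (vderive (vderive gamma) s))
      (vderive (vderive (vderive gamma)) s) / W s); [reflexivity|]. f_equal.
    change (ldot (lcross (x1 s, y1 s, t1 s) (x2 s, y2 s, t2 s)) (x3 s, y3 s, t3 s) = D s).
    unfold ldot, lcross, px, py, pt, D. simpl. ring. }
  assert (HW : forall s, W s < 0).
  { intros s. specialize (hcurv s). unfold spacelike in hcurv.
    rewrite (lsq_curvature_vector gamma s Hsm Hvel) in hcurv.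
    specialize (Hvel s). unfold spacelike in Hvel.
    set (g1 := vderive gamma s) in *. set (g2 := vderive (vderive gamma) s) in *.
    assert (Hgram : W s = - (lsq g1 * lsq g2 - ldot g1 g2 * ldot g1 g2)).
    { unfold W. fold g1 g2. unfold lsq, ldot, lcross, px, py, pt. simpl. ring. }
    rewrite Hgram. pose proof (pow_lt _ 3 Hvel) as H3.
    apply Rmult_lt_compat_r with (r := lsq g1 ^ 3) in hcurv; [|exact H3].
    unfold Rdiv in hcurv. rewrite Rmult_assoc, Rinv_l in hcurv by lra. lra. }
  assert (HDelta : forall s, x1 s * y2 s - y1 s * x2 s <> 0).
  { intros s E. specialize (HW s).
    change (lsq (lcross (x1 s, y1 s, t1 s) (x2 s, y2 s, t2 s)) < 0) in HW.
    unfold lsq, ldot, lcross, px, py, pt in HW. simpl in HW. rewrite E in HW.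
    pose proof (Rle_0_sqr (y1 s * t2 s - t1 s * y2 s)) as Q1.
    pose proof (Rle_0_sqr (t1 s * x2 s - x1 s * t2 s)) as Q2. unfold Rsqr in Q1, Q2. lra. }
  destruct (one_signed_torsion_planar_up_to_symmetry x y t x1 y1 t1 x2 y2 t2 x3 y3 t3 L)
    as [a [b [h H]]]; auto.
  { intros s. unfold x. rewrite Hper. reflexivity. }
  { intros s. unfold y. rewrite Hper. reflexivity. }
  { intros s. unfold t. rewrite Hper. reflexivity. }
  { change ((forall s, 0 <= D s) \/ (forall s, D s <= 0)).
    assert (HDW : forall s, D s = torsion gamma s * W s).
    { intros s. rewrite Htors. field. specialize (HW s). lra. }
    destruct htau as [Ht|Ht]; [right|left]; intros s; rewrite HDW;
      specialize (Ht s); specialize (HW s); nra. }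
  split.
  - assert (Hlin : forall (f f' g g' k k' : R -> R) (c : R), (forall s, is_derive f s (f' s)) ->
       (forall s, is_derive g s (g' s)) -> (forall s, is_derive k s (k' s)) ->
       (forall s, k s = a * f s + b * g s + c) -> forall s, k' s = a * f' s + b * g' s + 0).
    { intros f f' g g' k k' c Hf Hg Hk E s.
      rewrite <- (is_derive_unique _ _ _ (Hk s)). apply is_derive_unique.
      apply is_derive_ext with (fun s => a * f s + b * g s + c); [intros u; symmetry; apply E|].
      apply (is_derive_plus (fun s => a * f s + b * g s) (fun _ => c));
        [|exact (is_derive_const (V := R_NormedModule) c s)].
      apply (is_derive_plus (fun s => a * f s) (fun s => b * g s)); apply is_derive_scal; auto. }
    pose proof (Hlin x x1 y y1 t t1 h dx dy dt H) as H1.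
    pose proof (Hlin x1 x2 y1 y2 t1 t2 0 dx1 dy1 dt1 H1) as H2.
    pose proof (Hlin x2 x3 y2 y3 t2 t3 0 dx2 dy2 dt2 H2) as H3.
    intros s. rewrite Htors. replace (D s) with 0; [unfold Rdiv; ring|].
    unfold D. rewrite H1, H2, H3. ring.
  - exists a, b, (-1), (- h). split; [intros E; injection E; lra|].
    intros s. specialize (H s). unfold x, y, t in H. lra.
Qed.
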